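(* Suppose $\alpha>3/2$, $L>0$ and $\lambda\in(0,1)$. If $n$ and $p$ tend to infinity in such a way that $n=o(1)\,p^{2\alpha}$, then $$\widetilde\varphi=\big(n\sqrt p\;C^{1/2}(\alpha,L)\big)^{-\frac{2\alpha}{4\alpha+1}},\qquad C(\alpha,L)=\frac{2\alpha+1}{(4\alpha+1)^{1+1/(2\alpha)}}L^{-\frac1{2\alpha}},$$ is the asymptotically minimax separation rate for testing $$H_0:\ \Sigma^{-1}=I\qquad\text{against}\qquad H_1:\ \Sigma\in\mathcal G(\alpha,L,\lambda)\ \text{ such that }\ \frac1{2p}\|\Sigma^{-1}-I\|_F^2\ge\psi^2 .$$ That is, denoting by $R(\psi)$ the set of matrices $\Sigma$ satisfying $H_1$: for sequences $\psi=\psi_{n,p}>0$, if $\psi/\widetilde\varphi\to0$ then $\inf_\Delta\gamma(\Delta,R(\psi))\to1$, the infimum being over all test procedures; and if $\psi/\widetilde\varphi\to+\infty$ then there is a test procedure $\Delta^*$ (which may depend on $\psi$) with $\gamma(\Delta^*,R(\psi))\to0$.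
   Context: Model: $X_1,\dots,X_n$ are i.i.d. $p$-dimensional Gaussian vectors $\mathcal N_p(0,\Sigma)$, where $\Sigma=[\sigma_{ij}]_{1\le i,j\le p}$ is a covariance matrix with $\sigma_{ii}=1$ for all $i$. $\mathbb E_\Sigma$ denotes the corresponding expectation; $I$ is the $p\times p$ identity matrix; $\|\cdot\|_F$ is the Frobenius norm. $\alpha,L,\lambda$ are fixed. Classes: $\mathcal F(\alpha,L)$ is the set of $p\times p$ symmetric non-negative definite matrices $\Sigma$ with $\sigma_{ii}=1$ for all $i$ and $\frac1p\sum_{1\le i<j\le p}\sigma_{ij}^2|i-j|^{2\alpha}\le L$. $\mathcal G(\alpha,L,\lambda)$ is the set of $\Sigma\in\mathcal F(\alpha,L)$ all of whose eigenvalues satisfy $\lambda_i(\Sigma)\ge\lambda$, $i=1,\dots,p$. Error probabilities: a test procedure $\Delta$ is a measurable function of the observations $X_1,\dots,X_n$ with values in $[0,1]$. For a set $R$ of covariance matrices, $\gamma(\Delta,R)=\mathbb E_I(\Delta)+\sup_{\Sigma\in R}\mathbb E_\Sigma(1-\Delta)$. *)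

(* Defs.v *)
From HB Require Import structures.
From mathcomp Require Import all_boot all_order all_algebra ring lra.
From mathcomp Require Import all_classical all_reals all_analysis.
From mathcomp Require Import measurable_realfun.
Import Order.TTheory GRing.Theory Num.Theory.
Import numFieldNormedType.Exports.

Set Implicit Arguments.
Unset Strict Implicit.
Unset Printing Implicit Defensive.

Local Open Scope classical_set_scope.
Local Open Scope ring_scope.

Definition psdmx (R : realFieldType) p (S : 'M[R]_p) : Prop :=
  S^T = S /\ forall v : 'rV[R]_p, 0 <= (v *m S *m v^T) 0 0.

Lemma chol_exists (R : rcfType) p (S : 'M[R]_p) : psdmx S ->
  exists A : 'M[R]_p, is_trig_mx A /\ A *m A^T = S.
Proof.
elim: p S => [|p IH] S [symS posS].
  by exists 0; split; [exact: mx0_is_trig|apply/matrixP => -[]].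
pose S' : 'M[R]_(1 + p) := S.
pose a := S' 0 0; pose w := dlsubmx S'; pose T := drsubmx S'.
have wE : ursubmx S' = w^T by rewrite /w trmx_dlsub /S' symS.
have TT : T^T = T by rewrite /T trmx_drsub /S' symS.
have SE : S' = block_mx a%:M w^T w T.
  by rewrite -[LHS]submxK wE [ulsubmx _]mx11_scalar !mxE !lshift0.
have posS1 (v : 'rV[R]_(1 + p)) : 0 <= (v *m S' *m v^T) 0 0 by exact: posS.
have q x (u : 'rV[R]_p) :
    0 <= x ^+ 2 * a + x * (u *m w) 0 0 *+ 2 + (u *m T *m u^T) 0 0.
  have := posS1 (row_mx x%:M u); rewrite SE.
  rewrite tr_row_mx mul_row_block mul_row_col !mulmxDl.
  have -> : x%:M *m w^T *m u^T = (u *m w *m x%:M)^T.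
    by rewrite !trmx_mul mulmxA tr_scalar_mx.
  rewrite tr_scalar_mx !mul_mx_scalar linearZ /=.
  move: (u *m w) (u *m T *m u^T) => b c; rewrite !mxE eqxx mulr1n.
  move=> h; apply: (le_trans h); rewrite le_eqVlt; apply/orP; left; apply/eqP.
  by ring.
have a0 : 0 <= a.
  by have := q 1 0; rewrite !mul0mx !mxE; lra.
have w0 : a = 0 -> w = 0.
  move=> az; apply/matrixP => i j; rewrite ord1 [RHS]mxE.
  have := q ^~ (delta_mx 0 i); rewrite -rowE [row _ _ _ _]mxE.
  set t := (_ *m _) 0 0; move=> {}q; apply/eqP/negP => /negP wi.
  have := q (- (t + 1) / (w i 0 *+ 2)); rewrite az mulr0 add0r.
  have -> : - (t + 1) / (w i 0 *+ 2) * w i 0 *+ 2 = - (t + 1).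
    by field.
  lra.
have [|B [trigB BB]] := IH (T - a^-1 *: (w *m w^T)).
  split=> [|u]; first by rewrite linearB/= linearZ/= trmx_mul trmxK TT.
  have := q (- a^-1 * (u *m w) 0 0) u.
  rewrite mulmxBr mulmxBl [in X in _ -> X]mxE.
  rewrite -scalemxAr -scalemxAl mulmxA -[_ *m w^T *m u^T]mulmxA -trmx_mul.
  rewrite [X in _ -> _ <= _ + X]mxE [X in _ -> _ <= _ - X]mxE.
  rewrite [(_ *m (u *m w)^T) _ _]mxE big_ord1 [(u *m w)^T _ _]mxE.
  set t := (u *m w) 0 0.
  have [az|anz] := eqVneq a 0.
    by rewrite az invr0 !(mulr0, mul0r, oppr0, expr0n, add0r, mul0rn, subr0).
  by congr (0 <= _); field.
pose s := Num.sqrt a.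
have ss : s * s = a by rewrite -expr2 sqr_sqrtr.
have sw : s *: (s^-1 *: w) = w.
  have [az|anz] := eqVneq a 0; first by rewrite (w0 az) !scaler0.
  by rewrite scalerA divff ?scale1r// sqrtr_eq0 -ltNge lt_def anz.
pose M : 'M[R]_(1 + p) := block_mx s%:M 0 (s^-1 *: w) B.
have trigM : is_trig_mx M.
  by rewrite is_trig_block_mx// eqxx/= trigB andbT scalar_mx_is_trig.
have MM : M *m M^T = S'.
  rewrite SE tr_block_mx mulmx_block !tr_scalar_mx !trmx0 !mulmx0 !mul0mx.
  rewrite !addr0 -scalar_mxM ss mul_scalar_mx mul_mx_scalar -linearZ/= sw.
  congr block_mx.
  by rewrite linearZ/= -scalemxAr -scalemxAl scalerA BB -invfM ss; exact: subrKC.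
by exists M.
Qed.

(* A Cholesky factor of S; it is unique when S is positive definite. *)
Definition chol (R : realType) p (S : 'M[R]_p) : 'M[R]_p :=
  xget 0 [set A : 'M[R]_p | is_trig_mx A /\ A *m A^T = S].

Lemma cholP (R : realType) p (S : 'M[R]_p) : psdmx S ->
  is_trig_mx (chol S) /\ chol S *m (chol S)^T = S.
Proof. by move=> /chol_exists; exact: xgetPex. Qed.

Section iid.
Context d (T : measurableType d) (R : realType).

Definition tuple_cons m (xt : T * m.-tuple T) : m.+1.-tuple T :=
  [tuple of xt.1 :: xt.2].

Lemma measurable_tuple_cons m : measurable_fun setT (@tuple_cons m).
Proof. by apply: measurable_cons; [exact: measurable_fst|exact: measurable_snd]. Qed.

HB.instance Definition _ m :=
  isMeasurableFun.Build _ _ _ _ (@tuple_cons m) (@measurable_tuple_cons m).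

(* The n-fold product measure of P, i.e. the law of an i.i.d. sample. *)
Fixpoint iid_prob (P : probability T R) n : probability (n.-tuple T) R :=
  match n with
  | 0 => dirac ([tuple] : 0.-tuple T)
  | m.+1 => distribution (P \x iid_prob P m)%E (@tuple_cons m)
  end.

End iid.

Section gaussian.
Context (R : realType) (p : nat).

(* measurableTypeR R is R with its Borel sigma-algebra: the type on which the
   library puts normal_prob. *)
Definition lin_tuple (A : 'M[R]_p) (z : p.-tuple (measurableTypeR R)) :
    p.-tuple R :=
  [tuple \sum_(j < p) A i j * tnth z j | i < p].

Lemma measurable_lin_tuple (A : 'M[R]_p) : measurable_fun setT (lin_tuple A).
Proof.
apply/measurable_fun_tnthP => i.
rewrite (_ : _ \o _ = fun z => \sum_(j < p) A i j * tnth z j); last first.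
  by apply/funext => z /=; rewrite tnth_mktuple.
apply: measurable_sum => j; apply: measurable_funM => //.
exact: measurable_tnth.
Qed.

HB.instance Definition _ A :=
  isMeasurableFun.Build _ _ _ _ (lin_tuple A) (measurable_lin_tuple A).

(* N_p(0, S) for S non-negative definite, as the law of A z where A A^T = S
   and z has independent N(0, 1) coordinates; this law does not depend on the
   choice of the factor A. *)
Definition mvnormal (S : 'M[R]_p) : probability (p.-tuple R) R :=
  distribution (iid_prob (normal_prob 0 1) p) (lin_tuple (chol S)).

End gaussian.

Section testing.
Context (R : realType) (n p : nat).

(* A sample is a tuple x whose k-th entry tnth x k is the observation X_k. *)
Definition expect (S : 'M[R]_p) (f : n.-tuple (p.-tuple R) -> R) : R :=
  fine 'E_(iid_prob (mvnormal S) n)[f].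

Definition is_test (D : n.-tuple (p.-tuple R) -> R) : Prop :=
  measurable_fun setT D /\ forall x, 0 <= D x <= 1.

(* For an empty alternative the supremum is 0 (sup set0 = 0). *)
Definition risk (D : n.-tuple (p.-tuple R) -> R) (A : set 'M[R]_p) : R :=
  expect 1%:M D + sup [set expect S (fun x => 1 - D x) | S in A].

Definition minimax_risk (A : set 'M[R]_p) : R :=
  inf [set risk D A | D in is_test].

End testing.
Arguments minimax_risk {R} n {p} A.

Section classes.
Context (R : realType) (p : nat).

Definition frobenius (A : 'M[R]_p) : R :=
  Num.sqrt (\sum_(i < p) \sum_(j < p) A i j ^+ 2).

Definition classF (alpha L : R) : set 'M[R]_p :=
  [set S | [/\ psdmx S, forall i, S i i = 1 &
    p%:R^-1 * (\sum_(i < p) \sum_(j < p | (i < j)%N)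
      S i j ^+ 2 * `|i%:R - j%:R| `^ (2 * alpha)) <= L]].

Definition classG (alpha L lambda : R) : set 'M[R]_p :=
  [set S | classF alpha L S /\ forall a, eigenvalue S a -> lambda <= a].

Definition alternative (alpha L lambda psi : R) : set 'M[R]_p :=
  [set S | classG alpha L lambda S /\
    psi ^+ 2 <= (2 * p%:R)^-1 * frobenius (invmx S - 1%:M) ^+ 2].

End classes.

Definition rate_const (R : realType) (alpha L : R) : R :=
  (2 * alpha + 1) / (4 * alpha + 1) `^ (1 + (2 * alpha)^-1)
  * L `^ (- (2 * alpha)^-1).

Definition rate (R : realType) (alpha L : R) (n p : nat) : R :=
  (n%:R * Num.sqrt p%:R * Num.sqrt (rate_const alpha L))
    `^ (- (2 * alpha / (4 * alpha + 1))).

(* Main.v *)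
(** Put x = rate^(-1/alpha), so that x^(4 alpha + 1) = n^2 p C(alpha, L) and
    rate^2 = x^(-2 alpha).

    Upper bound.  If all the eigenvalues of S are at least lambda, then
    lambda^2 |S^-1 - I|^2 <= |S - I|^2 in Frobenius norm, so on the
    alternative |S - I|^2 >= 2 p (lambda psi)^2; by the smoothness condition at
    least half of this comes from the band |i - j| <= T as soon as T is of
    order x.  Split the sample into two halves of size m: the sum over the band
    of the products of the two (unnormalized) empirical covariances is an
    unbiased estimator of m^2 times the sum of the squares of the banded
    off-diagonal entries, and Chebyshev's inequality for it gives both errors,
    its relative variance being of order T / (n^2 p psi^4) + n^-2.

    Lower bound.  Cut {0, ..., p - 1} into B pairs of consecutive segments of
    length T of order x, and on each pair put s (u v^T + v u^T) off the
    diagonal, where u and v are uniform random sign vectors supported by the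
    two segments and s^2 T = 16 psi^2.  The disjointness of the supports makes
    the chi-square integral between two such Gaussian laws explicit:
    the product over the B pairs of (1 - s^2 <u, u'> <v, v'>)^(-n).  Averaging
    over the signs bounds it by exp(O(n^2 psi^4 B)), where
    n^2 psi^4 B is of order (psi / rate)^4. *)

Require Import Defs.
From mathcomp Require Import all_boot all_order all_algebra.
From mathcomp Require Import all_classical all_reals all_analysis.
From mathcomp Require Import measurable_realfun ring lra zify.
Import Order.TTheory GRing.Theory Num.Theory.
Import numFieldNormedType.Exports.
Import HBNNSimple.

Set Implicit Arguments.
Unset Strict Implicit.
Unset Printing Implicit Defensive.

Local Open Scope classical_set_scope.
Local Open Scope ring_scope.

(** * Likelihood ratios of Gaussian vectors *)

Section density.
Local Open Scope ereal_scope.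
Context d (T : measurableType d) (R : realType).

(** The reference measure is N(0, I) throughout, never Lebesgue measure on R^p: with a triangular
    factor of S, densities can then be computed one coordinate at a time. For one observation the
    chi-square integral is det(I - (S - I)(S' - I))^(-1/2). Perturbations that only couple the two
    segments of a pair keep the unit diagonal and make this determinant a perfect square, so that no
    root remains. Averaging (1 - s^2 <u, u'> <v, v'>)^(-n) over the signs requires n s^2 T to stay
    below a constant. This is where n = o(p^(2 alpha)) enters, as it bounds n rate^2; it also makes
    a pair of segments fit into {0, ..., p - 1}. In the upper bound the obstacle is that the class
    gives no uniform bound on the operator norm of S. The covariances of the products X_i X_j are
    therefore controlled by |S - I|^4 in Frobenius norm, which is comparable to the squared signal
    and costs only n^-2 after normalization. The cross term of the variance is absorbed by a small
    multiple delta of the squared mean. Splitting the sample means that no Gaussian moment beyond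
    the fourth is needed. *)

Lemma ge0_integral_density (mu nu : {measure set T -> \bar R}) (g : T -> R) :
  measurable_fun setT g -> (forall x, 0 <= g x)%R ->
  (forall A, measurable A -> nu A = \int[mu]_(x in A) (g x)%:E) ->
  forall f : T -> \bar R, measurable_fun setT f -> (forall x, 0 <= f x) ->
  \int[nu]_x f x = \int[mu]_x (f x * (g x)%:E).
Proof.
move=> mg g0 nuE f mf f0.
have mg' : measurable_fun setT (fun x => (g x)%:E) by exact/measurable_EFinP.
pose f_ := nnsfun_approx measurableT mf.
transitivity (lim (\int[nu]_x (f_ n x)%:E @[n --> \oo])).
  rewrite -monotone_convergence//=.
  - by apply: eq_integral => x _; apply/esym/cvg_lim => //; exact: cvg_nnsfun_approx.
  - by move=> n; exact/measurable_EFinP/measurable_funTS.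
  - by move=> n ? _; rewrite lee_fin.
  - by move=> ? _ ? ? mn; rewrite lee_fin; exact/lefP/nd_nnsfun_approx.
transitivity (lim (\int[mu]_x ((f_ n x)%:E * (g x)%:E) @[n --> \oo])); last first.
  rewrite -monotone_convergence//=.
  - apply: eq_integral => x _; apply/cvg_lim => //.
    by apply: cvgeZr => //; exact: cvg_nnsfun_approx.
  - by move=> n; apply: emeasurable_funM => //; exact/measurable_EFinP/measurable_funTS.
  - by move=> n x _; rewrite mule_ge0// lee_fin.
  - move=> x _ m n mn; rewrite lee_wpmul2r ?lee_fin//.
    exact/lefP/nd_nnsfun_approx.
suff -> : (fun n => \int[nu]_x (f_ n x)%:E) =
    (fun n => \int[mu]_x ((f_ n x)%:E * (g x)%:E)) by [].
apply/funext => n /=.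
under eq_integral do rewrite fimfunE -fsumEFin//.
rewrite ge0_integral_fsum//; last 2 first.
  - by move=> r; exact/measurable_EFinP/measurableT_comp.
  - by move=> r x _; rewrite EFinM nnfun_muleindic_ge0.
under [RHS]eq_integral.
  move=> x _; rewrite fimfunE -fsumEFin// muleC ge0_mule_fsumr; last first.
    by move=> r; rewrite EFinM nnfun_muleindic_ge0.
  over.
rewrite [RHS]ge0_integral_fsum//; last 2 first.
  - move=> r; apply: emeasurable_funM => //.
    by apply/measurable_EFinP; do 2 apply/measurableT_comp => //.
  - by move=> r x _; apply: mule_ge0; [rewrite lee_fin|rewrite EFinM nnfun_muleindic_ge0].
apply: eq_fsbigr => r _; rewrite integralZl_indic_nnsfun// integral_indic// setIT.
rewrite nuE//.
have [r0|r0] := leP 0%R r; last first.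
  rewrite preimage_nnfun0// integral_set0 mule0; apply/esym/integral0_eq => x _.
  by rewrite indicE in_set0 mulr0 mule0.
rewrite [in LHS]integral_mkcond -ge0_integralZl//.
- apply: eq_integral => x _; rewrite patchE indicE.
  by case: ifPn => xA; rewrite ?(negbTE xA)/= ?mulr1 ?mulr0 ?mule0 // muleC.
- exact/(measurable_restrictT _ _).1/measurable_funTS.
- by move=> x _; rewrite patchE; case: ifPn; rewrite // lee_fin.
Qed.

End density.

Section affine.
Local Open Scope ereal_scope.
Context (R : realType).
Notation mu := (@lebesgue_measure R).

Lemma measurable_affine (a b : R) :
  measurable_fun setT ((fun x => (a * x + b)%R) : measurableTypeR R -> measurableTypeR R).
Proof. by apply: measurable_funD => //; exact: measurable_funM. Qed.

(** [|a|] times the image measure under the affine map gives half-open intervals their length, so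
    uniqueness of Lebesgue measure applies. For [a < 0] the preimage exchanges the closed and the
    open end, whence the two cases. *)
Lemma lebesgue_affine (a b : R) (A : set (measurableTypeR R)) : a != 0%R -> measurable A ->
  mu A = `|a|%:E * mu ((fun x => (a * x + b)%R) @^-1` A).
Proof.
move=> a0 mA.
pose ph : measurableTypeR R -> measurableTypeR R := fun x => (a * x + b)%R.
have na0 : (0 <= `|a|)%R by [].
have := @lebesgue_measure_unique R (mscale (NngNum na0) (pushforward mu ph)).
move=> /(_ (measurable_affine a b) _ A mA) -> // _ [[u v] _ <-] /=.
rewrite /mscale /= /pushforward /= lebesgue_measure_itv/= lte_fin.
have [ap|an] := ltP 0%R a.
  have -> : ph @^-1` `]u, v] = `]((u - b) / a)%R, ((v - b) / a)%R]%classic.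
    apply/seteqP; split=> x; rewrite /ph /= !in_itv /= ltr_pdivrMr// ler_pdivlMr// ltrBlDr lerBrDr mulrC//.
  rewrite lebesgue_measure_itv/= lte_fin ltr_pM2r ?invr_gt0// ltrD2r.
  case: ifP => _; last by rewrite mule0.
  by rewrite -EFinB -EFinM gtr0_norm// -mulrBl mulrCA divff// mulr1; congr _%:E; ring.
have {}an : (a < 0)%R by rewrite lt_neqAle a0.
have -> : ph @^-1` `]u, v] = `[((v - b) / a)%R, ((u - b) / a)%R[%classic.
  apply/seteqP; split=> x; rewrite /ph /= !in_itv /= ler_ndivrMr// ltr_ndivlMr//.
    by rewrite lerBrDr ltrBlDr mulrC => /andP[-> ->].
  by rewrite lerBrDr ltrBlDr mulrC => /andP[-> ->].
rewrite lebesgue_measure_itv/= lte_fin ltr_nM2r ?invr_lt0// ltrD2r.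
case: ifP => _; last by rewrite mule0.
by rewrite -EFinB -EFinM ltr0_norm// -mulrBl mulrCA mulNr divff//; congr _%:E; ring.
Qed.

Lemma ge0_integral_affine (a b : R) (f : measurableTypeR R -> \bar R) : a != 0%R ->
  measurable_fun setT f -> (forall x, 0 <= f x) ->
  \int[mu]_x f x = `|a|%:E * \int[mu]_x f (a * x + b)%R.
Proof.
move=> a0 mf f0.
have na0 : (0 <= `|a|)%R by [].
pose ph : measurableTypeR R -> measurableTypeR R := fun x => (a * x + b)%R.
pose nu : {measure set _ -> \bar R} :=
  measure_function_pushforward__canonical__measure_function_Measure mu (measurable_affine a b).
transitivity (\int[mscale (NngNum na0) nu]_x f x).
  apply: eq_measure_integral => A mA _.
  by rewrite /mscale /= /pushforward; exact: lebesgue_affine.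
rewrite ge0_integral_mscale//=.
congr (_ * _).
by rewrite (@ge0_integral_pushforward _ _ _ _ _ ph)//; exact: measurable_affine.
Qed.

Lemma ge0_integral_normal (f : measurableTypeR R -> \bar R) :
  measurable_fun setT f -> (forall x, 0 <= f x) ->
  \int[normal_prob 0 1]_x f x = \int[mu]_x (f x * (normal_pdf 0 1 x)%:E).
Proof.
apply: ge0_integral_density => //.
- exact: measurable_normal_pdf.
- by move=> x; exact: normal_pdf_ge0.
Qed.

(** The change of variables with N(0, 1) itself as reference: the factor is the density of [a z + b]
    divided by that of [z]. This form iterates over the coordinates of [iid_prob]. *)
Lemma normal_affine (a b : R) (f : measurableTypeR R -> \bar R) : a != 0%R ->
  measurable_fun setT f -> (forall x, 0 <= f x) ->
  \int[normal_prob 0 1]_z f (a * z + b)%R =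
  \int[normal_prob 0 1]_x
    (f x * (`|a|^-1 * expR ((x ^+ 2 - ((x - b) / a) ^+ 2) / 2))%:E).
Proof.
move=> a0 mf f0.
have mf' : measurable_fun setT (fun z : measurableTypeR R => f (a * z + b)%R).
  by apply: (measurableT_comp mf); exact: measurable_affine.
rewrite !ge0_integral_normal//; last 2 first.
  - apply: emeasurable_funM => //; apply/measurable_EFinP.
    apply: measurable_funM => //; apply: measurableT_comp => //.
    apply: measurable_funM => //; apply: measurable_funB.
      exact: measurable_funX.
    apply: measurable_funX; apply: measurable_funM => //.
    exact: measurable_funB.
  - by move=> x; rewrite mule_ge0// lee_fin mulr_ge0 ?expR_ge0// invr_ge0.
rewrite (@ge0_integral_affine a b (fun x => _ * _ * _))//; last 2 first.
  - apply: emeasurable_funM => //; last first.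
      by apply/measurable_EFinP; exact: measurable_normal_pdf.
    apply: emeasurable_funM => //; apply/measurable_EFinP.
    apply: measurable_funM => //; apply: measurableT_comp => //.
    apply: measurable_funM => //; apply: measurable_funB.
      exact: measurable_funX.
    apply: measurable_funX; apply: measurable_funM => //.
    exact: measurable_funB.
  - move=> x; rewrite !mule_ge0// lee_fin ?normal_pdf_ge0//.
have na0 : (`|a| != 0)%R by rewrite normr_eq0.
rewrite -ge0_integralZl//; last 2 first.
  - apply: emeasurable_funM => //; last first.
      apply/measurable_EFinP; apply: (measurableT_comp (measurable_normal_pdf 0 1)).
      exact: measurable_affine.
    apply: emeasurable_funM => //; apply/measurable_EFinP.
    apply: measurable_funM => //; apply: measurableT_comp => //.
    apply: measurable_funM => //; apply: measurable_funB.
      by apply: measurable_funX; exact: measurable_affine.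
    apply: measurable_funX; apply: measurable_funM => //.
    by apply: measurable_funB => //; exact: measurable_affine.
  - move=> x _; rewrite !mule_ge0// lee_fin ?normal_pdf_ge0//.
apply: eq_integral => x _; rewrite muleCA -!muleA; congr (_ * _).
rewrite -!EFinM; congr _%:E.
rewrite normal_pdfE ?oner_neq0// /normal_fun.
rewrite mulrACA mulVf// mul1r mulrCA -expRD; congr (_ * expR _)%R.
by field.
Qed.

End affine.

Section iid_density.
Local Open Scope ereal_scope.
Context d (T : measurableType d) (R : realType).

Lemma ge0_integral_iid (P : probability T R) n (f : n.+1.-tuple T -> \bar R) :
  measurable_fun setT f -> (forall x, 0 <= f x) ->
  \int[iid_prob P n.+1]_x f x =
  \int[P]_x \int[iid_prob P n]_y f [tuple of x :: y].
Proof.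
move=> mf f0.
rewrite [LHS]ge0_integral_distribution// fubini_tonelli1//.
  by apply: (measurableT_comp mf); exact: measurable_tuple_cons.
by move=> x; exact: f0.
Qed.

Lemma iid_prob_density (P Q : probability T R) (L : T -> R) n :
  measurable_fun setT L -> (forall x, 0 <= L x)%R ->
  (forall f : T -> \bar R, measurable_fun setT f -> (forall x, 0 <= f x) ->
    \int[P]_x f x = \int[Q]_x (f x * (L x)%:E)) ->
  forall f : n.-tuple T -> \bar R, measurable_fun setT f -> (forall x, 0 <= f x) ->
    \int[iid_prob P n]_x f x =
    \int[iid_prob Q n]_x (f x * (\prod_(i < n) L (tnth x i))%:E).
Proof.
move=> mL L0 PQ; elim: n => [|n IH] f mf f0.
  by apply: eq_integral => x _; rewrite big_ord0 mule1.
have mcons : measurable_fun setT (fun xy : T * n.-tuple T => [tuple of xy.1 :: xy.2]).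
  exact: measurable_tuple_cons.
have mprod m : measurable_fun setT (fun y : m.-tuple T => (\prod_(i < m) L (tnth y i))%:E).
  apply/measurable_EFinP; apply: measurable_prod => i _.
  by apply: (measurableT_comp mL); exact: measurable_tnth.
have prod0 m (y : m.-tuple T) : 0 <= (\prod_(i < m) L (tnth y i))%:E.
  by rewrite lee_fin prodr_ge0.
rewrite !ge0_integral_iid//; last 2 first.
  - by apply: emeasurable_funM => //; exact: mprod.
  - by move=> x; rewrite mule_ge0.
rewrite PQ; last 2 first.
  - apply: (@measurable_fun_fubini_tonelli_F _ _ _ _ _ (iid_prob P n)
      (f \o @tuple_cons _ T n)) => [|xy]; last exact: f0.
    exact: (measurableT_comp mf).
  - by move=> x; apply: integral_ge0.
apply: eq_integral => x _.
have mfx : measurable_fun setT (fun y : n.-tuple T => f [tuple of x :: y]).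
  apply: (measurableT_comp mf); apply: measurable_cons => //.
rewrite IH// -ge0_integralZr//; last 3 first.
  - by apply: emeasurable_funM => //; exact: mprod.
  - by move=> y _; rewrite mule_ge0.
  - by rewrite lee_fin.
apply: eq_integral => y _; rewrite -muleA; congr (_ * _).
rewrite -EFinM big_ord_recl tnth0 mulrC; congr (_ * _)%:E.
by apply: eq_bigr => i _; rewrite tnthS.
Qed.

End iid_density.

Section gauss_density.
Context (R : realType).
Local Notation RR := (measurableTypeR R).
Local Notation gauss := (iid_prob (@normal_prob R 0 1)).

(* Density with respect to N(0, I) of the law of A z + b, where C = A^-1. *)
Definition gauss_weight p (A C : 'M[R]_p) (b : 'I_p -> R) (x : p.-tuple RR) : R :=
  `|\det A|^-1 * expR ((\sum_i tnth x i ^+ 2 -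
    \sum_i (\sum_j C i j * (tnth x j - b j)) ^+ 2) / 2).

Lemma gauss_weight_ge0 p (A C : 'M[R]_p) b x : 0 <= gauss_weight A C b x.
Proof. by rewrite mulr_ge0 ?expR_ge0// invr_ge0. Qed.

Lemma measurable_gauss_weight p (A C : 'M[R]_p) b :
  measurable_fun setT (gauss_weight A C b).
Proof.
apply: measurable_funM => //; apply: measurableT_comp => //.
apply: measurable_funM => //; apply: measurable_funB.
  by apply: measurable_sum => i; apply: measurable_funX; exact: measurable_tnth.
apply: measurable_sum => i; apply: measurable_funX; apply: measurable_sum => j.
apply: measurable_funM => //; apply: measurable_funB => //.
exact: measurable_tnth.
Qed.

(** The data for the induction on the dimension in [gauss_density]: deleting the first row and
    column of a lower triangular matrix and of its inverse leaves inverse matrices. The last clause,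
    read off the first column of [C A = I], says how a shift caused by the first coordinate passes
    through [C']. *)
Lemma trig_inv_block p (A C : 'M[R]_p.+1) : is_trig_mx A -> A *m C = 1%:M ->
  let A' := row' ord0 (col' ord0 A) in let C' := row' ord0 (col' ord0 C) in
  [/\ is_trig_mx A', A' *m C' = 1%:M, A ord0 ord0 != 0, \det A = A ord0 ord0 * \det A' &
    C ord0 ord0 = (A ord0 ord0)^-1] /\ ((forall j, C ord0 (lift ord0 j) = 0) /\
    forall i, \sum_k C' i k * A (lift ord0 k) ord0 = - C (lift ord0 i) ord0 * A ord0 ord0).
Proof.
move=> trA AC A' C'.
have trA0 j : A ord0 (lift ord0 j) = 0 by apply: (is_trig_mxP trA).
have CA := mulmx1C AC.
have trA' : is_trig_mx A'.
  by apply/is_trig_mxP => i j ij; rewrite !mxE; apply: (is_trig_mxP trA).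
have AC0 j : A ord0 ord0 * C ord0 j = (ord0 == j)%:R.
  have /matrixP/(_ ord0 j) := AC; rewrite !mxE big_ord_recl big1 ?addr0// => k _.
  by rewrite trA0 mul0r.
have a0 : A ord0 ord0 != 0.
  by apply/eqP => az; have := AC0 ord0; rewrite az mul0r eqxx => /esym/eqP; rewrite oner_eq0.
have C0 j : C ord0 (lift ord0 j) = 0.
  by have := AC0 (lift ord0 j) => /= /eqP; rewrite mulf_eq0 (negbTE a0)/= => /eqP.
split; [split => // | split => //].
- apply/matrixP => i j; have /matrixP/(_ (lift ord0 i) (lift ord0 j)) := AC.
  rewrite !mxE big_ord_recl C0 mulr0 add0r (inj_eq lift_inj) => <-.
  by apply: eq_bigr => k _; rewrite !mxE.
- rewrite !det_trig// big_ord_recl; congr (_ * _).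
  by apply: eq_bigr => i _; rewrite !mxE.
- by apply: (mulfI a0); rewrite AC0 eqxx divff.
- move=> i; have /matrixP/(_ (lift ord0 i) ord0) := CA.
  rewrite !mxE big_ord_recl /= => /eqP; rewrite addrC addr_eq0 mulNr => /eqP <-.
  by apply: eq_bigr => k _; rewrite !mxE.
Qed.

(** Induction on [p]: as [A] is lower triangular, the first coordinate of [A z + b] involves only
    the first coordinate of [z]; once that is fixed, the others have the same form in one dimension
    less, with a shift depending on it. This is why [b] is general. *)
Lemma gauss_density p (A C : 'M[R]_p) (b : 'I_p -> R) :
  is_trig_mx A -> A *m C = 1%:M ->
  forall f : p.-tuple RR -> \bar R, measurable_fun setT f -> (forall x, 0 <= f x)%E ->
  (\int[gauss p]_z f [tuple \sum_j A i j * tnth z j + b i | i < p]%R =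
   \int[gauss p]_x (f x * (gauss_weight A C b x)%:E))%E.
Proof.
elim: p A C b => [|p IH] A C b trA AC f mf f0.
  apply: eq_integral => x _; rewrite /gauss_weight det_mx00 normr1 invr1 mul1r.
  rewrite !big_ord0 subrr mul0r expR0 mule1; congr f; by apply: eq_from_tnth => -[].
have [[trA' AC' a0 detA C00] [C0 Cw]] := trig_inv_block trA AC.
set A' := row' _ _ in trA' AC' detA; set C' := row' _ _ in AC' Cw.
set a := A ord0 ord0 in a0 detA C00 Cw.
pose b' i := b (lift ord0 i); pose b0 := b ord0.
(* [bz z] is the shift of the remaining coordinates when the first standard coordinate is [z];
   below, [z] is recovered as [(t - b0) / a] from the first coordinate [t] of the image. *)
pose bz z i := A (lift ord0 i) ord0 * z + b' i.
pose w0 (t : RR) := `|a|^-1 * expR ((t ^+ 2 - ((t - b0) / a) ^+ 2) / 2).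
have w0_gt0 t : 0 < w0 t by rewrite mulr_gt0 ?expR_gt0// invr_gt0 normr_gt0.
have wE (x0 : RR) (y : p.-tuple RR) :
    gauss_weight A C b [tuple of x0 :: y] =
    w0 x0 * gauss_weight A' C' (bz ((x0 - b0) / a)) y.
  rewrite /gauss_weight /w0 detA normrM invfM mulrACA -expRD; congr (_ * expR _).
  rewrite -mulrDl; congr (_ / 2); rewrite addrACA -opprD; congr (_ - _).
    by rewrite big_ord_recl tnth0; congr (_ + _); apply: eq_bigr => i _; rewrite tnthS.
  rewrite big_ord_recl; congr (_ + _).
    rewrite big_ord_recl tnth0 C00 big1 ?addr0; last by move=> i _; rewrite C0 mul0r.
    by rewrite mulrC.
  apply: eq_bigr => i _; congr (_ ^+ 2); rewrite big_ord_recl tnth0.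
  under [RHS]eq_bigr do rewrite /bz opprD addrCA mulrDr mulrN (mulrA (C' _ _)).
  rewrite big_split/= sumrN -mulr_suml Cw mulNr !mulNr opprK.
  congr (_ + _); first by rewrite -mulrA; congr (_ * _); rewrite mulrC divfK.
  by apply: eq_bigr => j _; rewrite tnthS !mxE.
have mw := measurable_gauss_weight A C b.
have mcons : measurable_fun setT (@tuple_cons _ RR p) by exact: measurable_tuple_cons.
have mw0 : measurable_fun setT w0.
  apply: measurable_funM => //; apply: measurableT_comp => //.
  apply: measurable_funM => //; apply: measurable_funB; first exact: measurable_funX.
  by apply: measurable_funX; apply: measurable_funM => //; exact: measurable_funB.
pose H (t : RR) : \bar R :=
  (\int[gauss p]_y (f [tuple of t :: y] * (gauss_weight A' C' (bz ((t - b0) / a)) y)%:E))%E.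
have H0 t : (0 <= H t)%E.
  by apply: integral_ge0 => y _; rewrite mule_ge0// lee_fin gauss_weight_ge0.
have mH : measurable_fun setT H.
  (* Dividing the joint weight by [w0] exhibits the integrand as jointly measurable in [t] and [y],
     as Tonelli requires. *)
  pose F (ty : RR * p.-tuple RR) : \bar R := (f (tuple_cons ty) *
    (gauss_weight A C b (tuple_cons ty) / w0 ty.1)%:E)%E.
  have -> : H = fun t => (\int[gauss p]_y F (t, y))%E.
    apply/funext => t; apply: eq_integral => y _; rewrite /F /= wE.
    by rewrite mulrAC divff ?mul1r// gt_eqF.
  apply: (@measurable_fun_fubini_tonelli_F _ _ _ _ _ (gauss p) F) => [|ty]; last first.
    by rewrite mule_ge0// lee_fin divr_ge0 ?gauss_weight_ge0// ltW.
  apply: emeasurable_funM; first exact: (measurableT_comp mf).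
  apply/measurable_EFinP/measurable_funM; first exact: (measurableT_comp mw).
  rewrite (_ : (fun _ => _) = (fun t => (`|a| * expR (- ((t ^+ 2 - ((t - b0) / a) ^+ 2) / 2)))) \o (@fst RR (p.-tuple RR))); last first.
    by apply/funext => ty /=; rewrite /w0 invfM invrK -expRN.
  apply: measurableT_comp => //.
  apply: measurable_funM => //; apply: measurableT_comp => //; apply: measurableT_comp => //.
  apply: measurable_funM => //; apply: measurable_funB; first exact: measurable_funX.
  by apply: measurable_funX; apply: measurable_funM => //; exact: measurable_funB.
rewrite [RHS]ge0_integral_iid; last 2 first.
  - by apply: emeasurable_funM => //; exact/measurable_EFinP.
  - by move=> x; rewrite mule_ge0// lee_fin gauss_weight_ge0.
rewrite [LHS]ge0_integral_iid; last 2 first.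
  - apply: (measurableT_comp mf); apply/measurable_fun_tnthP => i.
    rewrite (_ : _ \o _ = fun z => \sum_j A i j * tnth z j + b i); last first.
      by apply/funext => z /=; rewrite tnth_mktuple.
    apply: measurable_funD => //; apply: measurable_sum => j; apply: measurable_funM => //.
    exact: measurable_tnth.
  - by move=> x; exact: f0.
transitivity (\int[normal_prob 0 1]_z H (a * z + b0)%R)%E.
  apply: eq_integral => z _; rewrite /H.
  have -> : (a * z + b0 - b0) / a = z by rewrite addrK mulrC mulKf.
  have mfz : measurable_fun setT (fun y : p.-tuple RR => f [tuple of (a * z + b0)%R :: y]).
    by apply: (measurableT_comp mf); exact: measurable_cons.
  rewrite -(IH A' C' (bz z) trA' AC' (fun y => f [tuple of (a * z + b0)%R :: y]))//.
  apply: eq_integral => y _; congr f.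
  apply: eq_from_tnth => i; rewrite tnth_mktuple.
  case: (unliftP ord0 i) => [j ->|->].
    rewrite tnthS tnth_mktuple big_ord_recl tnth0 /bz addrAC -addrA addrC.
    rewrite -addrA addrCA; congr (_ + _); first by apply: eq_bigr => k _; rewrite tnthS !mxE.
    by rewrite addrC.
  rewrite tnth0 big_ord_recl tnth0 big1 ?addr0// => j _.
  by rewrite (is_trig_mxP trA)// mul0r.
apply: (etrans (normal_affine b0 a0 mH H0)).
apply: eq_integral => x _; rewrite -/(w0 x) -ge0_integralZr; last 4 first.
  - exact: measurableT.
  - apply: emeasurable_funM; last by apply/measurable_EFinP; exact: measurable_gauss_weight.
    by apply: (measurableT_comp mf); exact: measurable_cons.
  - by move=> y _; rewrite mule_ge0// lee_fin gauss_weight_ge0.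
  - by rewrite lee_fin ltW.
apply: eq_integral => y _; rewrite wE -muleA; congr (_ * _)%E.
by rewrite -EFinM mulrC.
Qed.

End gauss_density.

Section mvnormal_density.
Context (R : realType).
Local Notation RR := (measurableTypeR R).
Local Notation gauss := (iid_prob (@normal_prob R 0 1)).

Lemma psdmx_inv p (Q : 'M[R]_p) : psdmx Q -> Q \in unitmx -> psdmx (invmx Q).
Proof.
move=> [symQ posQ] uQ; split; first by rewrite trmx_inv symQ.
move=> v; have := posQ (v *m invmx Q).
by rewrite trmx_mul trmx_inv symQ mulmxA mulmxKV.
Qed.

Definition quad p (Q : 'M[R]_p) (x : p.-tuple R) : R :=
  let v := \row_i tnth x i in (v *m Q *m v^T) 0 0.

(* Density of N(0, S) with respect to N(0, I). *)
Definition lik p (S : 'M[R]_p) (x : p.-tuple R) : R :=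
  (Num.sqrt (\det S))^-1 * expR ((quad 1%:M x - quad (invmx S) x) / 2).

Lemma quad_sum p (Q : 'M[R]_p) x :
  quad Q x = \sum_j (\sum_i tnth x i * Q i j) * tnth x j.
Proof.
rewrite /quad mxE; apply: eq_bigr => j _; rewrite !mxE; congr (_ * _).
by apply: eq_bigr => i _; rewrite mxE.
Qed.

Lemma quad1 p (x : p.-tuple R) : quad 1%:M x = \sum_i tnth x i ^+ 2.
Proof.
rewrite /quad mulmx1 mxE; apply: eq_bigr => i _.
by rewrite !mxE expr2.
Qed.

Lemma quad_gram p (C : 'M[R]_p) x :
  quad (C^T *m C) x = \sum_i (\sum_j C i j * tnth x j) ^+ 2.
Proof.
rewrite /quad mulmxA -mulmxA -[X in X *m _]trmxK trmx_mul trmxK mxE.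
apply: eq_bigr => i _; rewrite [in LHS]mxE expr2.
by rewrite !mxE; congr (_ * _); apply: eq_bigr => j _; rewrite !mxE.
Qed.

Lemma measurable_quad p (Q : 'M[R]_p) : measurable_fun setT (quad Q).
Proof.
rewrite (_ : quad Q = fun x => \sum_j (\sum_i tnth x i * Q i j) * tnth x j).
  apply: measurable_sum => j; apply: measurable_funM; last exact: measurable_tnth.
  apply: measurable_sum => i; apply: measurable_funM => //; exact: measurable_tnth.
by apply/funext => x; exact: quad_sum.
Qed.

Lemma measurable_expquad p (Q Q' : 'M[R]_p) :
  measurable_fun setT (fun x : p.-tuple R => (expR ((quad Q x - quad Q' x) / 2))%:E).
Proof.
apply/measurable_EFinP; apply: measurableT_comp => //.
by apply: measurable_funM => //; apply: measurable_funB; exact: measurable_quad.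
Qed.

Lemma lik_ge0 p (S : 'M[R]_p) x : 0 <= lik S x.
Proof. by rewrite mulr_ge0 ?expR_ge0// invr_ge0 sqrtr_ge0. Qed.

Lemma measurable_lik p (S : 'M[R]_p) : measurable_fun setT (lik S).
Proof.
apply: measurable_funM => //; apply: measurableT_comp => //.
by apply: measurable_funM => //; apply: measurable_funB; exact: measurable_quad.
Qed.

Lemma mvnormal_density p (S : 'M[R]_p) : psdmx S -> S \in unitmx ->
  forall f : p.-tuple R -> \bar R, measurable_fun setT f -> (forall x, 0 <= f x)%E ->
  (\int[mvnormal S]_x f x = \int[gauss p]_x (f x * (lik S x)%:E))%E.
Proof.
move=> psdS uS f mf f0.
have [trA AA] := cholP psdS; set A := chol S in trA AA.
have uA : A \in unitmx by move: uS; rewrite -AA unitmx_mul => /andP[].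
rewrite [LHS]ge0_integral_distribution//.
transitivity (\int[gauss p]_x (f x * (gauss_weight A (invmx A) (fun=> 0) x)%:E))%E.
  rewrite -gauss_density//; last exact: mulmxV.
  apply: eq_integral => z _ /=; congr f.
  by apply: eq_from_tnth => i; rewrite !tnth_mktuple addr0.
apply: eq_integral => x _; congr (_ * _%:E)%E; rewrite /gauss_weight /lik.
congr (_^-1 * expR ((_ - _) / 2)).
- by rewrite -AA det_mulmx det_tr -expr2 sqrtr_sqr.
- exact/esym/quad1.
- rewrite -[in RHS]AA; under eq_bigr do under eq_bigr do rewrite subr0.
  have -> : invmx (A *m A^T) = (invmx A)^T *m invmx A.
    apply: (@row_full_inj _ _ _ _ (A *m A^T)).
      by rewrite row_full_unit unitmx_mul unitmx_tr uA.
    rewrite mulmxV ?unitmx_mul ?unitmx_tr ?uA// mulmxA -(mulmxA A) -trmx_mul mulVmx//.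
    by rewrite trmx1 mulmx1 mulmxV.
  by rewrite quad_gram.
Qed.

Lemma psdmx1 p : psdmx (1%:M : 'M[R]_p).
Proof.
split; first by rewrite trmx1.
by move=> v; rewrite mulmx1 mxE sumr_ge0// => i _; rewrite mxE -expr2 sqr_ge0.
Qed.

(** [chol 1%:M] is only some triangular factor of the identity, its signs being undetermined; so the
    two laws are compared through the density, which is identically 1. *)
Lemma mvnormal1 p (f : p.-tuple R -> \bar R) :
  measurable_fun setT f -> (forall x, 0 <= f x)%E ->
  (\int[mvnormal 1%:M]_x f x = \int[gauss p]_x f x)%E.
Proof.
move=> mf f0; rewrite mvnormal_density ?unitmx1//; last exact: psdmx1.
apply: eq_integral => x _.
by rewrite /lik det1 sqrtr1 invr1 invmx1 subrr mul0r expR0 mulr1 mule1.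
Qed.

Lemma mvnormal_lik p (S : 'M[R]_p) : psdmx S -> S \in unitmx ->
  forall f : p.-tuple R -> \bar R, measurable_fun setT f -> (forall x, 0 <= f x)%E ->
  (\int[mvnormal S]_x f x = \int[mvnormal 1%:M]_x (f x * (lik S x)%:E))%E.
Proof.
move=> psdS uS f mf f0; rewrite mvnormal_density// -mvnormal1//.
- by apply: emeasurable_funM => //; apply/measurable_EFinP; exact: measurable_lik.
- by move=> x; rewrite mule_ge0// lee_fin lik_ge0.
Qed.

(** N(0, Q^-1) has total mass 1; this is read through its density with respect to N(0, I). *)
Lemma gauss_integral_quad p (Q : 'M[R]_p) : psdmx Q -> Q \in unitmx ->
  (\int[gauss p]_x (expR ((quad 1%:M x - quad Q x) / 2))%:E =
   ((Num.sqrt (\det Q))^-1)%:E)%E.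
Proof.
move=> psdQ uQ.
have uI : invmx Q \in unitmx by rewrite unitmx_inv.
have := @mvnormal_density _ _ (psdmx_inv psdQ uQ) uI (cst 1%E).
move=> /(_ (measurable_cst _) (fun=> lee01)).
rewrite [X in X = _ -> _](_ : _ = 1%E); last first.
  by rewrite integral_cst// mul1e; exact: probability_setT.
rewrite /lik invmxK det_inv.
under eq_integral do rewrite /cst mul1e.
have dQ : \det Q != 0 by rewrite -unitfE -unitmxE.
have dQ0 : 0 < \det Q.
  have [trA AA] := cholP psdQ.
  by rewrite lt_def dQ -AA det_mulmx det_tr -expr2 sqr_ge0.
under eq_integral do rewrite EFinM.
rewrite (@ge0_integralZl _ _ _ (gauss p) _ measurableT _ (measurable_expquad 1%:M Q)); last 2 first.
- by move=> x _; rewrite lee_fin expR_ge0.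
- by rewrite lee_fin invr_ge0 sqrtr_ge0.
set I := integral _ _ _; rewrite sqrtrV ?ltW// invrK => e.
have s0 : Num.sqrt (\det Q) != 0 by rewrite sqrtr_eq0 -ltNge.
by rewrite -[RHS]mule1 e muleA -EFinM mulVf// mul1e.
Qed.

(** The product of the likelihood ratios is the exponential of a quadratic form with matrix [Q],
    integrable because [Q] is positive definite; the determinants combine through
    [S Q S' = I - (S - I)(S' - I)]. *)
Lemma lik_prod p (S S' : 'M[R]_p) : let Q := invmx S + invmx S' - 1%:M in
  S \in unitmx -> S' \in unitmx -> psdmx S -> psdmx S' -> psdmx Q -> Q \in unitmx ->
  (\int[mvnormal 1%:M]_x (lik S x * lik S' x)%:E =
    ((Num.sqrt (\det (1%:M - (S - 1%:M) *m (S' - 1%:M))))^-1)%:E)%E.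
Proof.
move=> Q uS uS' psdS psdS' psdQ uQ; rewrite mvnormal1; last 2 first.
- by apply/measurable_EFinP/measurable_funM; exact: measurable_lik.
- by move=> x; rewrite lee_fin mulr_ge0// lik_ge0.
have det0 (M : 'M[R]_p) : psdmx M -> 0 <= \det M.
  move=> psdM; have [trA AA] := cholP psdM.
  by rewrite -AA det_mulmx det_tr -expr2 sqr_ge0.
have -> : 1%:M - (S - 1%:M) *m (S' - 1%:M) = S *m Q *m S'.
  have -> : S *m Q *m S' = S' + S - S *m S'.
    by rewrite /Q mulmxBr mulmxDr mulmxV// mulmx1 mulmxBl mulmxDl mul1mx mulmxKV.
  rewrite mulmxBl !mulmxBr !mul1mx !mulmx1.
  by apply/matrixP => i j; rewrite !mxE; ring.
rewrite !det_mulmx !sqrtrM ?mulr_ge0 ?det0// !invfM.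
transitivity (\int[gauss p]_x (((Num.sqrt (\det S))^-1 * (Num.sqrt (\det S'))^-1)%:E *
   (expR ((quad 1%:M x - quad Q x) / 2))%:E))%E.
  apply: eq_integral => x _; rewrite /lik mulrACA -expRD -EFinM; congr (_ * expR _)%:E.
  have -> : quad Q x = quad (invmx S) x + quad (invmx S') x - quad 1%:M x.
    rewrite /quad /Q mulmxBr mulmxDr mulmxBl mulmxDl.
    by rewrite [LHS]mxE [X in X + _]mxE [X in _ + X]mxE.
  by field.
rewrite (@ge0_integralZl _ _ _ (gauss p) _ measurableT _ (measurable_expquad 1%:M Q)); last 2 first.
- by move=> x _; rewrite lee_fin expR_ge0.
- by rewrite lee_fin mulr_ge0// invr_ge0 sqrtr_ge0.
rewrite gauss_integral_quad// -EFinM; congr _%:E; ring.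
Qed.

End mvnormal_density.

(** * Means under product measures *)

Section has_expectation.
Context (R : realType).

(** Integrability and the value of the integral are kept together, so that means of polynomials in
    the sample are assembled by linearity and independence without separate integrability proofs. *)
Definition has_mean d (T : measurableType d) (P : probability T R) (f : T -> R) (m : R) :=
  P.-integrable setT (EFin \o f) /\ (\int[P]_x (f x)%:E = m%:E)%E.

Section basic.
Context d (T : measurableType d) (P : probability T R).
Implicit Types (f g : T -> R) (a b : R).

Lemma has_mean_measurable f a : has_mean P f a -> measurable_fun setT f.
Proof. by move=> [/integrableP[/measurable_EFinP]]. Qed.

Lemma has_mean_ge0 f a : measurable_fun setT f -> (forall x, 0 <= f x) ->
  (\int[P]_x (f x)%:E = a%:E)%E -> has_mean P f a.
Proof.
move=> mf f0 e; split => //; apply/integrableP; split; first exact/measurable_EFinP.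
under eq_integral do rewrite /= ger0_norm//.
by rewrite e ltry.
Qed.

Lemma has_mean_cst a : has_mean P (fun=> a) a.
Proof.
split; first exact: finite_measure_integrable_cst.
rewrite (@integral_cst _ _ _ P _ measurableT a%:E) -[RHS]mule1; congr (_ * _)%E.
exact: probability_setT.
Qed.

Lemma has_meanD f g a b : has_mean P f a -> has_mean P g b ->
  has_mean P (fun x => f x + g x) (a + b).
Proof.
move=> [fi fe] [gi ge]; split; first exact: (integrableD measurableT fi gi).
by under eq_integral do rewrite EFinD; rewrite integralD// fe ge.
Qed.

Lemma has_meanZ f a b : has_mean P f a -> has_mean P (fun x => b * f x) (b * a).
Proof.
move=> [fi fe]; split; first exact: (integrableZl measurableT b fi).
by under eq_integral do rewrite EFinM; rewrite integralZl// fe.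
Qed.

Lemma has_mean_sum (I : Type) (s : seq I) (q : pred I) (f : I -> T -> R) (a : I -> R) :
  (forall i, q i -> has_mean P (f i) (a i)) ->
  has_mean P (fun x => \sum_(i <- s | q i) f i x) (\sum_(i <- s | q i) a i).
Proof.
move=> fa; elim: s => [|i s IH].
  under eq_fun do rewrite big_nil; rewrite big_nil; exact: has_mean_cst.
under eq_fun do rewrite big_cons; rewrite big_cons; case: ifP => // qi.
by apply: has_meanD => //; exact: fa.
Qed.

Lemma has_mean_le f g a b : has_mean P f a -> has_mean P g b ->
  (forall x, f x <= g x) -> a <= b.
Proof.
move=> [fi fe] [gi ge] fg; rewrite -lee_fin -fe -ge.
by apply: le_integral => // x _; rewrite lee_fin.
Qed.

Lemma has_mean_bounded f : measurable_fun setT f -> (forall x, 0 <= f x <= 1) ->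
  has_mean P f (fine (\int[P]_x (f x)%:E)).
Proof.
move=> mf f01.
have fi : P.-integrable setT (EFin \o f).
  apply: (@le_integrable _ _ _ P _ measurableT _ (cst 1%E)) => //.
  - exact/measurable_EFinP.
  - by move=> x _; rewrite /= lee_fin normr1 ger0_norm; case/andP: (f01 x).
  - exact: finite_measure_integrable_cst.
split => //; rewrite fineK//.
exact: integrable_fin_num.
Qed.

End basic.

Lemma has_mean_pushforward d d' (T : measurableType d) (T' : measurableType d')
    (P : probability T R) (X : {mfun T >-> T'}) (f : T' -> R) (a : R) :
  measurable_fun setT f -> has_mean P (f \o X) a -> has_mean (distribution P X) f a.
Proof.
move=> mf [fi fe]; have mf' : measurable_fun setT (EFin \o f) by exact/measurable_EFinP.
split; first exact: (integrable_pushforward _ mf').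
by rewrite -fe (@integral_distribution _ _ _ _ _ P X (EFin \o f)).
Qed.

Lemma has_mean_prod d d' (T : measurableType d) (T' : measurableType d')
    (P : probability T R) (Q : probability T' R) (f : T -> R) (g : T' -> R) (a b : R) :
  has_mean P f a -> has_mean Q g b ->
  has_mean (P \x Q)%E (fun xy => f xy.1 * g xy.2) (a * b).
Proof.
move=> fa gb; have mf := has_mean_measurable fa; have mg := has_mean_measurable gb.
have [fi fe] := fa; have [gi ge] := gb.
have mfg : measurable_fun setT (fun xy : T * T' => (f xy.1 * g xy.2)%:E).
  apply/measurable_EFinP/measurable_funM.
    by apply: (measurableT_comp mf); exact: measurable_fst.
  by apply: (measurableT_comp mg); exact: measurable_snd.
have fgi : (P \x Q)%E.-integrable setT (EFin \o (fun xy => f xy.1 * g xy.2)).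
  apply/integrable12ltyP => //=.
  have [mf' flt] := integrableP _ _ _ fi; have [mg' glt] := integrableP _ _ _ gi.
  have mnf : measurable_fun setT (fun x => `|f x|%:E).
    by apply/measurable_EFinP; exact: measurableT_comp.
  have mng : measurable_fun setT (fun x => `|g x|%:E).
    by apply/measurable_EFinP; exact: measurableT_comp.
  under eq_integral.
    move=> x _; under eq_integral do rewrite normrM EFinM.
    rewrite (ge0_integralZl _ measurableT mng)//.
    over.
  rewrite /= (ge0_integralZr _ measurableT mnf)//; last exact: integral_ge0.
  by rewrite lte_mul_pinfty//; [exact: integral_ge0 | rewrite ge0_fin_numE//; exact: integral_ge0].
split => //; rewrite -integral12_prod_meas1//=.
transitivity (\int[P]_x ((f x)%:E * b%:E))%E.
  apply: eq_integral => x _; rewrite /fubini_F /=.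
  by under eq_integral do rewrite EFinM; rewrite integralZl// ge.
by rewrite integralZr// fe.
Qed.

Lemma has_mean_iid d (T : measurableType d) (P : probability T R) n
    (f : 'I_n -> T -> R) (a : 'I_n -> R) :
  (forall i, has_mean P (f i) (a i)) ->
  has_mean (iid_prob P n) (fun x => \prod_i f i (tnth x i)) (\prod_i a i).
Proof.
elim: n f a => [|n IH] f a fa.
  by under eq_fun do rewrite big_ord0; rewrite big_ord0; exact: has_mean_cst.
apply: has_mean_pushforward.
  apply: measurable_prod => i _.
  by apply: (measurableT_comp (has_mean_measurable (fa i))); exact: measurable_tnth.
rewrite big_ord_recl.
have := has_mean_prod (fa ord0) (IH (fun i => f (lift ord0 i)) _ (fun i => fa (lift ord0 i))).
congr has_mean; apply/funext => xy /=; rewrite big_ord_recl tnth0; congr (_ * _).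
by apply: eq_bigr => i _; rewrite tnthS.
Qed.

End has_expectation.

(** * Second-moment lower bound for the risk *)

Section lower_bound.
Context (R : realType).

Lemma expectE n p (S : 'M[R]_p) (f : n.-tuple (p.-tuple R) -> R) m :
  has_mean (iid_prob (mvnormal S) n) f m -> expect S f = m.
Proof. by move=> [_ fe]; rewrite /expect unlock fe. Qed.

Lemma has_mean_test n p (S : 'M[R]_p) (D : n.-tuple (p.-tuple R) -> R) : is_test D ->
  has_mean (iid_prob (mvnormal S) n) D (expect S D).
Proof.
move=> [mD D01]; have h := has_mean_bounded (iid_prob (mvnormal S) n) mD D01.
by rewrite (expectE h).
Qed.

Lemma is_testC n p (D : n.-tuple (p.-tuple R) -> R) :
  is_test D -> is_test (fun x => 1 - D x).
Proof.
move=> [mD D01]; split; first exact: measurable_funB.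
by move=> x; have /andP[? ?] := D01 x; rewrite subr_ge0 gerBl; apply/andP.
Qed.

Lemma has_mean_lik n p (S : 'M[R]_p) (f : n.-tuple (p.-tuple R) -> R) m :
  psdmx S -> S \in unitmx -> (forall x, 0 <= f x) ->
  has_mean (iid_prob (mvnormal S) n) f m ->
  has_mean (iid_prob (mvnormal 1%:M) n)
    (fun x => f x * \prod_i lik S (tnth x i)) m.
Proof.
move=> psdS uS f0 fm; have mf := has_mean_measurable fm; have [_ fe] := fm.
apply: has_mean_ge0.
- apply: measurable_funM => //; apply: measurable_prod => i _.
  by apply: (measurableT_comp (measurable_lik S)); exact: measurable_tnth.
- by move=> x; rewrite mulr_ge0// prodr_ge0// => i _; exact: lik_ge0.
- rewrite -fe (@iid_prob_density _ _ _ (mvnormal S) (mvnormal 1%:M) (lik S))//.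
  + exact: measurable_lik.
  + exact: lik_ge0.
  + exact: mvnormal_lik.
  + exact/measurable_EFinP.
Qed.

Lemma expect_itv n p (S : 'M[R]_p) (D : n.-tuple (p.-tuple R) -> R) : is_test D ->
  0 <= expect S D <= 1.
Proof.
move=> tD; have h := has_mean_test S tD; case: tD => _ D01.
apply/andP; split.
  by apply: (has_mean_le (has_mean_cst _ 0) h) => x; case/andP: (D01 x).
by apply: (has_mean_le h (has_mean_cst _ 1)) => x; case/andP: (D01 x).
Qed.

(* Le Cam's bound for the uniform mixture over I.  c i j is the chi-square
   integral for one observation, and eta comes from |Z - 1| <=
   (Z - 1)^2 / (2 eta) + eta / 2 applied to the mixture likelihood ratio. *)
Lemma risk_ge n p (I : finType) (S : I -> 'M[R]_p) (A : set 'M[R]_p) (c : I -> I -> R)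
    (D : n.-tuple (p.-tuple R) -> R) (eta : R) : is_test D -> 0 < eta -> (0 < #|I|)%N ->
  (forall i, A (S i)) -> (forall i, psdmx (S i)) -> (forall i, S i \in unitmx) ->
  (forall i j, (\int[mvnormal 1%:M]_x (lik (S i) x * lik (S j) x)%:E = (c i j)%:E)%E) ->
  1 - eta / 2 - (#|I|%:R^-1 ^+ 2 * (\sum_i \sum_j c i j ^+ n) - 1) / (2 * eta) <= risk D A.
Proof.
move=> tD eta0 I0 AS psdS uS cE; set N : R := #|I|%:R.
set M := N^-1 ^+ 2 * _.
have N0 : 0 < N by rewrite ltr0n.
pose G := iid_prob (mvnormal (1%:M : 'M[R]_p)) n.
pose W i (x : n.-tuple (p.-tuple R)) := \prod_k lik (S i) (tnth x k).
pose LR x := N^-1 * \sum_i W i x.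
have tC := is_testC tD; have D01 := tD.2.
have mW i : has_mean G (W i) 1.
  have := @has_mean_lik n p (S i) (fun=> 1) 1 (psdS i) (uS i) (fun=> ler01) (has_mean_cst _ 1).
  by congr has_mean; apply/funext => x; rewrite mul1r.
have mLR : has_mean G LR 1.
  have := has_meanZ N^-1 (@has_mean_sum _ _ _ G _ (index_enum I) xpredT _ _ (fun i _ => mW i)).
  by rewrite sumr_const -[_ *+ _]/N mulVf// gt_eqF.
have mLR2 : has_mean G (fun x => LR x ^+ 2) M.
  have mWW i j : has_mean G (fun x => W i x * W j x) (c i j ^+ n).
    have mc : has_mean (mvnormal (1%:M : 'M[R]_p))
        (fun x => lik (S i) x * lik (S j) x) (c i j).
      apply: has_mean_ge0 => //; first by apply: measurable_funM; exact: measurable_lik.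
      by move=> x; rewrite mulr_ge0// lik_ge0.
    have := has_mean_iid (fun _ : 'I_n => mc).
    rewrite prodr_const card_ord; congr has_mean.
    by apply/funext => x; rewrite -big_split.
  have := has_meanZ (N^-1 ^+ 2) (@has_mean_sum _ _ _ G _ (index_enum I) xpredT _ _ (fun i _ =>
    @has_mean_sum _ _ _ G _ (index_enum I) xpredT _ _ (fun j _ => mWW i j))).
  congr has_mean; apply/funext => x; rewrite /LR exprMn; congr (_ * _).
  rewrite expr2 mulr_suml; apply: eq_bigr => i _.
  by rewrite mulr_sumr.
have mD : has_mean G D (expect 1%:M D).
  exact: has_mean_test.
pose b i := expect (S i) (fun x => 1 - D x).
have mb : has_mean G (fun x => (1 - D x) * LR x) (N^-1 * \sum_i b i).
  have h i := has_mean_lik (psdS i) (uS i) (fun x => (andP (tC.2 x)).1) (has_mean_test (S i) tC).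
  have := has_meanZ N^-1 (@has_mean_sum _ _ _ G _ (index_enum I) xpredT _ _ (fun i _ => h i)).
  congr has_mean; apply/funext => x; rewrite /LR mulrCA; congr (_ * _).
  by rewrite mulr_sumr.
have b_le : N^-1 * \sum_i b i <= sup [set expect T (fun x => 1 - D x) | T in A].
  rewrite ler_pdivrMl// mulr_natl -sumr_const; apply: ler_sum => i _.
  apply: ub_le_sup; last by exists (S i).
  by exists 1 => _ [T _ <-]; case/andP: (expect_itv T tC).
(* What gets integrated is the pointwise bound (1 - D)(1 - LR) <= eta / 2 + (1 - LR)^2 / (2 eta),
   with the cross term LR / eta moved to the left, so that both sides have known means. *)
have rhs := has_meanD (has_meanD mD mb)
  (has_meanD (has_mean_cst G (eta / 2)) (has_meanZ (2 * eta)^-1 (has_meanD (has_mean_cst G 1) mLR2))).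
have lhs := has_meanD (has_mean_cst G 1) (has_meanZ eta^-1 mLR).
have := has_mean_le lhs rhs; rewrite /risk => h.
have {}h : 1 + eta^-1 * 1 <= expect 1%:M D + N^-1 * (\sum_i b i) + (eta / 2 + (2 * eta)^-1 * (1 + M)).
  apply: h => x; have /andP[d0 d1] := D01 x; set r := LR x.
  have e2 : (2 * eta)^-1 = eta^-1 / 2 by rewrite invfM mulrC.
  have ie : 0 < eta^-1 by rewrite invr_gt0.
  have ee : eta * eta^-1 = 1 by rewrite divff ?gt_eqF.
  rewrite e2; set y := eta^-1 in ie ee *; set d := D x in d0 d1 *.
  have key : (1 - d) * (1 - r) <= (eta + y * (1 - r) ^+ 2) / 2.
    have k1 : (1 - d) * (1 - r) <= `|1 - r|.
      apply: (le_trans (ler_norm _)); rewrite normrM ler_piMl//.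
      by rewrite ger0_norm; lra.
    apply: (le_trans k1); set t := `|1 - r|.
    have -> : (1 - r) ^+ 2 = t ^+ 2 by rewrite /t -normrX ger0_norm ?sqr_ge0.
    have : 0 <= y * (t - eta) ^+ 2 by rewrite mulr_ge0 ?sqr_ge0// ltW.
    have -> : y * (t - eta) ^+ 2 = y * t ^+ 2 - 2 * t * (eta * y) + eta * (eta * y) by ring.
    by rewrite ee; lra.
  lra.
apply: (@le_trans _ _ (expect 1%:M D + N^-1 * \sum_i b i)); last by rewrite lerD2l.
have e2 : (2 * eta)^-1 = eta^-1 / 2 by rewrite invfM mulrC.
move: h; rewrite e2; lra.
Qed.

End lower_bound.

(** * Quadratic forms and Frobenius norms *)

Section forms.
Context (R : realType).

Definition form p (M : 'M[R]_p) (u v : 'rV[R]_p) : R := (u *m M *m v^T) 0 0.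
Definition nrm2 p (v : 'rV[R]_p) : R := \sum_i v 0 i ^+ 2.

Section forms_theory.
Context (p : nat).
Implicit Types (M S : 'M[R]_p) (u v : 'rV[R]_p).

Lemma nrm2_ge0 v : 0 <= nrm2 v.
Proof. by apply: sumr_ge0 => i _; exact: sqr_ge0. Qed.

Lemma nrm2E v : nrm2 v = (v *m v^T) 0 0.
Proof. by rewrite mxE; apply: eq_bigr => i _; rewrite mxE expr2. Qed.

Lemma nrm2_eq0 v : nrm2 v = 0 -> v = 0.
Proof.
move=> /eqP; rewrite psumr_eq0 => [/allP h|i _]; last exact: sqr_ge0.
apply/rowP => i; rewrite mxE; apply/eqP.
by rewrite -sqrf_eq0; apply: h; rewrite mem_index_enum.
Qed.

Lemma nrm2_gt0 v : v != 0 -> 0 < nrm2 v.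
Proof.
move=> v0; rewrite lt_def nrm2_ge0 andbT; apply: contraNneq v0 => /nrm2_eq0 ->.
by rewrite eqxx.
Qed.

Lemma form1 v : form 1%:M v v = nrm2 v.
Proof. by rewrite /form mulmx1 nrm2E. Qed.

Lemma formD M S u v : form (M + S) u v = form M u v + form S u v.
Proof. by rewrite /form mulmxDr mulmxDl mxE. Qed.

Lemma formB M S u v : form (M - S) u v = form M u v - form S u v.
Proof. by rewrite /form mulmxBr mulmxBl !mxE. Qed.

Lemma form_scalar (c : R) v : form c%:M v v = c * nrm2 v.
Proof. by rewrite /form mul_mx_scalar -scalemxAl mxE nrm2E. Qed.

Lemma formC M u v : M^T = M -> form M u v = form M v u.
Proof.
move=> sM; have -> : form M u v = (u *m M *m v^T)^T 0 0 by rewrite [RHS]mxE.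
by rewrite /form !trmx_mul trmxK sM mulmxA.
Qed.

Lemma psd_cauchy_schwarz M u v : psdmx M -> form M u v ^+ 2 <= form M u u * form M v v.
Proof.
move=> [sM pM].
have pos t : 0 <= form M u u + 2 * t * form M u v + t ^+ 2 * form M v v.
  have := pM (u + t *: v); rewrite mulmxDl mulmxDl linearD/= linearZ/= !mulmxDr.
  rewrite -!scalemxAl -!scalemxAr => /le_trans; apply.
  rewrite le_eqVlt; apply/orP; left; apply/eqP.
  have : (v *m M *m u^T) 0 0 = form M u v by exact: (formC v u sM).
  rewrite /form; move: (u *m M *m u^T) (u *m M *m v^T) (v *m M *m u^T) (v *m M *m v^T).
  by move=> a b c d; rewrite !mxE => ->; ring.
have pu := pM u; have pv := pM v; rewrite -/(form M u u) in pu; rewrite -/(form M v v) in pv.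
have [v0|v0] := eqVneq (form M v v) 0.
  have [w0|w0] := eqVneq (form M u v) 0; first by rewrite w0 v0 mulr0 expr0n.
  (* When [form M v v = 0] the quadratic is affine in [t], and this [t] would give it the value
     -1. *)
  have := pos (- (form M u u + 1) / (2 * form M u v)); rewrite v0 mulr0 addr0.
  have -> : 2 * (- (form M u u + 1) / (2 * form M u v)) * form M u v = - (form M u u + 1) by field.
  lra.
have {}pv : 0 < form M v v by rewrite lt_def v0.
have := pos (- form M u v / form M v v).
have -> : form M u u + 2 * (- form M u v / form M v v) * form M u v
   + (- form M u v / form M v v) ^+ 2 * form M v v
   = form M u u - form M u v ^+ 2 / form M v v by field.
by rewrite subr_ge0 ler_pdivrMr.
Qed.

Lemma cauchy_schwarz u v : (\sum_i u 0 i * v 0 i) ^+ 2 <= nrm2 u * nrm2 v.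
Proof.
have psd1 : psdmx (1%:M : 'M[R]_p).
  by split=> [|w]; rewrite ?trmx1// mulmx1 -nrm2E nrm2_ge0.
have := psd_cauchy_schwarz u v psd1; rewrite !form1 /form mulmx1 mxE.
by congr (_ ^+ 2 <= _); apply: eq_bigr => i _; rewrite mxE.
Qed.

Lemma coercive_psd M c : M^T = M -> 0 < c -> (forall v, c * nrm2 v <= form M v v) ->
  psdmx M /\ M \in unitmx.
Proof.
move=> sM c0 cM; split.
  by split=> // v; apply: (le_trans _ (cM v)); rewrite mulr_ge0 ?nrm2_ge0// ltW.
rewrite -row_free_unit -kermx_eq0; apply/eqP/row_matrixP => i; rewrite row0.
set v := row i _; apply: nrm2_eq0.
have vM : v *m M = 0 by rewrite /v -row_mul mulmx_ker row0.
apply/eqP; rewrite eq_le nrm2_ge0 andbT -(pmulr_rle0 _ c0).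
by apply: (le_trans (cM v)); rewrite /form vM mul0mx mxE.
Qed.

Lemma coercive_eigenvalue M c : (forall v, c * nrm2 v <= form M v v) ->
  forall a, eigenvalue M a -> c <= a.
Proof.
move=> cM a /eigenvalueP[v vM v0]; have := cM v.
by rewrite /form vM -scalemxAl mxE -nrm2E ler_pM2r// nrm2_gt0.
Qed.

(** Cauchy-Schwarz for the form of [M] at [w = v M^-1] and [v]: |v|^4 = M(w, v)^2 <= M(w, w) M(v,
    v), where M(w, w) is the form of [M^-1] at [v]. *)
Lemma coercive_inv M c : psdmx M -> M \in unitmx -> 0 < c ->
  (forall v, form M v v <= c * nrm2 v) ->
  forall v, c^-1 * nrm2 v <= form (invmx M) v v.
Proof.
move=> psdM uM c0 cM v; have [sM pM] := psdM.
pose w := v *m invmx M.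
have wM : w *m M = v by rewrite /w mulmxKV.
have fE : form (invmx M) v v = form M w w.
  by rewrite /form /w trmx_mul trmx_inv sM mulmxA mulmxKV.
have fw : form M w v = nrm2 v by rewrite /form wM nrm2E.
rewrite fE; have := psd_cauchy_schwarz w v psdM; rewrite fw => h.
have := pM w; rewrite -/(form M w w) => pw.
have {}h : nrm2 v ^+ 2 <= form M w w * (c * nrm2 v).
  by apply: (le_trans h); rewrite ler_wpM2l.
have [v0|v0] := eqVneq v 0.
  by rewrite [nrm2 v](_ : _ = 0) ?mulr0// /nrm2 big1// => i _; rewrite v0 mxE expr0n.
rewrite ler_pdivrMl// -(ler_pM2r (nrm2_gt0 v0)) -expr2.
by apply: (le_trans h); rewrite mulrCA mulrA.
Qed.

End forms_theory.

Definition frob2 m n (A : 'M[R]_(m, n)) : R := \sum_i \sum_j A i j ^+ 2.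

Lemma frob2_ge0 m n (A : 'M[R]_(m, n)) : 0 <= frob2 A.
Proof. by do 2 (apply: sumr_ge0 => ? _); exact: sqr_ge0. Qed.

Lemma frobenius_sqr p (A : 'M[R]_p) : frobenius A ^+ 2 = frob2 A.
Proof. by rewrite sqr_sqrtr// frob2_ge0. Qed.

Lemma frob2_rows m n (A : 'M[R]_(m, n)) : frob2 A = \sum_i nrm2 (row i A).
Proof.
by apply: eq_bigr => i _; apply: eq_bigr => j _; rewrite mxE.
Qed.

Lemma nrm2_mulmx p (v : 'rV[R]_p) (B : 'M[R]_p) : nrm2 (v *m B) <= nrm2 v * frob2 B.
Proof.
rewrite /frob2 exchange_big /= mulr_sumr; apply: ler_sum => j _; rewrite mxE.
have := cauchy_schwarz v (\row_i B i j).
by congr (_ ^+ 2 <= _ * _); apply: eq_bigr => i _; rewrite mxE.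
Qed.

(** With [M = A A^T] the form is |v A|^2, and |v| <= |A^-1|_F |v A|. The 1 added to the squared
    Frobenius norm keeps the denominator positive even for [p = 0]. *)
Lemma psd_unit_coercive p (M : 'M[R]_p) : psdmx M -> M \in unitmx ->
  exists2 c, 0 < c & forall v, c * nrm2 v <= form M v v.
Proof.
move=> psdM uM; have [trA AA] := cholP psdM; set A := chol M in AA.
have uA : A \in unitmx by move: uM; rewrite -AA unitmx_mul => /andP[].
have k0 : 0 < 1 + frob2 (invmx A) by rewrite ltr_wpDr ?frob2_ge0.
exists (1 + frob2 (invmx A))^-1; first by rewrite invr_gt0.
move=> v; rewrite ler_pdivrMl//.
have -> : form M v v = nrm2 (v *m A) by rewrite /form -AA nrm2E trmx_mul !mulmxA.
have := nrm2_mulmx (v *m A) (invmx A); rewrite mulmxK// => /le_trans; apply.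
by rewrite mulrC ler_wpM2r ?nrm2_ge0// lerDr.
Qed.

(* The largest t such that S - t I is non-negative is attained, and S - t I is
   then singular, so that t is an eigenvalue of S. *)
Lemma eigenvalue_coercive p (S : 'M[R]_p) lambda : psdmx S -> 0 < lambda ->
  (forall a, eigenvalue S a -> lambda <= a) ->
  forall v, lambda * nrm2 v <= form S v v.
Proof.
move=> psdS l0 eS v; have [sS pS] := psdS.
have [->|v0] := eqVneq v 0.
  rewrite [nrm2 _](_ : _ = 0) ?mulr0; first by rewrite /form mul0mx mul0mx mxE.
  by rewrite /nrm2 big1// => i _; rewrite mxE expr0n.
pose T : set R := [set t | forall v, t * nrm2 v <= form S v v].
have T0 : T 0 by move=> w; rewrite mul0r; exact: pS.
have supT : has_sup T.
  split; first by exists 0.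
  by exists (form S v v / nrm2 v) => t /(_ v); rewrite ler_pdivlMr ?nrm2_gt0.
have Ts : T (sup T).
  move=> w; have [->|w0] := eqVneq w 0.
    rewrite [nrm2 _](_ : _ = 0) ?mulr0; first by rewrite /form mul0mx mul0mx mxE.
    by rewrite /nrm2 big1// => i _; rewrite mxE expr0n.
  rewrite -ler_pdivlMr ?nrm2_gt0//; apply: ge_sup; first by exists 0.
  by move=> t /(_ w); rewrite ler_pdivlMr ?nrm2_gt0.
have [ls|sl] := leP lambda (sup T).
  by apply: (le_trans _ (Ts v)); rewrite ler_wpM2r ?nrm2_ge0.
exfalso; pose M := S - (sup T)%:M.
have fM w : form M w w = form S w w - sup T * nrm2 w by rewrite formB form_scalar.
have psdM : psdmx M.
  split; first by rewrite /M linearB/= tr_scalar_mx sS.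
  by move=> w; rewrite -/(form M w w) fM subr_ge0.
have [uM|uM] := boolP (M \in unitmx); last first.
  have /eS : eigenvalue S (sup T) by rewrite /eigenvalue /eigenspace kermx_eq0 row_free_unit.
  by rewrite leNgt sl.
have [c c0 cM] := psd_unit_coercive psdM uM.
have : T (sup T + c) by move=> w; have := cM w; rewrite fM mulrDl; lra.
by move=> /(ub_le_sup supT.2); rewrite gerDl leNgt c0.
Qed.

Lemma coercive_mulmx p (S : 'M[R]_p) lambda (v : 'rV[R]_p) : 0 < lambda ->
  (forall v, lambda * nrm2 v <= form S v v) -> lambda ^+ 2 * nrm2 v <= nrm2 (v *m S).
Proof.
move=> l0 cS; have [->|v0] := eqVneq v 0.
  rewrite [nrm2 0](_ : _ = 0) ?mulr0 ?nrm2_ge0//.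
  by rewrite /nrm2 big1// => i _; rewrite mxE expr0n.
have nv := nrm2_gt0 v0.
have h : form S v v ^+ 2 <= nrm2 (v *m S) * nrm2 v.
  have := cauchy_schwarz (v *m S) v; congr (_ ^+ 2 <= _).
  by rewrite /form mxE; apply: eq_bigr => i _; rewrite [v^T _ _]mxE.
rewrite -(ler_pM2r nv); apply: (le_trans _ h).
rewrite -mulrA -expr2 -exprMn ler_sqr ?nnegrE//; first by rewrite mulr_ge0 ?ltW.
by apply: (le_trans _ (cS v)); rewrite mulr_ge0 ?ltW.
Qed.

Lemma frob2_mulmx_ge p (M S : 'M[R]_p) lambda : 0 < lambda ->
  (forall v, lambda * nrm2 v <= form S v v) -> lambda ^+ 2 * frob2 M <= frob2 (M *m S).
Proof.
move=> l0 cS; rewrite !frob2_rows mulr_sumr; apply: ler_sum => i _.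
by rewrite row_mul; exact: coercive_mulmx.
Qed.

(** Right multiplication by [S] turns [S^-1 - I] into [I - S] and, [S] being bounded below by
    [lambda], shrinks no row norm by more than the factor [lambda]. *)
Lemma frob2_inv_le p (S : 'M[R]_p) lambda : psdmx S -> 0 < lambda ->
  (forall a, eigenvalue S a -> lambda <= a) ->
  lambda ^+ 2 * frob2 (invmx S - 1%:M) <= frob2 (S - 1%:M).
Proof.
move=> psdS l0 eS; have cS := eigenvalue_coercive psdS l0 eS.
have [_ uS] := coercive_psd psdS.1 l0 cS.
apply: (le_trans (frob2_mulmx_ge _ l0 cS)).
rewrite mulmxBl mulVmx// mul1mx le_eqVlt; apply/orP; left; apply/eqP.
by do 2 (apply: eq_bigr => ? _); rewrite !mxE -sqrrN opprB.
Qed.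

Section schur.
Context (p : nat) (A : 'M[R]_p) (rho : R).
Hypothesis symA : A^T = A.
Hypothesis rowA : forall i, \sum_j `|A i j| <= rho.

Let symE i j : A i j = A j i.
Proof. by rewrite -[in LHS]symA mxE. Qed.

Lemma schur_form (v : 'rV[R]_p) : `|form A v v| <= rho * nrm2 v.
Proof.
have h : `|form A v v| <= \sum_i \sum_j `|A i j| * ((v 0 i ^+ 2 + v 0 j ^+ 2) / 2).
  rewrite /form mxE exchange_big; apply: (le_trans (ler_norm_sum _ _ _)).
  apply: ler_sum => j _; rewrite !mxE mulr_suml.
  apply: (le_trans (ler_norm_sum _ _ _)); apply: ler_sum => i _.
  rewrite mulrAC mulrC normrM ler_wpM2l//.
  have := sqr_ge0 (v 0 i - v 0 j); have := sqr_ge0 (v 0 i + v 0 j).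
  by rewrite ler_norml sqrrD sqrrB => h1 h2; apply/andP; split; lra.
apply: (le_trans h).
have -> : \sum_i \sum_j `|A i j| * ((v 0 i ^+ 2 + v 0 j ^+ 2) / 2) =
    \sum_i (\sum_j `|A i j|) * v 0 i ^+ 2.
  transitivity ((\sum_i \sum_j `|A i j| * v 0 i ^+ 2 + \sum_i \sum_j `|A i j| * v 0 j ^+ 2) / 2).
    rewrite -big_split mulr_suml; apply: eq_bigr => i _.
    rewrite -big_split mulr_suml; apply: eq_bigr => j _ /=; ring.
  rewrite [X in (_ + X) / 2]exchange_big /=.
  under [X in (_ + X) / 2]eq_bigr do under eq_bigr do rewrite symE.
  under [RHS]eq_bigr do rewrite mulr_suml.
  by set t := \sum_i \sum_j _; field.
by rewrite /nrm2 mulr_sumr; apply: ler_sum => i _; rewrite ler_wpM2r ?sqr_ge0.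
Qed.

(** Schur's test: Cauchy-Schwarz with [|A i j|] split into two square roots, then the row sums are
    used once and, by symmetry, the column sums once. *)
Lemma schur_mulmx (v : 'rV[R]_p) : nrm2 (v *m A) <= rho ^+ 2 * nrm2 v.
Proof.
have [->|v0] := eqVneq v 0.
  rewrite mul0mx [nrm2 _](_ : _ = 0) ?mulr0//.
  by rewrite /nrm2 big1// => i _; rewrite mxE expr0n.
have i0 : exists i : 'I_p, True.
  by move/rV0Pn: v0 => [i _]; exists i.
have rho0 : 0 <= rho.
  by have [i _] := i0; apply: (le_trans _ (rowA i)); exact: sumr_ge0.
have h j : (v *m A) 0 j ^+ 2 <= rho * \sum_i v 0 i ^+ 2 * `|A i j|.
  rewrite mxE; pose u : 'rV[R]_p := \row_i Num.sqrt `|A i j|.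
  pose w : 'rV[R]_p := \row_i (Num.sqrt `|A i j| * `|v 0 i|).
  have := cauchy_schwarz u w.
  have -> : nrm2 w = \sum_i v 0 i ^+ 2 * `|A i j|.
    by apply: eq_bigr => i _; rewrite mxE mulrC exprMn sqr_sqrtr// real_normK ?num_real.
  have uE : nrm2 u = \sum_i `|A j i|.
    by apply: eq_bigr => i _; rewrite mxE sqr_sqrtr// symE.
  have s0 : 0 <= \sum_i v 0 i ^+ 2 * `|A i j| by apply: sumr_ge0 => i _; rewrite mulr_ge0 ?sqr_ge0.
  move=> cs; apply: (@le_trans _ _ (nrm2 u * \sum_i v 0 i ^+ 2 * `|A i j|)); last first.
    by rewrite ler_wpM2r// uE.
  apply: (le_trans _ cs); rewrite -ler_sqrt ?sqr_ge0// !sqrtr_sqr.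
  apply: (le_trans (ler_norm_sum _ _ _)); apply: (le_trans _ (ler_norm _)).
  apply: ler_sum => i _; rewrite !mxE mulrA -expr2 sqr_sqrtr// normrM mulrC//.
apply: (@le_trans _ _ (\sum_j rho * \sum_i v 0 i ^+ 2 * `|A i j|)).
  by apply: ler_sum.
rewrite -mulr_sumr exchange_big /= expr2 -mulrA ler_wpM2l// /nrm2 mulr_sumr.
by apply: ler_sum => i _; rewrite -mulr_sumr mulrC ler_wpM2r ?sqr_ge0.
Qed.

End schur.

End forms.

(** * The random-sign prior *)

Section signs.
Context (R : realType).
Local Notation signs T := {ffun 'I_T -> bool}.

Definition sgn (b : bool) : R := (-1) ^+ b.
Definition sign_sum T (e : signs T) : R := \sum_i sgn (e i).
Definition savg T (F : signs T -> R) : R := (2 ^+ T)^-1 * \sum_e F e.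

Lemma savg_le T (F F' : signs T -> R) : (forall e, F e <= F' e) -> savg F <= savg F'.
Proof. by move=> h; rewrite ler_wpM2l ?invr_ge0 ?exprn_ge0//; apply: ler_sum. Qed.

Lemma savgZ T c (F : signs T -> R) : savg (fun e => c * F e) = c * savg F.
Proof. by rewrite /savg -mulr_sumr mulrCA. Qed.

Lemma savg_recl T (F : signs T.+1 -> R) :
  savg F = savg (fun e : signs T =>
    (F [ffun i => oapp e true (unlift ord0 i)] + F [ffun i => oapp e false (unlift ord0 i)]) / 2).
Proof.
pose c (ae : bool * signs T) : signs T.+1 := [ffun i => oapp ae.2 ae.1 (unlift ord0 i)].
have bc : bijective c.
  exists (fun f : signs T.+1 => (f ord0, [ffun i => f (lift ord0 i)])).
    move=> [a e]; rewrite /c /= ffunE unlift_none /=; congr (_, _).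
    by apply/ffunP => i; rewrite !ffunE liftK.
  move=> f; apply/ffunP => i; rewrite ffunE /=.
  by case: unliftP => [j ->|->]; rewrite /= ?ffunE.
rewrite /savg (reindex c) /=; last exact: onW_bij.
rewrite -(pair_big xpredT xpredT (fun a e => F (c (a, e)))) /= big_bool /= -big_split.
by rewrite exprS invfM -mulrA mulrCA mulr_sumr; congr (_ * _); apply: eq_bigr => e _; rewrite mulrC.
Qed.

Lemma sign_sum_recl T a (e : signs T) :
  sign_sum [ffun i => oapp e a (unlift ord0 i)] = sgn a + sign_sum e.
Proof.
rewrite /sign_sum big_ord_recl ffunE unlift_none; congr (_ + _).
by apply: eq_bigr => i _; rewrite ffunE liftK.
Qed.

(** 1 / (1 - x) = 1 + x / (1 - x) <= exp(x / (1 - x)), and x / (1 - x) <= x + 2 x^2 amounts to x^2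
    (1 - 2 x) >= 0. *)
Lemma inv_onem_le (x : R) : x <= 1 / 2 -> (1 - x)^-1 <= expR (x + 2 * x ^+ 2).
Proof.
move=> x2; have x1 : 0 < 1 - x by lra.
have -> : (1 - x)^-1 = 1 + x / (1 - x) by field; rewrite gt_eqF.
apply: (le_trans (expR_ge1Dx _)); rewrite ler_expR ler_pdivrMr//.
have := sqr_ge0 x; rewrite -subr_ge0 => h.
have -> : (x + 2 * x ^+ 2) * (1 - x) = x + x ^+ 2 * (1 - 2 * x) by ring.
by rewrite lerDl mulr_ge0 ?sqr_ge0//; lra.
Qed.

(** A crude form of cosh y <= exp(y^2 / 2), only orders of magnitude being at stake. For y^2 <= 1/2,
    cosh y is at most the mean of 1 / (1 - y) and 1 / (1 + y), which is 1 / (1 - y^2); otherwise y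
    and -y are both below 2 y^2. *)
Lemma cosh_le (y : R) : (expR y + expR (- y)) / 2 <= expR (2 * y ^+ 2).
Proof.
have [y2|y2] := leP (y ^+ 2) (1 / 2).
  have y1 : 0 < 1 - y by nra.
  have y1' : 0 < 1 + y by nra.
  have y12 : 0 < 1 - y ^+ 2 by lra.
  have h1 : expR y <= (1 - y)^-1.
    rewrite -[expR y]invrK -expRN lef_pV2 ?posrE ?expR_gt0//.
    by have := expR_ge1Dx (- y).
  have h2 : expR (- y) <= (1 + y)^-1.
    by rewrite expRN lef_pV2 ?posrE ?expR_gt0//; exact: expR_ge1Dx.
  apply: (@le_trans _ _ (1 - y ^+ 2)^-1).
    have -> : (1 - y ^+ 2)^-1 = ((1 - y)^-1 + (1 + y)^-1) / 2.
      by field; rewrite !gt_eqF.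
    by lra.
  have -> : (1 - y ^+ 2)^-1 = 1 + y ^+ 2 / (1 - y ^+ 2) by field; rewrite gt_eqF.
  apply: (le_trans (expR_ge1Dx _)); rewrite ler_expR ler_pdivrMr//.
  have := sqr_ge0 y; nra.
have h z : z ^+ 2 = y ^+ 2 -> expR z <= expR (2 * y ^+ 2) 
  by move=> zy; rewrite -zy in y2 *; rewrite ler_expR; have [z2|z2] := leP z (1 / 2); [lra | nra].
by have := h y erefl; have := h (- y) (sqrrN y); lra.
Qed.

Lemma savg_exp T (l : R) : savg (fun e : signs T => expR (l * sign_sum e)) <= expR (2 * T%:R * l ^+ 2).
Proof.
elim: T => [|T IH].
  rewrite /savg expr0 invr1 mul1r (eq_bigr (fun=> 1)) => [|e _].
    by rewrite sumr_const card_ffun card_ord expn0 mulr1n mulr0 mul0r expR0.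
  by rewrite /sign_sum big_ord0 mulr0 expR0.
rewrite savg_recl.
under [X in savg X]eq_fun do rewrite !sign_sum_recl /sgn expr1 expr0 !mulrDr !expRD mulr1 mulrN1 -mulrDl mulrAC addrC.
rewrite savgZ.
apply: (@le_trans _ _ (expR (2 * l ^+ 2) * expR (2 * T%:R * l ^+ 2))).
  rewrite ler_pM ?cosh_le//.
  by rewrite /savg mulr_ge0 ?invr_ge0 ?exprn_ge0// sumr_ge0// => e _; exact: expR_ge0.
have tE : T.+1%:R = T%:R + 1 :> R by rewrite natr1.
by rewrite -expRD tE ler_expR; lra.
Qed.

(** Averaging over one sign multiplies exp(S^2 / m) by exp(1 / m) cosh(2 S / m), and S^2 / m + 8 S^2
    / m^2 <= S^2 / (m - 8) because (m + 8)(m - 8) <= m^2. Each sign thus lowers [m] by 8: with the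
    coefficient written as 1 / m, the loss is additive. *)
Lemma savg_exp_sqr_aux T (m : R) : 8 * T%:R < m ->
  savg (fun e : signs T => expR (sign_sum e ^+ 2 / m)) <= expR (T%:R / (m - 8 * T%:R)).
Proof.
elim: T m => [|T IH] m.
  move=> _; rewrite /savg expr0 invr1 mul1r (eq_bigr (fun=> 1)) => [|e _].
    by rewrite sumr_const card_ffun card_ord expn0 mulr1n mul0r expR0.
  by rewrite /sign_sum big_ord0 expr0n mul0r expR0.
have tE : T.+1%:R = T%:R + 1 :> R by rewrite natr1.
rewrite tE => Tm; have T0 : 0 <= T%:R :> R by [].
set t : R := T%:R in IH Tm T0 *.
have m0 : 0 < m by lra.
have m8 : 0 < m - 8 by lra.
rewrite savg_recl.
apply: (@le_trans _ _ (savg (fun e : signs T => expR m^-1 * expR (sign_sum e ^+ 2 / (m - 8))))).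
  apply: savg_le => e; rewrite !sign_sum_recl /sgn expr1 expr0; set S := sign_sum e.
  have -> : (-1 + S) ^+ 2 / m = m^-1 + S ^+ 2 / m + - (2 * S / m) by field; rewrite gt_eqF.
  have -> : (1 + S) ^+ 2 / m = m^-1 + S ^+ 2 / m + 2 * S / m by field; rewrite gt_eqF.
  rewrite !(expRD (m^-1 + _)) -mulrDr -mulrA.
  apply: (@le_trans _ _ (expR (m^-1 + S ^+ 2 / m) * expR (2 * (2 * S / m) ^+ 2))).
    by rewrite ler_wpM2l ?expR_ge0// addrC cosh_le.
  rewrite -!expRD ler_expR -addrA lerD2l.
  have -> : S ^+ 2 / m + 2 * (2 * S / m) ^+ 2 = S ^+ 2 * ((m + 8) / m ^+ 2).
    by field; rewrite gt_eqF.
  rewrite ler_wpM2l ?sqr_ge0// ler_pdivrMr ?exprn_gt0// mulrC ler_pdivlMr//.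
  by rewrite -subr_ge0 (_ : _ - _ = 64)//; ring.
rewrite savgZ; apply: (@le_trans _ _ (expR m^-1 * expR (t / (m - 8 - 8 * t)))).
  by rewrite ler_wpM2l ?expR_ge0//; apply: IH; lra.
rewrite -expRD ler_expR.
have -> : m - 8 * (t + 1) = m - 8 - 8 * t by ring.
have d0 : 0 < m - 8 - 8 * t by lra.
have dm : m - 8 - 8 * t <= m by lra.
move: (m - 8 - 8 * t) d0 dm => q q0 qm.
by rewrite mulrDl mul1r [leRHS]addrC lerD2r lef_pV2 ?posrE.
Qed.

Lemma savg_exp_sqr T (c : R) : 0 <= c -> 16 * T%:R * c <= 1 ->
  savg (fun e : signs T => expR (c * sign_sum e ^+ 2)) <= expR (2 * T%:R * c).
Proof.
move=> c0 Tc; have [->|cn0] := eqVneq c 0.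
  rewrite mulr0 expR0 /savg (eq_bigr (fun=> 1)) => [|e _]; last by rewrite mul0r expR0.
  by rewrite sumr_const card_ffun card_ord card_bool natrX mulVf// expf_neq0.
have {cn0}c0 : 0 < c by rewrite lt_def cn0.
have m0 : 0 < c^-1 by rewrite invr_gt0.
have T0 : 0 <= T%:R :> R by [].
have Tm : 16 * T%:R <= c^-1 by rewrite -[c^-1]mul1r ler_pdivlMr.
have cm : c * c^-1 = 1 by rewrite divff ?gt_eqF.
have Tm' : 8 * T%:R < c^-1 by nra.
apply: (@le_trans _ _ (savg (fun e : signs T => expR (sign_sum e ^+ 2 / c^-1)))).
  by apply: savg_le => e; rewrite invrK mulrC.
apply: (le_trans (savg_exp_sqr_aux Tm')).
rewrite ler_expR ler_pdivrMr; last by lra.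
have -> : 2 * T%:R * c * (c^-1 - 8 * T%:R) = 2 * T%:R * (c * c^-1) - T%:R * (16 * T%:R * c) by ring.
by rewrite cm; nra.
Qed.

Lemma savgD T (F F' : signs T -> R) : savg (fun e => F e + F' e) = savg F + savg F'.
Proof. by rewrite /savg big_split mulrDr. Qed.

Lemma sgn_norm b : `|sgn b| = 1.
Proof. by rewrite /sgn normrX normrN1 expr1n. Qed.

Lemma sign_sum_norm T (e : signs T) : `|sign_sum e| <= T%:R.
Proof.
apply: (le_trans (ler_norm_sum _ _ _)).
by rewrite (eq_bigr (fun=> 1)) ?sumr_const ?card_ord// => i _; exact: sgn_norm.
Qed.

(** With x = s2 X Y, (1 - x)^-n <= exp(n x) exp(2 n x^2), and the arithmetic-geometric mean
    inequality separates the factors. One sum being fixed, the linear part is averaged by [savg_exp]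
    and the quadratic one by [savg_exp_sqr]; both leave the exponential of a multiple of the square
    of the other sum, to which [savg_exp_sqr] applies again. *)
Lemma savg_block T (n : nat) (s2 : R) : (0 < n)%N -> 0 <= s2 ->
  s2 * T%:R ^+ 2 <= 1 / 2 -> n%:R * s2 * T%:R <= 1 / 32 ->
  savg (fun e : signs T => savg (fun e' : signs T =>
    ((1 - s2 * (sign_sum e * sign_sum e'))^-1) ^+ n)) <= expR (16 * (n%:R * s2 * T%:R) ^+ 2).
Proof.
move=> n0 s0 sT nsT; set N : R := n%:R in nsT *; set t : R := T%:R in sT nsT *.
have N1 : 1 <= N by rewrite ler1n.
have t0 : 0 <= t by [].
have N0 : 0 <= N by lra.
set th := N * s2 * t in nsT *.
have th0 : 0 <= th by rewrite !mulr_ge0// ler0n.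
have sq (e : signs T) : sign_sum e ^+ 2 <= t ^+ 2.
  by rewrite -real_normK ?num_real// ler_sqr ?nnegrE//; exact: sign_sum_norm.
pose f1 (e e' : signs T) := expR (2 * N * s2 * sign_sum e' * sign_sum e).
pose f2 (e e' : signs T) := expR (4 * N * s2 ^+ 2 * sign_sum e' ^+ 2 * sign_sum e ^+ 2).
have step1 (e e' : signs T) : ((1 - s2 * (sign_sum e * sign_sum e'))^-1) ^+ n <=
    (f1 e' e + f2 e' e) / 2.
  set x := s2 * _.
  have x2 : `|x| <= 1 / 2.
    apply: (le_trans _ sT); rewrite normrM ger0_norm// ler_wpM2l// normrM expr2.
    by rewrite ler_pM//; exact: sign_sum_norm.
  have x1 : x <= 1 / 2 by apply: (le_trans (ler_norm _)).
  have i0 : 0 <= (1 - x)^-1 by rewrite invr_ge0; lra.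
  apply: (@le_trans _ _ (expR (x + 2 * x ^+ 2) ^+ n)).
    by rewrite lerXn2r ?nnegrE ?expR_ge0// inv_onem_le.
  rewrite -expRM_natl -/N mulrDr expRD.
  have -> : f1 e' e = expR (N * x) ^+ 2.
    by rewrite -expRM_natl /f1; congr expR; rewrite /x; ring.
  have -> : f2 e' e = expR (N * (2 * x ^+ 2)) ^+ 2.
    by rewrite -expRM_natl /f2; congr expR; rewrite /x; ring.
  by have := sqr_ge0 (expR (N * x) - expR (N * (2 * x ^+ 2))); rewrite sqrrB; lra.
apply: (@le_trans _ _ (savg (fun e => savg (fun e' => (f1 e' e + f2 e' e) / 2)))).
  by do 2 (apply: savg_le => ?); exact: step1.
have -> : savg (fun e => savg (fun e' => (f1 e' e + f2 e' e) / 2)) =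
   (savg (fun e => savg (f1^~ e)) + savg (fun e => savg (f2^~ e))) / 2.
  rewrite -savgD mulrC -savgZ; congr savg; apply/funext => e.
  by rewrite -savgD -savgZ; congr savg; apply/funext => e'; rewrite mulrC.
have b1 : savg (fun e => savg (f1^~ e)) <= expR (16 * th ^+ 2).
  apply: (@le_trans _ _ (savg (fun e : signs T => expR (8 * t * (N * s2) ^+ 2 * sign_sum e ^+ 2)))).
    apply: savg_le => e; apply: (le_trans (savg_exp _ (2 * N * s2 * sign_sum e))).
    by rewrite ler_expR le_eqVlt; apply/orP; left; apply/eqP; rewrite -/t; ring.
  apply: (le_trans (savg_exp_sqr _ _)).
  - by rewrite !mulr_ge0// sqr_ge0.
  - have -> : 16 * T%:R * (8 * t * (N * s2) ^+ 2) = 128 * th ^+ 2 by rewrite /th -/t; ring.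
    nra.
  - by rewrite ler_expR le_eqVlt; apply/orP; left; apply/eqP; rewrite /th -/t; ring.
have b2 : savg (fun e => savg (f2^~ e)) <= expR (16 * th ^+ 2).
  have c20 (e : signs T) : 0 <= 4 * N * s2 ^+ 2 * sign_sum e ^+ 2.
    by rewrite mulr_ge0 ?sqr_ge0// !mulr_ge0.
  apply: (@le_trans _ _ (savg (fun e : signs T => expR (8 * t * N * s2 ^+ 2 * sign_sum e ^+ 2)))).
    apply: savg_le => e; apply: (le_trans (savg_exp_sqr (c20 e) _)).
      (* 64 th s2 t^2 <= 64 (1/32) (1/2) = 1: this fixes the constant 1/32. *)
      apply: (@le_trans _ _ (64 * th * (s2 * t ^+ 2))); last nra.
      have -> : 64 * th * (s2 * t ^+ 2) = 16 * t * (4 * N * s2 ^+ 2 * t ^+ 2).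
        by rewrite /th; ring.
      by rewrite !ler_wpM2l// !mulr_ge0 ?sqr_ge0.
    by rewrite ler_expR le_eqVlt; apply/orP; left; apply/eqP; rewrite -/t; ring.
  (* [N >= 1] brings the quadratic part under the bound already found for the linear one. *)
  have h : N * s2 ^+ 2 * t ^+ 2 <= th ^+ 2.
    have -> : th ^+ 2 = N * (N * s2 ^+ 2 * t ^+ 2) by rewrite /th; ring.
    by rewrite ler_peMl// !mulr_ge0 ?sqr_ge0.
  apply: (le_trans (savg_exp_sqr _ _)).
  - by rewrite !mulr_ge0 ?sqr_ge0.
  - have -> : 16 * T%:R * (8 * t * N * s2 ^+ 2) = 128 * (N * s2 ^+ 2 * t ^+ 2) by rewrite -/t; ring.
    nra.
  - rewrite ler_expR.
    have -> : 2 * T%:R * (8 * t * N * s2 ^+ 2) = 16 * (N * s2 ^+ 2 * t ^+ 2) by rewrite -/t; ring.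
    by lra.
lra.
Qed.

End signs.

(** Sylvester's identity: [N P] and [P N] have the same determinant, and both are block triangular
    with an identity block. *)
Lemma det_1B_mulmxC (R : comNzRingType) m n (X : 'M[R]_(m, n)) (Y : 'M[R]_(n, m)) :
  \det (1%:M - X *m Y) = \det (1%:M - Y *m X).
Proof.
pose N : 'M[R]_(m + n) := block_mx 1%:M X Y 1%:M.
pose P : 'M[R]_(m + n) := block_mx 1%:M 0 (- Y) 1%:M.
have <- : \det (N *m P) = \det (1%:M - X *m Y).
  rewrite mulmx_block !mulmx1 !mul1mx mulmx0 add0r mulmxN subrr.
  by rewrite add0r det_ublock det1 mulr1.
have <- : \det (P *m N) = \det (1%:M - Y *m X).
  rewrite mulmx_block !mulmx1 !mul1mx !mul0mx addr0 addNr.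
  by rewrite addr0 mulNmx addrC det_ublock det1 mul1r.
by rewrite !det_mulmx mulrC.
Qed.

(** * Perturbations of the identity by pairs of sign vectors *)

Section prior.
Context (R : realType) (p B T : nat).
Context (e : 'I_B -> bool -> 'I_T -> 'I_p).
Hypothesis e_inj : forall b h r b' h' r', e b h r = e b' h' r' -> [/\ b = b', h = h' & r = r'].
Local Notation signs := {ffun 'I_T -> bool}.
Local Notation sgn := (sgn R).
Local Notation prior := {ffun 'I_B -> signs * signs}.
Implicit Types w : prior.

Definition half w b h : signs := if h then (w b).2 else (w b).1.

Definition sign_mx h w : 'M[R]_(p, B) :=
  \matrix_(i, b) \sum_r (e b h r == i)%:R * sgn (half w b h r).

Definition overlap h w w' b : R := \sum_r sgn (half w b h r) * sgn (half w' b h r).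

Lemma sign_mx_gram h w w' :
  (sign_mx h w)^T *m sign_mx h w' = diag_mx (\row_b overlap h w w' b).
Proof.
apply/matrixP => b b'; rewrite !mxE.
transitivity (\sum_r \sum_r' sgn (half w b h r) * sgn (half w' b' h r') * (e b h r == e b' h r')%:R).
  under eq_bigr do rewrite !mxE mulr_suml.
  rewrite exchange_big; apply: eq_bigr => r _ /=.
  under eq_bigr do rewrite mulr_sumr.
  rewrite exchange_big; apply: eq_bigr => r' _ /=.
  rewrite (bigD1 (e b h r))//= eqxx mul1r big1 ?addr0 => [|i /negbTE ni].
    by rewrite mulrCA mulrC eq_sym.
  by rewrite eq_sym ni !mul0r.
have [->|bb] := eqVneq b b'; last first.
  rewrite mulr0n big1// => r _; rewrite big1// => r' _.
  by case: eqP => [/e_inj[/eqP]|]; rewrite ?(negbTE bb) ?mulr0.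
rewrite mulr1n /overlap; apply: eq_bigr => r _.
rewrite (bigD1 r)//= eqxx mulr1 big1 ?addr0// => r' rr.
by case: eqP => [/e_inj[_ _ /esym/eqP]|]; rewrite ?(negbTE rr) ?mulr0.
Qed.

Lemma sign_mx_orth w w' : (sign_mx true w)^T *m sign_mx false w' = 0.
Proof.
apply/matrixP => b b'; rewrite !mxE big1// => i _; rewrite !mxE.
rewrite mulr_suml big1// => r _; rewrite mulr_sumr big1// => r' _.
have [<-|_] := eqVneq (e b true r) i; last by rewrite !mul0r.
by case: eqP => [/e_inj[]//|_]; rewrite !mul0r mulr0.
Qed.

Lemma sign_mx_orth' w w' : (sign_mx false w)^T *m sign_mx true w' = 0.
Proof. by rewrite -[LHS]trmxK trmx_mul trmxK sign_mx_orth trmx0. Qed.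

(* h = false, true select the two segments of a pair; the b-th columns of the
   two sign matrices are the sign vectors u and v. *)
Definition pert (s : R) w : 'M[R]_p :=
  s *: (sign_mx false w *m (sign_mx true w)^T + sign_mx true w *m (sign_mx false w)^T).

Lemma pert_sym s w : (pert s w)^T = pert s w.
Proof. by rewrite linearZ/= linearD/= !trmx_mul !trmxK addrC. Qed.

(** Each factor exchanges the two families of segments, so the product preserves them and the mixed
    terms vanish by orthogonality of the supports. *)
Lemma pert_mul s w w' : pert s w *m pert s w' = s ^+ 2 *:
  (sign_mx false w *m diag_mx (\row_b overlap true w w' b) *m (sign_mx false w')^T +
   sign_mx true w *m diag_mx (\row_b overlap false w w' b) *m (sign_mx true w')^T).
Proof.
rewrite /pert -scalemxAl -scalemxAr scalerA -expr2; congr (_ *: _).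
rewrite mulmxDl !mulmxDr !mulmxA.
rewrite -(mulmxA (sign_mx false w) _ (sign_mx false w')) sign_mx_orth.
rewrite -(mulmxA (sign_mx true w) _ (sign_mx true w')) sign_mx_orth'.
rewrite !mulmx0 !mul0mx add0r addr0.
by rewrite -(mulmxA _ (sign_mx true w)^T) -(mulmxA _ (sign_mx false w)^T) !sign_mx_gram.
Qed.

(** [X] and [Y] carry the two families of segments and [X Y = 0], so I - (X + Y) = (I - X)(I - Y).
    Sylvester's identity reduces each factor to a diagonal matrix of size [B], and the two
    determinants agree. The resulting square cancels the square root in [lik_prod]. *)
Lemma det_pert s w w' : \det (1%:M - pert s w *m pert s w') =
  (\prod_b (1 - s ^+ 2 * (overlap false w w' b * overlap true w w' b))) ^+ 2.
Proof.
rewrite pert_mul scalerDr.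
set X := s ^+ 2 *: _; set Y := s ^+ 2 *: _.
have XY : X *m Y = 0.
  rewrite /X /Y -scalemxAl -scalemxAr !mulmxA.
  by rewrite -(mulmxA _ (sign_mx false w')^T) sign_mx_orth' mulmx0 !mul0mx !scaler0.
have -> : 1%:M - (X + Y) = (1%:M - X) *m (1%:M - Y).
  by rewrite mulmxBr mulmx1 mulmxBl mul1mx XY subr0 opprD addrA.
have overlapC h b : overlap h w' w b = overlap h w w' b.
  by apply: eq_bigr => r _; rewrite mulrC.
have half_det h h' : \det (1%:M - s ^+ 2 *: (sign_mx h w *m diag_mx (\row_b overlap h' w w' b)
    *m (sign_mx h w')^T)) = \prod_b (1 - s ^+ 2 * (overlap h w w' b * overlap h' w w' b)).
  rewrite -mulmxA scalemxAr det_1B_mulmxC -scalemxAl -mulmxA sign_mx_gram mulmx_diag.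
  set d := \row_j _.
  have -> : 1%:M - s ^+ 2 *: diag_mx d = diag_mx (\row_j (1 - s ^+ 2 * d 0 j)).
    apply/matrixP => i j; rewrite !mxE; case: eqP => _; rewrite ?mulr1n// !mulr0n mulr0 subr0//.
  rewrite det_diag; apply: eq_bigr => b _; rewrite !mxE overlapC.
  by rewrite [overlap h' _ _ _ * _]mulrC.
rewrite det_mulmx !half_det expr2; congr (_ * _).
by apply: eq_bigr => b _; rewrite [overlap true _ _ _ * _]mulrC.
Qed.

Definition hit h i b : R := \sum_r (e b h r == i)%:R.

Lemma sign_mx_le h w i b : `|sign_mx h w i b| <= hit h i b.
Proof.
rewrite mxE; apply: (le_trans (ler_norm_sum _ _ _)); apply: ler_sum => r _.
by rewrite normrM sgn_norm mulr1 normr_nat.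
Qed.

Lemma sum_hit h b : \sum_i hit h i b = T%:R.
Proof.
rewrite exchange_big /= (eq_bigr (fun=> 1)) ?sumr_const ?card_ord// => r _.
by rewrite (bigD1 (e b h r))//= eqxx big1 ?addr0// => i; rewrite eq_sym => /negbTE ->.
Qed.

Lemma hit_le1 i : \sum_b (hit false i b + hit true i b) <= 1.
Proof.
have [/existsP[b /existsP[h /existsP[r /eqP ei]]]|no] :=
    boolP [exists b, exists h, exists r, e b h r == i].
  have hE b' h' : hit h' i b' = ((b' == b) && (h' == h))%:R.
    rewrite /hit; case: (boolP (_ && _)) => [/andP[/eqP-> /eqP->]|n].
      rewrite (bigD1 r)//= ei eqxx big1 ?addr0// => r' rr.
      by case: eqP => // e'; move: rr; have [_ _ ->] := e_inj (etrans e' (esym ei)); rewrite eqxx.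
    rewrite big1// => r' _; case: eqP => // e'.
    by move: n; have [-> -> _] := e_inj (etrans e' (esym ei)); rewrite !eqxx.
  rewrite (bigD1 b)//= big1 ?addr0 => [|b' /negbTE nb]; last by rewrite !hE nb/= addr0.
  by rewrite !hE eqxx/=; case: (h) => /=; rewrite ?addr0 ?add0r.
rewrite big1 ?ler01// => b _.
have h0 h : hit h i b = 0.
  rewrite /hit big1// => r _; case: eqP => // ei; move: no; rewrite negb_exists.
  move=> /forallP/(_ b); rewrite negb_exists => /forallP/(_ h).
  by rewrite negb_exists => /forallP/(_ r); rewrite ei eqxx.
by rewrite !h0 addr0.
Qed.

(** A coordinate lies in at most one segment, by [hit_le1], and its row is supported by the [T]
    coordinates of the partner segment. *)
Lemma pert_row s w i : 0 <= s -> \sum_j `|pert s w i j| <= s * T%:R.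
Proof.
move=> s0.
have h j : `|pert s w i j| <= s * \sum_b (hit false i b * hit true j b + hit true i b * hit false j b).
  rewrite /pert !mxE normrM ger0_norm// ler_wpM2l//.
  rewrite -big_split/=; apply: (le_trans (ler_norm_sum _ _ _)); apply: ler_sum => b _.
  apply: (le_trans (ler_normD _ _)); rewrite !normrM [_^T b j]mxE [_^T b j]mxE.
  by rewrite lerD// ler_pM// sign_mx_le.
apply: (le_trans (ler_sum _ (fun j _ => h j))).
rewrite -mulr_sumr ler_wpM2l// exchange_big /=.
rewrite (eq_bigr (fun b => (hit false i b + hit true i b) * T%:R)) => [|b _]; last first.
  by rewrite big_split /= -!mulr_sumr !sum_hit mulrDl.
rewrite -mulr_suml -[leRHS]mul1r ler_wpM2r//; exact: hit_le1.
Qed.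

Lemma pert_diag s w i : pert s w i i = 0.
Proof.
rewrite /pert !mxE; rewrite (_ : _ + _ = 0) ?mulr0//.
rewrite -big_split big1// => b _ /=; rewrite ![_^T b i]mxE.
suff z : sign_mx false w i b * sign_mx true w i b = 0.
  by rewrite [X in _ + X]mulrC z addr0.
rewrite !mxE mulr_suml big1// => r _; rewrite mulr_sumr big1// => r' _.
have [<-|_] := eqVneq (e b false r) i; last by rewrite !mul0r.
by case: eqP => [/e_inj[]//|_]; rewrite !mul0r mulr0.
Qed.

Lemma pert_band s w i j (d : R) :
  (forall b h r h' r', `|(e b h r)%:R - (e b h' r')%:R| <= d) ->
  pert s w i j != 0 -> `|i%:R - j%:R| <= d.
Proof.
move=> ed; apply: contraNT => nd; rewrite -ltNge in nd.
have z h h' b : sign_mx h w i b * sign_mx h' w j b = 0.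
  rewrite !mxE mulr_suml big1// => r _; rewrite mulr_sumr big1// => r' _.
  have [ei|_] := eqVneq (e b h r) i; last by rewrite !mul0r.
  have [ej|_] := eqVneq (e b h' r') j; last by rewrite !mul0r mulr0.
  by move: nd; rewrite -ei -ej ltNge ed.
rewrite /pert !mxE !big1 ?addr0 ?mulr0// => b _; by rewrite [_^T b j]mxE z.
Qed.

(** By symmetry this is the trace of the square, given by [pert_mul] with [w' = w], where every
    overlap equals [T]. *)
Lemma frob2_pert s w : frob2 (pert s w) = 2 * s ^+ 2 * T%:R ^+ 2 * B%:R.
Proof.
have -> : frob2 (pert s w) = \tr (pert s w *m pert s w).
  apply: eq_bigr => i _; rewrite mxE; apply: eq_bigr => j _.
  by rewrite expr2; congr (_ * _); rewrite -[in LHS]pert_sym mxE.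
have overlapE h b : overlap h w w b = T%:R.
  rewrite /overlap (eq_bigr (fun=> 1)) ?sumr_const ?card_ord// => r _.
  by rewrite -expr2 -real_normK ?num_real// sgn_norm expr1n.
have D h : diag_mx (\row_b overlap h w w b) = T%:R%:M :> 'M[R]_B.
  apply/matrixP => b b'; rewrite !mxE; case: eqP => // _; by rewrite overlapE.
have trh h : \tr (sign_mx h w *m diag_mx (\row_b overlap (~~ h) w w b) *m (sign_mx h w)^T)
    = T%:R ^+ 2 * B%:R.
  rewrite D mul_mx_scalar -scalemxAl mxtraceZ mxtrace_mulC sign_mx_gram D mxtrace_scalar.
  by rewrite -(mulr_natr T%:R B) expr2 mulrA.
rewrite pert_mul mxtraceZ mxtraceD (trh false) (trh true); ring.
Qed.

End prior.

(** * The chi-square integral of the mixture and the alternatives it charges *)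

Section prior_risk.
Context (R : realType) (p B T : nat).
Context (e : 'I_B -> bool -> 'I_T -> 'I_p).
Hypothesis e_inj : forall b h r b' h' r', e b h r = e b' h' r' -> [/\ b = b', h = h' & r = r'].
Local Notation signs := {ffun 'I_T -> bool}.
Local Notation prior := {ffun 'I_B -> signs * signs}.
Implicit Types w : prior.

(** Coordinatewise multiplication by the fixed signs [x], an exclusive or on booleans, permutes the
    sign vectors. *)
Lemma sum_sign_shift (x : signs) (f : R -> R) :
  \sum_(y : signs) f (\sum_r sgn R (x r) * sgn R (y r)) = \sum_(y : signs) f (sign_sum R y).
Proof.
pose c (y : signs) : signs := [ffun r => x r (+) y r].
have cK : involutive c by move=> y; apply/ffunP => r; rewrite !ffunE addbA addbb.
rewrite (reindex_inj (inv_inj cK)) /=; apply: eq_bigr => y _; congr f.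
by apply: eq_bigr => r _; rewrite ffunE /sgn signr_addb mulrA -expr2 sqrr_sign mul1r.
Qed.

(** By [sum_sign_shift] the sum over [w'] is the same for every [w], and it factors over the [B]
    pairs. The two averages on the right run over the two halves of one pair of [w'], not over [w]
    and [w']. *)
Lemma prior_mean n (s2 : R) :
  #|prior|%:R^-1 ^+ 2 * (\sum_(w : prior) \sum_(w' : prior)
    (\prod_b (1 - s2 * (overlap R false w w' b * overlap R true w w' b))^-1) ^+ n) =
  (savg (fun x : signs => savg (fun y : signs =>
    ((1 - s2 * (sign_sum R x * sign_sum R y))^-1) ^+ n))) ^+ B.
Proof.
set K := savg _; pose N : R := 2 ^+ T.
have N0 : N != 0 by rewrite expf_neq0.
have cardE : #|prior|%:R = (N * N) ^+ B :> R.
  by rewrite card_ffun card_prod !card_ffun !card_ord card_bool natrX natrM natrX.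
have sumw w : \sum_(w' : prior) (\prod_b (1 - s2 * (overlap R false w w' b * overlap R true w w' b))^-1) ^+ n
    = (N * N * K) ^+ B.
  pose F b (a : signs * signs) := ((1 - s2 * ((\sum_r sgn R (half w b false r) * sgn R (a.1 r)) *
     (\sum_r sgn R (half w b true r) * sgn R (a.2 r))))^-1) ^+ n.
  transitivity (\sum_(w' : prior) \prod_b F b (w' b)).
    by apply: eq_bigr => w' _; rewrite -prodrXl.
  rewrite -bigA_distr_bigA /=; transitivity (\prod_(b < B) (N * N * K)); last first.
    by rewrite prodr_const card_ord.
  apply: eq_bigr => b _; rewrite -(pair_big xpredT xpredT (fun x y => F b (x, y))) /=.
  transitivity (\sum_(x : signs) \sum_(y : signs) ((1 - s2 * (sign_sum R x * sign_sum R y))^-1) ^+ n).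
    rewrite /F /= (sum_sign_shift _ (fun g => \sum_(y : signs) ((1 - s2 * (g *
      (\sum_r sgn R (half w b true r) * sgn R (y r))))^-1) ^+ n)).
    apply: eq_bigr => x _.
    by rewrite (sum_sign_shift _ (fun g => ((1 - s2 * (sign_sum R x * g))^-1) ^+ n)).
  by rewrite /K /savg -/N -mulr_sumr; move: (\sum_x _) => q; field.
rewrite (eq_bigr (fun=> (N * N * K) ^+ B)) => [|w _]; last exact: sumw.
have -> : \sum_(w : prior) (N * N * K) ^+ B = (N * N) ^+ B * K ^+ B * (N * N) ^+ B.
  transitivity ((N * N * K) ^+ B *+ #|{: prior}|); first by rewrite sumr_const.
  rewrite -[LHS]mulr_natr cardE; congr (_ * _); exact: exprMn.
rewrite cardE.
have : (N * N) ^+ B != 0 by rewrite expf_neq0// mulf_neq0.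
move: ((N * N) ^+ B) => q q0; rewrite expr2; field; exact: q0.
Qed.

Section alternative.
Context (n : nat) (alpha L lambda psi s d : R).
Hypotheses (n0 : (0 < n)%N) (p0 : (0 < p)%N) (s0 : 0 <= s) (alpha0 : 0 <= alpha) (lambda0 : 0 < lambda).
Hypothesis sT : s * T%:R <= 1 / 2.
Hypothesis sTl : s * T%:R <= 1 - lambda.
Hypothesis nsT : n%:R * s ^+ 2 * T%:R <= 1 / 32.
Hypothesis BT : 2 * T%:R * B%:R <= p%:R :> R.
Hypothesis eband : forall b h r h' r', `|(e b h r)%:R - (e b h' r')%:R| <= d.
Hypothesis smooth : s ^+ 2 * T%:R * d `^ (2 * alpha) <= L.
Hypothesis psiE : 4 * p%:R * psi ^+ 2 <= s ^+ 2 * T%:R ^+ 2 * B%:R.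

Definition cov w : 'M[R]_p := 1%:M + pert e s w.

Let rho := s * T%:R.
Let rho0 : 0 <= rho. Proof. by rewrite mulr_ge0. Qed.
Let pert_rho w i : \sum_j `|pert e s w i j| <= rho. Proof. exact: pert_row. Qed.

Lemma cov_sym w : (cov w)^T = cov w.
Proof. by rewrite /cov linearD/= trmx1 pert_sym. Qed.

Lemma cov_lower w v : (1 - rho) * nrm2 v <= form (cov w) v v.
Proof.
rewrite formD form1 mulrBl mul1r lerD2l.
have := schur_form (pert_sym e s w) (pert_rho w) v.
by rewrite ler_norml => /andP[].
Qed.

Lemma cov_upper w v : form (cov w) v v <= (1 + rho) * nrm2 v.
Proof.
rewrite formD form1 mulrDl mul1r lerD2l.
have := schur_form (pert_sym e s w) (pert_rho w) v.
by rewrite ler_norml => /andP[].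
Qed.

Let rho1 : 0 < 1 - rho. Proof. by move: sT; rewrite -/rho; lra. Qed.

Lemma cov_psd w : psdmx (cov w).
Proof. by have [] := coercive_psd (cov_sym w) rho1 (cov_lower w). Qed.

Lemma cov_unit w : cov w \in unitmx.
Proof. by have [] := coercive_psd (cov_sym w) rho1 (cov_lower w). Qed.

(** The positivity required by [lik_prod]: each inverse is at least 1 / (1 + rho) as a form, so [Q]
    is at least 2 / (1 + rho) - 1, which is positive as rho <= 1/2. *)
Lemma cov_inv_sum w w' : let Q := invmx (cov w) + invmx (cov w') - 1%:M in
  psdmx Q /\ Q \in unitmx.
Proof.
have r1 : 0 < 1 + rho by rewrite ltr_wpDr.
apply: (@coercive_psd _ _ _ (2 / (1 + rho) - 1)).
- by rewrite linearB/= linearD/= !trmx_inv trmx1 !cov_sym.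
- by rewrite subr_gt0 ltr_pdivlMr//; move: sT; rewrite -/rho; lra.
- move=> v; rewrite formB formD form1 mulrBl mul1r lerD2r.
  have := coercive_inv (cov_psd w) (cov_unit w) r1 (cov_upper w) v.
  have := coercive_inv (cov_psd w') (cov_unit w') r1 (cov_upper w') v.
  by rewrite (_ : 2 / (1 + rho) = (1 + rho)^-1 + (1 + rho)^-1); [rewrite mulrDl; lra|field; rewrite gt_eqF].
Qed.

Lemma s2_le1 (x y : R) : `|x| <= T%:R -> `|y| <= T%:R -> s ^+ 2 * (x * y) <= 1.
Proof.
move=> xT yT; apply: (le_trans (ler_norm _)); rewrite normrM normrX (ger0_norm s0).
apply: (@le_trans _ _ (s ^+ 2 * (T%:R * T%:R))).
  by rewrite ler_wpM2l ?exprn_ge0// normrM ler_pM.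
rewrite -expr2 -exprMn -/rho; apply: (@le_trans _ _ (1 ^+ 2)); last by rewrite expr1n.
by rewrite ler_sqr ?nnegrE//; move: sT; rewrite -/rho; lra.
Qed.

Lemma overlap_le h w w' b : `|overlap R h w w' b| <= T%:R.
Proof.
apply: (le_trans (ler_norm_sum _ _ _)).
rewrite (eq_bigr (fun=> 1)) ?sumr_const ?card_ord// => i _.
by rewrite normrM !sgn_norm mulr1.
Qed.

Lemma cov_lik w w' : (\int[mvnormal 1%:M]_x (lik (cov w) x * lik (cov w') x)%:E =
  (\prod_b (1 - s ^+ 2 * (overlap R false w w' b * overlap R true w w' b))^-1)%:E)%E.
Proof.
have [psdQ uQ] := cov_inv_sum w w'.
rewrite lik_prod ?cov_unit//; [|exact: cov_psd|exact: cov_psd].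
have covB u : cov u - 1%:M = pert e s u by rewrite /cov addrC addKr.
rewrite !covB det_pert// sqrtr_sqr ger0_norm ?prodfV// prodr_ge0// => b _.
by rewrite subr_ge0 s2_le1// overlap_le.
Qed.

Lemma cov_alternative w : alternative alpha L lambda psi (cov w).
Proof.
have p0' : 0 < p%:R :> R by rewrite ltr0n.
split; [split; [split|]|].
- exact: cov_psd.
- by move=> i; rewrite mxE pert_diag// addr0 mxE eqxx.
- rewrite ler_pdivrMl//.
  (* Nonzero entries lie at distance at most [d], and the squared Frobenius norm 2 s^2 T^2 B is at
     most p s^2 T since 2 T B <= p. *)
  apply: (@le_trans _ _ (\sum_i \sum_j pert e s w i j ^+ 2 * d `^ (2 * alpha))).
    apply: ler_sum => i _; rewrite big_mkcond; apply: ler_sum => j _.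
    case: ifPn => [ij|_]; last by rewrite mulr_ge0 ?sqr_ge0 ?powR_ge0.
    have -> : cov w i j = pert e s w i j.
      by rewrite mxE [1%:M _ _]mxE (_ : i == j = false) ?add0r//; apply/eqP => ij'; rewrite ij' ltnn in ij.
    have [->|ne0] := eqVneq (pert e s w i j) 0; first by rewrite expr0n !mul0r.
    have ijd := pert_band eband ne0.
    rewrite ler_wpM2l ?sqr_ge0// ge0_ler_powR ?nnegrE ?mulr_ge0//.
    exact: (le_trans _ ijd).
  under eq_bigr do rewrite -mulr_suml.
  rewrite -mulr_suml -/(frob2 _) frob2_pert//.
  have -> : 2 * s ^+ 2 * T%:R ^+ 2 * B%:R * d `^ (2 * alpha) =
    (2 * T%:R * B%:R) * (s ^+ 2 * T%:R * d `^ (2 * alpha)) by ring.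
  by rewrite ler_pM// ?mulr_ge0 ?sqr_ge0 ?powR_ge0.
- move=> a /(coercive_eigenvalue (cov_lower w)); move: sTl; rewrite -/rho; lra.
- rewrite frobenius_sqr mulrC ler_pdivlMr ?mulr_gt0//.
  set M := invmx _ - _.
  (* (S^-1 - I) S = -pert, and right multiplication by [S] at most quadruples squared norms as rho
     <= 1. With |pert|^2 = 2 s^2 T^2 B this accounts for the factor 4 in [psiE]. *)
  have fM : frob2 (M *m cov w) = 2 * s ^+ 2 * T%:R ^+ 2 * B%:R.
    rewrite -(frob2_pert e_inj s w) /M mulmxBl mulVmx ?cov_unit// mul1mx /cov opprD addrA subrr add0r.
    by do 2 (apply: eq_bigr => ? _); rewrite [in LHS]mxE sqrrN.
  have : frob2 (M *m cov w) <= 4 * frob2 M.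
    rewrite !frob2_rows mulr_sumr; apply: ler_sum => i _; rewrite row_mul.
    set v := row i M; rewrite /cov mulmxDr mulmx1.
    have h : nrm2 (v + v *m pert e s w) <= 2 * nrm2 v + 2 * nrm2 (v *m pert e s w).
      rewrite /nrm2 !mulr_sumr -big_split; apply: ler_sum => j _ /=; rewrite mxE.
      by have := sqr_ge0 (v 0 j - (v *m pert e s w) 0 j); rewrite sqrrB sqrrD; lra.
    apply: (le_trans h).
    have := schur_mulmx (pert_sym e s w) (pert_rho w) v.
    have r2 : rho ^+ 2 * nrm2 v <= 1 * nrm2 v.
      rewrite ler_wpM2r ?nrm2_ge0// -(expr1n R 2) ler_sqr ?nnegrE//.
      by move: sT; rewrite -/rho; lra.
    lra.
  by rewrite fM; move: psiE; lra.
Qed.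

Lemma prior_risk_ge (eta : R) (D : n.-tuple (p.-tuple R) -> R) : 0 < eta -> is_test D ->
  1 - eta / 2 - (expR (16 * (n%:R * s ^+ 2 * T%:R) ^+ 2 * B%:R) - 1) / (2 * eta) <=
  risk D (alternative alpha L lambda psi).
Proof.
move=> eta0 tD.
have c0 : (0 < #|{: prior}|)%N.
  by apply/card_gt0P; exists [ffun=> ([ffun=> true], [ffun=> true])].
apply: (le_trans _ (risk_ge tD eta0 c0 cov_alternative cov_psd cov_unit cov_lik)).
rewrite lerD2l lerN2 ler_pM2r ?invr_gt0 ?mulr_gt0// lerD2r prior_mean.
rewrite [_ * B%:R]mulrC expRM_natl lerXn2r ?nnegrE ?expR_ge0//.
  rewrite /savg mulr_ge0 ?invr_ge0 ?exprn_ge0// sumr_ge0// => x _.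
  rewrite mulr_ge0 ?invr_ge0 ?exprn_ge0// sumr_ge0// => y _.
  rewrite exprn_ge0// invr_ge0 subr_ge0; apply: s2_le1; exact: sign_sum_norm.
apply: savg_block => //; first exact: sqr_ge0.
rewrite -exprMn; move: sT (mulr_ge0 s0 (ler0n R T)); move: (s * T%:R) => q; nra.
Qed.

End alternative.
End prior_risk.

(** * Gaussian moments *)

Section normal_moments.
Context (R : realType).
Local Notation RR := (measurableTypeR R).
Local Notation N01 := (@normal_prob R 0 1).

Lemma has_mean_dominated d (T : measurableType d) (P : probability T R) (f g : T -> R) b :
  measurable_fun setT f -> (forall x, `|f x| <= g x) -> has_mean P g b ->
  exists a, has_mean P f a.
Proof.
move=> mf fg [gi _].
have fi : P.-integrable setT (EFin \o f).
  apply: (@le_integrable _ _ _ P _ measurableT _ (EFin \o g)) => //.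
  - exact/measurable_EFinP.
  - by move=> x _; rewrite /= lee_fin (le_trans (fg x))// ler_norm.
exists (fine (\int[P]_x (f x)%:E)); split => //; rewrite fineK//.
exact: integrable_fin_num.
Qed.

Lemma has_mean_unique d (T : measurableType d) (P : probability T R) (f : T -> R) a b :
  has_mean P f a -> has_mean P f b -> a = b.
Proof. by move=> [_ ea] [_ eb]; apply: EFin_inj; rewrite -ea -eb. Qed.

(** The law of [a z] has mass one: [normal_affine] for the constant function 1. *)
Lemma normal_exp_sqr (a : R) : 0 < a ->
  has_mean N01 (fun x => expR ((1 - a^-1 ^+ 2) * x ^+ 2 / 2)) a.
Proof.
move=> a0; apply: has_mean_ge0.
- apply: measurableT_comp => //; apply: measurable_funM => //; exact: measurable_funM.
- by move=> x; exact: expR_ge0.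
- have := @normal_affine R a 0 (cst 1%E) (lt0r_neq0 a0) (measurable_cst _) (fun=> lee01).
  rewrite [X in X = _ -> _](_ : _ = 1%E); last first.
    by rewrite integral_cst// mul1e; exact: probability_setT.
  rewrite gtr0_norm// => h.
  have mE : measurable_fun setT (fun x : RR => (expR ((1 - a^-1 ^+ 2) * x ^+ 2 / 2))%:E).
    apply/measurable_EFinP; apply: measurableT_comp => //; apply: measurable_funM => //.
    exact: measurable_funM.
  have {}h : (1 = a^-1%:E * \int[N01]_x (expR ((1 - a^-1 ^+ 2) * x ^+ 2 / 2))%:E)%E.
    rewrite -(ge0_integralZl _ measurableT mE)//; last by rewrite lee_fin invr_ge0 ltW.
    rewrite h; apply: eq_integral => x _; rewrite mul1e -EFinM subr0; congr (_ * expR _)%:E.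
    by field; rewrite gt_eqF.
  have cancel (I : \bar R) : (1 = a^-1%:E * I -> I = a%:E)%E.
    by move=> hI; rewrite -[I]mul1e -(divff (lt0r_neq0 a0)) EFinM -muleA -hI mule1.
  exact: cancel h.
Qed.

Lemma expR_ge2 (y : R) : 0 <= y -> 1 + y + y ^+ 2 / 2 <= expR y.
Proof.
move=> y0; have nd : {homo series (exp_coeff y) : m n / (m <= n)%N >-> m <= n}.
  by apply: nondecreasing_series => i _ _; rewrite /exp_coeff /= divr_ge0 ?exprn_ge0.
have := nondecreasing_cvgn_le nd (is_cvg_series_exp_coeff y) 3%N.
rewrite /expR /series /= !big_nat_recr//= big_geq// /exp_coeff /= !factS fact0 !muln1.
by apply: le_trans; rewrite le_eqVlt; apply/orP; left; apply/eqP; rewrite expr0 expr1; field.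
Qed.

(** Inversion of [expR_ge2], because (1 - y + y^2/2)(1 + y + y^2/2) = 1 + y^4/4. *)
Lemma expRN_le2 (y : R) : 0 <= y -> expR (- y) <= 1 - y + y ^+ 2 / 2.
Proof.
move=> y0; have h := expR_ge2 y0; have p0 : 0 < 1 + y + y ^+ 2 / 2 by nra.
rewrite expRN; apply: (@le_trans _ _ (1 + y + y ^+ 2 / 2)^-1).
  by rewrite lef_pV2 ?posrE ?expR_gt0.
rewrite -[leLHS]mul1r ler_pdivrMr//.
have -> : (1 - y + y ^+ 2 / 2) * (1 + y + y ^+ 2 / 2) = 1 + (y ^+ 2 / 2) ^+ 2 by field.
by rewrite lerDl sqr_ge0.
Qed.

(** Beyond order 4 the default 0 of [nth] is returned and carries no meaning. *)
Definition normal_moment (k : nat) : R := nth 0 [:: 1; 0; 1; 0; 3] k.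

(* The moments are identified by letting a tend to 1 in normal_exp_sqr, the
   exponential being compared with its Taylor polynomial. *)
Lemma normal_moments : forall k, (k <= 4)%N -> has_mean N01 (fun x => x ^+ k) (normal_moment k).
Proof.
have mX k : measurable_fun setT (fun x : RR => x ^+ k) by exact: measurable_funX.
have i2 : 0 < 2 :> R by [].
(* At a = 2 the coefficient 1 - a^-2 is positive, so the integrable exponential dominates x^4 and
   all moments up to order 4 exist. *)
have e2 x : 1 + 3/4 * x ^+ 2 / 2 + (3/4) ^+ 2 * x ^+ 4 / 8 <= expR ((1 - 2^-1 ^+ 2) * x ^+ 2 / 2) :> R.
  have -> : 1 - 2^-1 ^+ 2 = 3/4 :> R by field.
  have y0 : 0 <= 3/4 * x ^+ 2 / 2 by have := sqr_ge0 x; lra.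
  by have := expR_ge2 y0; apply: le_trans; rewrite le_eqVlt; apply/orP; left; apply/eqP; field.
have [m4 h4] : exists m4, has_mean N01 (fun x => x ^+ 4) m4.
  apply: (has_mean_dominated (mX 4%N) _ (has_meanZ 16 (normal_exp_sqr i2))) => x.
  have := e2 x; have := sqr_ge0 x; have : 0 <= x ^+ 4 by rewrite exprn_even_ge0.
  move=> x4; rewrite ger0_norm//; lra.
have p4 x : x ^+ 4 = (x ^+ 2) ^+ 2 :> R by rewrite -exprM.
have dom k : (k <= 4)%N -> exists m, has_mean N01 (fun x => x ^+ k) m.
  move=> k4; apply: (has_mean_dominated (mX k) _ (has_meanD (has_mean_cst N01 1) h4)) => x.
  have [x1|x1] := leP `|x| 1.
    rewrite normrX; apply: (@le_trans _ _ 1); first by rewrite exprn_ile1.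
    by rewrite lerDl p4 sqr_ge0.
  have : `|x ^+ k| <= `|x| ^+ 4 by rewrite normrX ler_weXn2l// ltW.
  by move/le_trans; apply; rewrite -normrX ger0_norm ?lerDr// p4 sqr_ge0.
have [m1 h1] := dom 1%N isT; have [m2 h2] := dom 2%N isT; have [m3 h3] := dom 3%N isT.
have up a : 1 < a -> 1 + (1 - a^-1 ^+ 2) * m2 / 2 + (1 - a^-1 ^+ 2) ^+ 2 * m4 / 8 <= a.
  move=> a1; have a0 : 0 < a by lra.
  have t0 : 0 <= 1 - a^-1 ^+ 2.
    by rewrite subr_ge0 exprn_ile1// ?invr_ge0 ?invf_le1// ltW.
  set t := 1 - _ in t0 *.
  have := has_meanD (has_meanD (has_mean_cst N01 1) (has_meanZ (t / 2) h2)) (has_meanZ (t ^+ 2 / 8) h4).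
  move=> /has_mean_le /(_ (normal_exp_sqr a0)) h.
  apply: (le_trans _ (h _)); first by rewrite le_eqVlt; apply/orP; left; apply/eqP; field.
  move=> x; have y0 : 0 <= t * x ^+ 2 / 2 by rewrite divr_ge0// mulr_ge0// sqr_ge0.
  have := expR_ge2 y0.
  by apply: le_trans; rewrite le_eqVlt; apply/orP; left; apply/eqP; field.
have lo a : 0 < a < 1 -> a <= 1 - (a^-1 ^+ 2 - 1) * m2 / 2 + (a^-1 ^+ 2 - 1) ^+ 2 * m4 / 8.
  move=> /andP[a0 a1].
  have t0 : 0 <= a^-1 ^+ 2 - 1.
    by rewrite subr_ge0 exprn_ege1// invf_ge1 ?ltW.
  set t := _ - 1 in t0 *.
  have := has_meanD (has_meanD (has_mean_cst N01 1) (has_meanZ (- (t / 2)) h2)) (has_meanZ (t ^+ 2 / 8) h4).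
  move=> /(has_mean_le (normal_exp_sqr a0)) h.
  apply: (le_trans (h _)); last by rewrite le_eqVlt; apply/orP; left; apply/eqP; field.
  move=> x; have y0 : 0 <= t * x ^+ 2 / 2 by rewrite divr_ge0// mulr_ge0// sqr_ge0.
  have := expRN_le2 y0.
  have -> : expR (- (t * x ^+ 2 / 2)) = expR ((1 - a^-1 ^+ 2) * x ^+ 2 / 2).
    by congr expR; rewrite /t; field; rewrite gt_eqF.
  by move/le_trans; apply; rewrite le_eqVlt; apply/orP; left; apply/eqP; field.
have lin a : 0 < a -> 1 + (1 - a^-1 ^+ 2) * m2 / 2 <= a.
  move=> a0; set t := 1 - _.
  have := has_meanD (has_mean_cst N01 1) (has_meanZ (t / 2) h2).
  move=> /has_mean_le /(_ (normal_exp_sqr a0)) h.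
  apply: (le_trans _ (h _)); first by rewrite le_eqVlt; apply/orP; left; apply/eqP; field.
  move=> x; have := expR_ge1Dx (t * x ^+ 2 / 2).
  by apply: le_trans; rewrite le_eqVlt; apply/orP; left; apply/eqP; field.
(* Clearing denominators exhibits the factor [a - 1]; dividing by it on either side of 1 and letting
   [a] tend to 1 gives both inequalities between [m2] and 1. *)
have lin' a : 0 < a -> (a - 1) * ((a + 1) * m2 - 2 * a ^+ 2) <= 0.
  move=> a0; have := lin a a0; rewrite -subr_le0.
  have -> : 1 + (1 - a^-1 ^+ 2) * m2 / 2 - a = (2 * a ^+ 2)^-1 * ((a - 1) * ((a + 1) * m2 - 2 * a ^+ 2)).
    by field; rewrite gt_eqF.
  by rewrite pmulr_rle0// invr_gt0 mulr_gt0// exprn_gt0.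
have m2E : m2 = 1.
  apply/eqP; rewrite eq_le; apply/andP; split; apply/ler_addgt0Pr => eps eps0;
    pose c := Num.min (eps / 2) (1/2);
    have c0 : 0 < c by rewrite lt_min !divr_gt0.
    have ce : c <= eps / 2 by rewrite ge_min lexx.
    have := lin' (1 + c); rewrite addr_gt0// => /(_ isT).
    have -> : 1 + c - 1 = c by ring.
    rewrite pmulr_rle0// => h.
    have : (2 + c) * (m2 - (1 + 2 * c)) <= 0 by nra.
    by rewrite pmulr_rle0; lra.
  have c1 : c <= 1/2 by rewrite ge_min lexx orbT.
  have ce : c <= eps / 2 by rewrite ge_min lexx.
  have c1' : 0 < 1 - c by lra.
  have := lin' (1 - c) c1'.
  have -> : 1 - c - 1 = - c by ring.
  rewrite mulNr oppr_le0 pmulr_rge0// => h.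
  have : 0 <= (2 - c) * (m2 - (1 - 2 * c)) by nra.
  by rewrite pmulr_rge0; lra.
(* With [m2 = 1] the first-order terms cancel and [(a - 1)^2] factors out; at [a = 1] the remaining
   bracket is [4 m4 - 12]. *)
have br a : a != 0 -> 1 + (1 - a^-1 ^+ 2) * m2 / 2 + (1 - a^-1 ^+ 2) ^+ 2 * m4 / 8 - a =
    (a - 1) ^+ 2 / (8 * a ^+ 4) * ((a + 1) ^+ 2 * m4 - 4 * a ^+ 2 * (2 * a + 1)).
  by move=> a0; rewrite m2E; field.
have m4E : m4 = 3.
  apply/eqP; rewrite eq_le; apply/andP; split; apply/ler_addgt0Pr => eps eps0;
    pose c := Num.min (eps / 10) (1/2);
    have c0 : 0 < c by rewrite lt_min !divr_gt0.
    have ce : c <= eps / 10 by rewrite ge_min lexx.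
    have a0 : 0 < 1 + c by rewrite addr_gt0.
    have := up (1 + c); rewrite ltrDl => /(_ c0); rewrite -subr_le0 br ?gt_eqF//.
    rewrite pmulr_rle0; last first.
      by rewrite divr_gt0 ?mulr_gt0 ?exprn_gt0// addrAC subrr add0r.
    move=> h; have : (2 + c) ^+ 2 * (m4 - (3 + 10 * c)) <= 0.
      apply: (le_trans _ h).
      rewrite -subr_ge0 (_ : _ - _ = c * (20 + 15 * c + 2 * c ^+ 2)); last by ring.
      by rewrite mulr_ge0 ?addr_ge0 ?mulr_ge0 ?sqr_ge0 ?ltW.
    by rewrite pmulr_rle0 ?exprn_gt0; lra.
  have c1 : c <= 1/2 by rewrite ge_min lexx orbT.
  have ce : c <= eps / 10 by rewrite ge_min lexx.
  have a0 : 0 < 1 - c by lra.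
  have := lo (1 - c); rewrite a0 ltrBlDr ltrDl c0 => /(_ isT).
  have -> : 1 - ((1 - c)^-1 ^+ 2 - 1) * m2 / 2 + ((1 - c)^-1 ^+ 2 - 1) ^+ 2 * m4 / 8 =
     1 + (1 - (1 - c)^-1 ^+ 2) * m2 / 2 + (1 - (1 - c)^-1 ^+ 2) ^+ 2 * m4 / 8.
    by move: (_^-1) => y; ring.
  rewrite -subr_ge0 br ?gt_eqF// pmulr_rge0; last first.
    rewrite (_ : (1 - c - 1) ^+ 2 = c ^+ 2); last by ring.
    by rewrite divr_gt0 ?mulr_gt0 ?exprn_gt0.
  move=> h; have : 0 <= (2 - c) ^+ 2 * (m4 - (3 - 10 * c)).
    apply: (le_trans h).
    rewrite -subr_ge0 (_ : _ - _ = c * (20 - 15 * c + 2 * c ^+ 2)); last by ring.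
    by rewrite mulr_ge0 ?ltW//; nra.
  by rewrite pmulr_rge0 ?exprn_gt0; lra.
(* [normal_affine] concerns nonnegative functions, so the symmetry is applied to (x + 1)^2 and (x +
   1)^4, from which the odd moments are read off. *)
have flip (f : RR -> R) a : measurable_fun setT f -> (forall x, 0 <= f x) -> has_mean N01 f a ->
    has_mean N01 (fun x => f (- x)) a.
  move=> mf f0 [_ fe]; apply: has_mean_ge0 => //.
    rewrite (_ : (fun x => f (- x)) = f \o (fun x : RR => -1 * x + 0)).
      by apply: (measurableT_comp mf); exact: measurable_affine.
    by apply/funext => x /=; rewrite mulN1r addr0.
  have mf' : measurable_fun setT (fun x : RR => (f x)%:E) by exact/measurable_EFinP.
  have n0 : (-1 : R) != 0 by rewrite oppr_eq0 oner_eq0.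
  have f0' (x : RR) : (0 <= (f x)%:E)%E by rewrite lee_fin.
  have e := normal_affine 0 n0 mf' f0'.
  transitivity (\int[N01]_x (f (-1 * x + 0))%:E)%E.
    by apply: eq_integral => x _; rewrite mulN1r addr0.
  apply: (etrans e); rewrite -fe; apply: eq_integral => x _.
  by rewrite normrN1 invr1 mul1r subr0 invrN invr1 mulrN1 sqrrN subrr mul0r expR0 mule1.
have m1E : m1 = 0.
  have h : has_mean N01 (fun x => (x + 1) ^+ 2) (m2 + (2 * m1 + 1)).
    have := has_meanD h2 (has_meanD (has_meanZ 2 h1) (has_mean_cst N01 1)).
    by congr has_mean; apply/funext => x; rewrite expr1; ring.
  have h' : has_mean N01 (fun x => (- x + 1) ^+ 2) (m2 + (- 2 * m1 + 1)).
    have := has_meanD h2 (has_meanD (has_meanZ (-2) h1) (has_mean_cst N01 1)).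
    by congr has_mean; apply/funext => x; rewrite expr1; ring.
  have mf : measurable_fun setT (fun x : RR => (x + 1) ^+ 2).
    by apply: measurable_funX; exact: measurable_funD.
  have := has_mean_unique (flip _ _ mf (fun x => sqr_ge0 _) h) h'; lra.
have m3E : m3 = 0.
  have h : has_mean N01 (fun x => (x + 1) ^+ 4) (m4 + (4 * m3 + (6 * m2 + (4 * m1 + 1)))).
    have := has_meanD h4 (has_meanD (has_meanZ 4 h3) (has_meanD (has_meanZ 6 h2)
      (has_meanD (has_meanZ 4 h1) (has_mean_cst N01 1)))).
    by congr has_mean; apply/funext => x; rewrite expr1; ring.
  have h' : has_mean N01 (fun x => (- x + 1) ^+ 4) (m4 + (- 4 * m3 + (6 * m2 + (- 4 * m1 + 1)))).
    have := has_meanD h4 (has_meanD (has_meanZ (-4) h3) (has_meanD (has_meanZ 6 h2)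
      (has_meanD (has_meanZ (-4) h1) (has_mean_cst N01 1)))).
    by congr has_mean; apply/funext => x; rewrite expr1; ring.
  have mf : measurable_fun setT (fun x : RR => (x + 1) ^+ 4).
    by apply: measurable_funX; exact: measurable_funD.
  have p x : 0 <= (x + 1) ^+ 4 :> R by rewrite exprn_even_ge0.
  have := has_mean_unique (flip _ _ mf p h) h'; lra.
rewrite m1E in h1; rewrite m2E in h2; rewrite m3E in h3; rewrite m4E in h4.
case=> [_|[_|[_|[_|[_|//]]]]].
- exact: (has_mean_cst N01 1).
- exact: h1.
- exact: h2.
- exact: h3.
- exact: h4.
Qed.

End normal_moments.

Section gaussian_moments.
Context (R : realType).
Local Notation RR := (measurableTypeR R).
Local Notation gauss := (iid_prob (@normal_prob R 0 1)).
Local Notation mom := (normal_moment R).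

Lemma prod_pow_eq p (x : 'I_p -> R) a : \prod_i x i ^+ (i == a) = x a.
Proof.
by rewrite (bigD1 a)//= eqxx expr1 big1 ?mulr1// => i /negbTE ->; rewrite expr0.
Qed.

Lemma has_mean_gauss_prod p (k : 'I_p -> nat) : (forall i, (k i <= 4)%N) ->
  has_mean (gauss p) (fun z => \prod_i tnth z i ^+ k i) (\prod_i mom (k i)).
Proof.
move=> k4; exact: (@has_mean_iid _ _ _ (normal_prob 0 1) p (fun i (t : RR) => t ^+ k i)
  (fun i => mom (k i)) (fun i => normal_moments R (k4 i))).
Qed.

Definition kron p (a b : 'I_p) : R := (a == b)%:R.

Lemma moment2 p (a b : 'I_p) : \prod_i mom ((i == a) + (i == b)) = kron a b.
Proof.
rewrite /kron; have [<-|ab] := eqVneq a b.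
  rewrite big1// => i _; by case: eqP.
by rewrite (bigD1 a)//= eqxx (negbTE ab) /= mul0r.
Qed.

(** Isserlis' formula for independent standard coordinates, by cases on the coincidences; when all
    four indices agree, the three terms add up to the fourth moment 3. *)
Lemma moment4 p (a b c d : 'I_p) :
  \prod_i mom ((i == a) + (i == b) + (i == c) + (i == d)) =
  kron a b * kron c d + kron a c * kron b d + kron a d * kron b c.
Proof.
rewrite /kron.
have [ab|ab] := eqVneq a b; last first.
  have [ac|ac] := eqVneq a c; last first.
    have [ad|ad] := eqVneq a d; last first.
      by rewrite (bigD1 a)//= eqxx (negbTE ab) (negbTE ac) (negbTE ad) /= !mul0r !addr0.
    subst d; have [bc|bc] := eqVneq b c.
      subst c; rewrite big1 ?mul0r ?add0r ?mulr1// => i _.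
      have [->|ia] := eqVneq i a; first by rewrite (negbTE ab).
      by case: eqP.
    rewrite (bigD1 b)//= eqxx [b == a]eq_sym (negbTE ab) (negbTE bc) /=.
    by rewrite !mul0r !mulr0 !addr0.
  subst c; have [bd|bd] := eqVneq b d.
    subst d; rewrite (negbTE ab) big1 ?mul0r ?add0r ?mulr1 ?addr0// => i _.
    have [->|ia] := eqVneq i a; first by rewrite (negbTE ab).
    by case: eqP.
  rewrite (bigD1 b)//= eqxx [b == a]eq_sym (negbTE ab) (negbTE bd) /=.
  by rewrite !mul0r !mulr0 !addr0.
subst b; have [cd|cd] := eqVneq c d.
  subst d; have [ac|ac] := eqVneq a c.
    subst c; rewrite (bigD1 a)//= eqxx big1 ?mulr1 => [|i /negbTE ->//].
    by rewrite /normal_moment /=; ring.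
  rewrite big1 ?mulr0 ?mul0r ?addr0 ?mulr1// => i _.
  have [->|ia] := eqVneq i a; first by rewrite (negbTE ac).
  by case: eqP.
have [ac|ac] := eqVneq a c.
  subst c; rewrite (bigD1 d)//= eqxx [d == a]eq_sym (negbTE cd) /=.
  by rewrite !mul0r !mulr0 !addr0.
rewrite (bigD1 c)//= eqxx [c == a]eq_sym (negbTE ac) (negbTE cd) /=.
by rewrite !mul0r !mulr0 !addr0.
Qed.

Lemma has_mean_gauss2 p (a b : 'I_p) :
  has_mean (gauss p) (fun z => tnth z a * tnth z b) (kron a b).
Proof.
have k4 i : ((i == a) + (i == b) <= 4)%N by do 2 case: eqP.
have := has_mean_gauss_prod k4; rewrite moment2; congr has_mean; apply/funext => z.
under eq_bigr do rewrite exprD.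
by rewrite big_split /= !(prod_pow_eq (tnth z)).
Qed.

Lemma has_mean_gauss4 p (a b c d : 'I_p) :
  has_mean (gauss p) (fun z => tnth z a * tnth z b * (tnth z c * tnth z d))
    (kron a b * kron c d + kron a c * kron b d + kron a d * kron b c).
Proof.
have k4 i : ((i == a) + (i == b) + (i == c) + (i == d) <= 4)%N by do 4 case: eqP.
have := has_mean_gauss_prod k4; rewrite moment4; congr has_mean; apply/funext => z.
under eq_bigr do rewrite !exprD.
by rewrite !big_split /= !(prod_pow_eq (tnth z)) !mulrA.
Qed.

Lemma kron_sum p (a : 'I_p) (f : 'I_p -> R) : \sum_b f b * kron a b = f a.
Proof.
by rewrite (bigD1 a)//= /kron eqxx mulr1 big1 ?addr0// => i; rewrite eq_sym => /negbTE ->; rewrite mulr0.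
Qed.

(** Written with a doubled index, a product of two entries of [S] becomes a fourfold sum of the same
    shape as the one produced by linearity in [has_mean_mv4]. *)
Lemma kron_pair p (u v : 'I_p -> R) : \sum_a u a * v a = \sum_a \sum_b u a * v b * kron a b.
Proof.
by apply: eq_bigr => a _; under eq_bigr do rewrite -mulrA; rewrite -mulr_sumr kron_sum.
Qed.

Section mv.
Context (p : nat) (S : 'M[R]_p).
Hypothesis psdS : psdmx S.

Let A := chol S.
Let AA i j : \sum_a A i a * A j a = S i j.
Proof.
have [_ AS] := cholP psdS; rewrite -[in RHS]AS mxE.
by apply: eq_bigr => a _; rewrite [in RHS]mxE.
Qed.

Lemma has_mean_mv2 i j : has_mean (mvnormal S) (fun x => tnth x i * tnth x j) (S i j).
Proof.
apply: has_mean_pushforward.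
  by apply: measurable_funM; exact: measurable_tnth.
have := @has_mean_sum _ _ _ (gauss p) _ (index_enum 'I_p) xpredT _ _ (fun a _ =>
  @has_mean_sum _ _ _ (gauss p) _ (index_enum 'I_p) xpredT _ _ (fun b _ =>
    has_meanZ (A i a * A j b) (has_mean_gauss2 a b))).
rewrite (_ : \sum_a _ = S i j).
  congr has_mean; apply/funext => z /=; rewrite !tnth_mktuple mulr_suml.
  apply: eq_bigr => a _; rewrite mulr_sumr; apply: eq_bigr => b _.
  by rewrite mulrACA.
rewrite -AA; apply: eq_bigr => a _.
under eq_bigr do rewrite -mulrA.
rewrite -mulr_sumr; congr (_ * _); exact: kron_sum.
Qed.

Lemma has_mean_mv4 i j k l :
  has_mean (mvnormal S) (fun x => tnth x i * tnth x j * (tnth x k * tnth x l))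
    (S i j * S k l + S i k * S j l + S i l * S j k).
Proof.
apply: has_mean_pushforward.
  by apply: measurable_funM; apply: measurable_funM; exact: measurable_tnth.
have := @has_mean_sum _ _ _ (gauss p) _ (index_enum 'I_p) xpredT _ _ (fun a _ =>
  @has_mean_sum _ _ _ (gauss p) _ (index_enum 'I_p) xpredT _ _ (fun b _ =>
  @has_mean_sum _ _ _ (gauss p) _ (index_enum 'I_p) xpredT _ _ (fun c _ =>
  @has_mean_sum _ _ _ (gauss p) _ (index_enum 'I_p) xpredT _ _ (fun d _ =>
    has_meanZ (A i a * A j b * (A k c * A l d)) (has_mean_gauss4 a b c d))))).
rewrite (_ : \sum_a _ = S i j * S k l + S i k * S j l + S i l * S j k).
  congr has_mean; apply/funext => z /=; rewrite !tnth_mktuple.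
  rewrite [in RHS]mulr_suml mulr_suml; apply: eq_bigr => a _.
  rewrite mulr_sumr mulr_suml; apply: eq_bigr => b _.
  rewrite mulr_suml mulr_sumr; apply: eq_bigr => c _.
  rewrite mulr_sumr mulr_sumr; apply: eq_bigr => d _.
  by ring.
rewrite -!AA !kron_pair.
rewrite (_ : \sum_a \sum_b \sum_c \sum_d _ =
  \sum_a \sum_b \sum_c \sum_d A i a * A j b * (A k c * A l d) * (kron a b * kron c d) +
  \sum_a \sum_b \sum_c \sum_d A i a * A j b * (A k c * A l d) * (kron a c * kron b d) +
  \sum_a \sum_b \sum_c \sum_d A i a * A j b * (A k c * A l d) * (kron a d * kron b c)); last first.
  rewrite -!big_split; apply: eq_bigr => a _; rewrite -!big_split; apply: eq_bigr => b _.
  rewrite -!big_split; apply: eq_bigr => c _; rewrite -!big_split; apply: eq_bigr => d _ /=.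
  by ring.
congr (_ + _ + _).
- rewrite mulr_suml; apply: eq_bigr => a _; rewrite mulr_suml; apply: eq_bigr => b _.
  rewrite mulr_sumr; apply: eq_bigr => c _; rewrite mulr_sumr; apply: eq_bigr => d _; ring.
- rewrite mulr_suml; apply: eq_bigr => a _; rewrite exchange_big mulr_suml; apply: eq_bigr => b _.
  rewrite mulr_sumr; apply: eq_bigr => c _; rewrite mulr_sumr; apply: eq_bigr => d _ /=; ring.
- rewrite mulr_suml; apply: eq_bigr => a _.
  under eq_bigr do rewrite exchange_big.
  rewrite exchange_big mulr_suml; apply: eq_bigr => b _.
  rewrite mulr_sumr; apply: eq_bigr => c _; rewrite mulr_sumr; apply: eq_bigr => d _ /=; ring.
Qed.

End mv.
End gaussian_moments.

(** * The split-sample banded test *)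

Section split_statistic.
Context d (T : measurableType d) (R : realType) (P : probability T R) (m n : nat).
Context (i1 i2 : 'I_m -> 'I_n).
Hypotheses (i1_inj : injective i1) (i2_inj : injective i2) (i12 : forall k l, i1 k != i2 l).

Lemma prod_if_eq (f : 'I_n -> R) a : \prod_i (if i == a then f i else 1) = f a.
Proof. by rewrite (bigD1 a)//= eqxx big1 ?mulr1// => i /negbTE ->. Qed.

(** [k], [k'] stand for indices in one half of the sample and [l], [l'] for indices in the other.
    The product is rewritten as a product over all observations, with factor 1 where an index does
    not occur; [V] records whether the two indices of a half coincide. *)
Lemma has_mean_four (q q' : T -> R) (mu mu' nu : R) (k k' l l' : 'I_n) :
  has_mean P q mu -> has_mean P q' mu' -> has_mean P (fun x => q x * q' x) nu ->
  k != l -> k != l' -> k' != l -> k' != l' ->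
  let V a b := if a == b then nu else mu * mu' in
  has_mean (iid_prob P n) (fun x => (q (tnth x k) * q (tnth x l)) * (q' (tnth x k') * q' (tnth x l')))
    (V k k' * V l l').
Proof.
move=> hq hq' hqq kl kl' k'l k'l' V.
pose one (b : bool) (f : T -> R) x := if b then f x else 1.
pose W (a b i : 'I_n) := if i == a then (if i == b then nu else mu) else if i == b then mu' else 1.
have WV a b : \prod_i W a b i = V a b.
  rewrite /V /W; have [->|ab] := eqVneq a b.
    rewrite -[RHS](prod_if_eq (fun=> nu) b); by apply: eq_bigr => i _; case: (i == b).
  rewrite (bigD1 a)//= eqxx (negbTE ab) (bigD1 b)/=; last by rewrite eq_sym.
  rewrite eqxx [b == a]eq_sym (negbTE ab) big1 ?mulr1// => i /andP[/negbTE -> /negbTE ->//].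
have hW a b i : has_mean P (fun x => one (i == a) q x * one (i == b) q' x) (W a b i).
  rewrite /one /W; case: ifP => _; case: ifP => _ //.
  - by under eq_fun do rewrite mulr1.
  - by under eq_fun do rewrite mul1r.
  - by under eq_fun do rewrite mul1r; exact: has_mean_cst.
pose f i x := (one (i == k) q x * one (i == k') q' x) * (one (i == l) q x * one (i == l') q' x).
have hf i : has_mean P (f i) (W k k' i * W l l' i).
  have [ik|ik] := boolP ((i == k) || (i == k')).
    have [nl nl'] : i != l /\ i != l' by case/orP: ik => /eqP ->.
    have -> : W l l' i = 1 by rewrite /W (negbTE nl) (negbTE nl').
    rewrite mulr1; have := hW k k' i; congr has_mean; apply/funext => x.
    by rewrite /f /one (negbTE nl) (negbTE nl') !mulr1.
  move: ik; rewrite negb_or => /andP[nk nk'].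
  have -> : W k k' i = 1 by rewrite /W (negbTE nk) (negbTE nk').
  rewrite mul1r; have := hW l l' i; congr has_mean; apply/funext => x.
  by rewrite /f /one (negbTE nk) (negbTE nk') !mul1r.
have := has_mean_iid hf; rewrite big_split /= !WV; congr has_mean; apply/funext => x.
rewrite /f /one !big_split /=.
rewrite (prod_if_eq (fun i => q (tnth x i)) k) (prod_if_eq (fun i => q' (tnth x i)) k').
rewrite (prod_if_eq (fun i => q (tnth x i)) l) (prod_if_eq (fun i => q' (tnth x i)) l').
by rewrite mulrACA.
Qed.

Context (J : finType) (q : J -> T -> R) (mu : J -> R) (c : J -> J -> R).
Hypothesis qmu : forall b, has_mean P (q b) (mu b).
Hypothesis qqc : forall b b', has_mean P (fun x => q b x * q b' x) (mu b * mu b' + c b b').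

Definition split_stat (x : n.-tuple T) : R :=
  \sum_b (\sum_k q b (tnth x (i1 k))) * (\sum_k q b (tnth x (i2 k))).

Let sumV (i : 'I_m -> 'I_n) (x y : R) : injective i ->
  \sum_k \sum_k' (if i k == i k' then x + y else x) = m%:R ^+ 2 * x + m%:R * y.
Proof.
move=> ii; transitivity (\sum_(k < m) (m%:R * x + y)).
  apply: eq_bigr => k _.
  transitivity (\sum_(k' < m) (x + (if k' == k then y else 0))).
    by apply: eq_bigr => k' _; rewrite (inj_eq ii) eq_sym; case: ifP; rewrite ?addr0.
  rewrite big_split /= sumr_const card_ord mulr_natl; congr (_ + _).
  by rewrite (bigD1 k)//= eqxx big1 ?addr0// => k' /negbTE ->.
rewrite sumr_const card_ord -[_ *+ m]mulr_natl; ring.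
Qed.

(** Each half contributes [m^2 mu mu' + m c], the second term coming from the coincidences of
    indices; the halves are independent and equally large, hence the square. *)
Lemma has_mean_split_prod b b' : has_mean (iid_prob P n)
  (fun x => ((\sum_k q b (tnth x (i1 k))) * (\sum_k q b (tnth x (i2 k)))) *
            ((\sum_k q b' (tnth x (i1 k))) * (\sum_k q b' (tnth x (i2 k)))))
  ((m%:R ^+ 2 * (mu b * mu b') + m%:R * c b b') ^+ 2).
Proof.
have := @has_mean_sum _ _ _ (iid_prob P n) _ (index_enum 'I_m) xpredT _ _ (fun k _ =>
  @has_mean_sum _ _ _ (iid_prob P n) _ (index_enum 'I_m) xpredT _ _ (fun k' _ =>
  @has_mean_sum _ _ _ (iid_prob P n) _ (index_enum 'I_m) xpredT _ _ (fun l _ =>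
  @has_mean_sum _ _ _ (iid_prob P n) _ (index_enum 'I_m) xpredT _ _ (fun l' _ =>
    has_mean_four (qmu b) (qmu b') (qqc b b') (i12 k l) (i12 k l') (i12 k' l) (i12 k' l'))))).
rewrite (_ : \sum_k _ = (m%:R ^+ 2 * (mu b * mu b') + m%:R * c b b') ^+ 2).
  congr has_mean; apply/funext => x.
  rewrite [RHS]mulrACA [X in _ = X * _]mulr_suml [RHS]mulr_suml; apply: eq_bigr => k _.
  rewrite [X in _ = X * _]mulr_sumr [RHS]mulr_suml; apply: eq_bigr => k' _.
  rewrite [X in _ = _ * X]mulr_suml [RHS]mulr_sumr; apply: eq_bigr => l _.
  rewrite [X in _ = _ * X]mulr_sumr [RHS]mulr_sumr; apply: eq_bigr => l' _.
  by rewrite mulrACA.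
rewrite expr2 -{1}(sumV _ _ i1_inj) -(sumV _ _ i2_inj).
rewrite mulr_suml; apply: eq_bigr => k _; rewrite mulr_suml; apply: eq_bigr => k' _.
rewrite mulr_sumr; apply: eq_bigr => l _; rewrite mulr_sumr; by apply: eq_bigr => l' _.
Qed.

Lemma has_mean_split_stat : has_mean (iid_prob P n) split_stat (m%:R ^+ 2 * \sum_b mu b ^+ 2).
Proof.
rewrite mulr_sumr; apply: has_mean_sum => b _.
(* With the constant 1 as second function, [has_mean_four] reduces to a product of two means. *)
have one : has_mean P (fun x => q b x * 1) (mu b * 1).
  by rewrite mulr1; under eq_fun do rewrite mulr1.
have := @has_mean_sum _ _ _ (iid_prob P n) _ (index_enum 'I_m) xpredT _ _ (fun k _ =>
  @has_mean_sum _ _ _ (iid_prob P n) _ (index_enum 'I_m) xpredT _ _ (fun l _ =>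
    has_mean_four (qmu b) (has_mean_cst P 1) one (i12 k l) (i12 k l) (i12 k l) (i12 k l))).
rewrite (_ : \sum_k _ = m%:R ^+ 2 * mu b ^+ 2).
  congr has_mean; apply/funext => x.
  rewrite mulr_suml; apply: eq_bigr => k _; rewrite mulr_sumr; apply: eq_bigr => l _.
  by rewrite !mulr1.
under eq_bigr do under eq_bigr do rewrite !eqxx mulr1.
rewrite !sumr_const card_ord -[_ *+ m]mulr_natl -[_ *+ m in X in _ * X]mulr_natl; ring.
Qed.

(** (x + y)^2 - x^2 = 2 x y + y^2 with [x = m^2 mu mu'] and [y = m c]; the x^2 add up to the squared
    mean. *)
Lemma has_mean_split_var : has_mean (iid_prob P n)
  (fun x => (split_stat x - m%:R ^+ 2 * \sum_b mu b ^+ 2) ^+ 2)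
  (\sum_b \sum_b' (2 * m%:R ^+ 3 * (mu b * mu b' * c b b') + m%:R ^+ 2 * c b b' ^+ 2)).
Proof.
set M := m%:R ^+ 2 * _.
have sq := @has_mean_sum _ _ _ (iid_prob P n) _ (index_enum J) xpredT _ _ (fun b _ =>
  @has_mean_sum _ _ _ (iid_prob P n) _ (index_enum J) xpredT _ _ (fun b' _ =>
    has_mean_split_prod b b')).
have := has_meanD sq (has_meanD (has_meanZ (- 2 * M) has_mean_split_stat)
  (has_mean_cst _ (M ^+ 2))).
rewrite -/M (_ : _ + _ = \sum_b \sum_b'
    (2 * m%:R ^+ 3 * (mu b * mu b' * c b b') + m%:R ^+ 2 * c b b' ^+ 2)).
  congr has_mean; apply/funext => x.
  transitivity (split_stat x ^+ 2 + (- 2 * M * split_stat x + M ^+ 2)); last by ring.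
  congr (_ + _); rewrite expr2 mulr_suml; apply: eq_bigr => b _.
  by rewrite [X in _ = _ * X]/split_stat [RHS]mulr_sumr.
have -> : - 2 * M * M + M ^+ 2 = - M ^+ 2 by ring.
have -> : M ^+ 2 = \sum_b \sum_b' (m%:R ^+ 2 * (mu b * mu b')) ^+ 2.
  rewrite /M expr2 mulr_sumr mulr_suml; apply: eq_bigr => b _.
  by rewrite mulr_sumr; apply: eq_bigr => b' _; ring.
rewrite -sumrB; apply: eq_bigr => b _; rewrite -sumrB; apply: eq_bigr => b' _; ring.
Qed.

End split_statistic.

(** * Banded sums of squared covariances *)

Section band_test.
Context (R : realType) (p T : nat).
Implicit Types (S : 'M[R]_p).

Definition band (i j : 'I_p) : bool := [&& i != j, (i <= j + T)%N & (j <= i + T)%N].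
Definition band_ind (i j : 'I_p) : R := (band i j)%:R.

Lemma band_sym i j : band i j = band j i.
Proof. by rewrite /band eq_sym; congr (_ && _); rewrite andbC. Qed.

Lemma band_ind_ge0 i j : 0 <= band_ind i j. Proof. exact: ler0n. Qed.
Lemma band_ind_le1 i j : band_ind i j <= 1. Proof. by rewrite lern1 leq_b1. Qed.

Lemma sum_ord_eq1 (k : nat) : \sum_(j < p) ((j == k :> nat)%:R : R) <= 1.
Proof.
have [kp|kp] := ltnP k p.
  rewrite (bigD1 (Ordinal kp))//= eqxx big1 ?addr0// => j.
  by rewrite -val_eqE /= => /negbTE ->.
rewrite big1 ?ler01// => j _; case: eqP => // jk.
by move: (ltn_ord j); rewrite jk ltnNge kp.
Qed.

Lemma band_row i : \sum_j band_ind i j <= Num.min (2 * T%:R) p%:R.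
Proof.
rewrite le_min; apply/andP; split; last first.
  rewrite -[leRHS](_ : \sum_(j < p) 1 = _); last by rewrite sumr_const card_ord.
  by apply: ler_sum => j _; exact: band_ind_le1.
(* In the band, [j] is [i] plus or minus one of 1, ..., T. Truncated subtraction may count [j = 0]
   repeatedly, which is harmless in an upper bound. *)
apply: (@le_trans _ _ (\sum_(j < p) \sum_(d < T)
    ((j == (i + d.+1)%N :> nat)%:R + (j == (i - d.+1)%N :> nat)%:R))).
  apply: ler_sum => j _; rewrite /band_ind /band.
  case: (boolP [&& _, _ & _]) => [/and3P[ij h1 h2]|_]; last by apply: sumr_ge0 => k _; rewrite addr_ge0.
  have [lt|gt|e] := ltngtP i j; last by move: ij; rewrite -val_eqE /= e eqxx.
    have dT : (j - i.+1 < T)%N by lia.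
    rewrite (bigD1 (Ordinal dT))//= (_ : _ == _ = true); last by apply/eqP; lia.
    by rewrite -addrA lerDl addr_ge0// ?ler0n// sumr_ge0// => k _; rewrite addr_ge0.
  have dT : (i - j.+1 < T)%N by lia.
  have e : nat_of_ord j = (i - (i - j.+1).+1)%N by lia.
  rewrite (bigD1 (Ordinal dT))//= -e eqxx.
  by rewrite [X in X + _]addrC -addrA lerDl addr_ge0// ?ler0n// sumr_ge0// => k _; rewrite addr_ge0.
rewrite exchange_big /=.
apply: (@le_trans _ _ (\sum_(d < T) 2)); last by rewrite sumr_const card_ord -[_ *+ T]mulr_natr.
apply: ler_sum => d _; rewrite big_split /= (_ : 2 = 1 + 1) ?lerD ?sum_ord_eq1//.
Qed.

Definition band_sqr S := \sum_i \sum_j band_ind i j * S i j ^+ 2.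
(** By Isserlis' formula, the covariance of [x_i x_j] and [x_i' x_j'], restricted to pairs in the
    band. *)
Definition band_cov S (i j i' j' : 'I_p) : R := band_ind i j * band_ind i' j' * (S i i' * S j j' + S i j' * S j i').
Definition band_cov_sqr S := \sum_i \sum_j \sum_i' \sum_j' band_cov S i j i' j' ^+ 2.

Lemma sum_prod2 (f g : 'I_p -> R) : \sum_i \sum_j f i * g j = (\sum_i f i) * (\sum_j g j).
Proof. by rewrite mulr_suml; apply: eq_bigr => i _; rewrite mulr_sumr. Qed.

Lemma sum_kron (i : 'I_p) : \sum_j (kron R i j) = 1.
Proof.
by have := kron_sum i (fun=> 1 : R); under eq_bigr do rewrite mul1r.
Qed.

(** Each [S i j ^+ 2] splits into its diagonal part and [a i j]. The purely diagonal term is the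
    noise, at most p w with w the bound on a row of the band; the term quadratic in [a] is at most
    E^2; the two mixed terms, w E each, are absorbed through 2 w E <= w^2 + E^2 and w <= p. *)
Lemma band_cov_sqr_le S : S^T = S -> (forall i, S i i = 1) ->
  band_cov_sqr S <= 8 * (2 * p%:R * T%:R + frob2 (S - 1%:M) ^+ 2).
Proof.
move=> symS diagS; set E := frob2 _.
pose a i j := (S - 1%:M) i j ^+ 2.
have a0 i j : 0 <= a i j by exact: sqr_ge0.
have aE i j : S i j ^+ 2 = kron R i j + a i j.
  rewrite /a !mxE /kron; have [->|ij] := eqVneq i j; first by rewrite diagS mulr1n subrr expr1n expr0n addr0.
  by rewrite mulr0n subr0 add0r.
have asym i j : a i j = a j i.
  by rewrite /a !mxE eq_sym; congr ((_ - _) ^+ 2); rewrite -[in LHS]symS mxE.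
pose w : R := Num.min (2 * T%:R) p%:R.
have w0 : 0 <= w by rewrite le_min mulr_ge0//= ler0n.
have wp : w <= p%:R by rewrite ge_min lexx orbT.
have wT : w <= 2 * T%:R by rewrite ge_min lexx.
have E0 : 0 <= E by exact: frob2_ge0.
pose K := \sum_i \sum_j \sum_i' \sum_j' band_ind i j * band_ind i' j' * (S i i' ^+ 2 * S j j' ^+ 2).
have swap : \sum_i \sum_j \sum_i' \sum_j' band_ind i j * band_ind i' j' * (S i j' ^+ 2 * S j i' ^+ 2) = K.
  apply: eq_bigr => i _; apply: eq_bigr => j _; rewrite exchange_big /=.
  by apply: eq_bigr => i' _; apply: eq_bigr => j' _; rewrite /band_ind (band_sym j' i').
have cK : band_cov_sqr S <= 4 * K.
  have -> : 4 * K = 2 * (K + \sum_i \sum_j \sum_i' \sum_j' band_ind i j * band_ind i' j' * (S i j' ^+ 2 * S j i' ^+ 2)).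
    by rewrite swap; ring.
  rewrite -big_split mulr_sumr; apply: ler_sum => i _ /=.
  rewrite -big_split mulr_sumr; apply: ler_sum => j _ /=.
  rewrite -big_split mulr_sumr; apply: ler_sum => i' _ /=.
  rewrite -big_split mulr_sumr; apply: ler_sum => j' _ /=.
  rewrite /band_cov -!natrM exprMn; set b := (_ * _)%N.
  have -> : (b%:R : R) ^+ 2 = b%:R by rewrite /b; do 2 case: band; rewrite ?mul0n ?muln0 ?expr0n ?expr1n.
  rewrite -mulrDr (mulrCA 2) ler_wpM2l ?ler0n//.
  have := sqr_ge0 (S i i' * S j j' - S i j' * S j i').
  by rewrite sqrrB sqrrD !exprMn; lra.
have KE : K <= 2 * p%:R * w + 2 * E ^+ 2.
  pose r i := \sum_j a i j.
  have rE : \sum_i r i = E by [].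
  have r0 i : 0 <= r i by exact: sumr_ge0.
  have h1 : \sum_i \sum_j \sum_i' \sum_j' band_ind i j * (kron R i i' * kron R j j') <= p%:R * w.
    rewrite mulr_natl -[X in _ *+ X](card_ord p) -sumr_const; apply: ler_sum => i _.
    apply: (le_trans _ (band_row i)); rewrite le_eqVlt; apply/orP; left; apply/eqP.
    apply: eq_bigr => j _; under eq_bigr do rewrite -mulr_sumr.
    by rewrite -mulr_sumr sum_prod2 !sum_kron !mulr1.
  have h2 : \sum_i \sum_j \sum_i' \sum_j' band_ind i j * (kron R i i' * a j j') <= w * E.
    rewrite exchange_big -rE mulr_sumr /=; apply: ler_sum => j _.
    rewrite (eq_bigr (fun i => r j * band_ind j i)) => [|i _].
      by rewrite -mulr_sumr mulrC ler_wpM2r ?r0// band_row.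
    under eq_bigr do rewrite -mulr_sumr.
    by rewrite -mulr_sumr sum_prod2 sum_kron mul1r mulrC /band_ind band_sym.
  have h3 : \sum_i \sum_j \sum_i' \sum_j' band_ind i j * (a i i' * kron R j j') <= w * E.
    rewrite -rE mulr_sumr; apply: ler_sum => i _.
    rewrite (eq_bigr (fun j => r i * band_ind i j)) => [|j _].
      by rewrite -mulr_sumr mulrC ler_wpM2r ?r0// band_row.
    under eq_bigr do rewrite -mulr_sumr.
    by rewrite -mulr_sumr sum_prod2 sum_kron mulr1 mulrC.
  have h4 : \sum_i \sum_j \sum_i' \sum_j' a i i' * a j j' = E ^+ 2.
    under eq_bigr do under eq_bigr do rewrite sum_prod2.
    by rewrite sum_prod2 expr2.
  have : K <= p%:R * w + w * E + w * E + E ^+ 2.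
    apply: (@le_trans _ _ (\sum_i \sum_j \sum_i' \sum_j' (band_ind i j * (kron R i i' * kron R j j') +
       band_ind i j * (kron R i i' * a j j') + band_ind i j * (a i i' * kron R j j') + a i i' * a j j'))).
      do 4 (apply: ler_sum => ? _); rewrite !aE; set x := band_ind _ _; set y := band_ind _ _.
      set k1 := kron R _ _; set k2 := kron R _ _; set a1 := a _ _; set a2 := a _ _.
      have x1 : 0 <= x <= 1 by rewrite band_ind_ge0 band_ind_le1.
      have y1 : 0 <= y <= 1 by rewrite band_ind_ge0 band_ind_le1.
      have k10 : 0 <= k1 by exact: ler0n. have k20 : 0 <= k2 by exact: ler0n.
      have a10 : 0 <= a1 by exact: a0. have a20 : 0 <= a2 by exact: a0.
      have xy : x * y <= x by rewrite ler_piMr; case/andP: x1; case/andP: y1.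
      apply: (@le_trans _ _ (x * ((k1 + a1) * (k2 + a2)))).
        by rewrite ler_wpM2r// mulr_ge0// addr_ge0.
      have a12 : 0 <= a1 * a2 by exact: mulr_ge0.
      have xa : x * (a1 * a2) <= a1 * a2 by rewrite ler_piMl//; case/andP: x1.
      lra.
    under eq_bigr do under eq_bigr do under eq_bigr do rewrite !big_split.
    under eq_bigr do under eq_bigr do rewrite !big_split.
    under eq_bigr do rewrite !big_split.
    rewrite !big_split /= h4; lra.
  have : 2 * w * E <= w ^+ 2 + E ^+ 2 by have := sqr_ge0 (w - E); rewrite sqrrB; lra.
  have : w ^+ 2 <= p%:R * w by rewrite expr2 ler_wpM2r.
  lra.
have : p%:R * w <= p%:R * (2 * T%:R) by rewrite ler_wpM2l.
lra.
Qed.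

(** Off the band and the diagonal the smoothness weight is at least T^(2 alpha); the factor 2 counts
    both triangles, and the diagonal of [S - I] is zero. *)
Lemma band_sqr_tail S (alpha L : R) : 0 <= alpha -> classF alpha L S -> (0 < p)%N ->
  T%:R `^ (2 * alpha) * (frob2 (S - 1%:M) - band_sqr S) <= 2 * L * p%:R.
Proof.
move=> al0 [[symS _] diagS sm] p0.
have symE i j : S i j = S j i by rewrite -[in LHS]symS mxE.
have p0' : 0 < p%:R :> R by rewrite ltr0n.
move: sm; rewrite ler_pdivrMl// => sm.
pose f (i j : 'I_p) : R := S i j ^+ 2 * `|i%:R - j%:R| `^ (2 * alpha).
have fC i j : f i j = f j i by rewrite /f symE distrC.
have f0 i j : 0 <= f i j by rewrite mulr_ge0 ?sqr_ge0 ?powR_ge0.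
pose g (i j : 'I_p) : R := (if (i < j)%N then f i j else 0) + (if (j < i)%N then f j i else 0).
apply: (@le_trans _ _ (\sum_i \sum_j g i j)).
  rewrite /frob2 /band_sqr -sumrB mulr_sumr; apply: ler_sum => i _.
  rewrite -sumrB mulr_sumr; apply: ler_sum => j _.
  rewrite !mxE /g; have [<-|ij] := eqVneq i j.
    by rewrite diagS mulr1n subrr expr0n /band_ind /band eqxx/= mul0r subrr mulr0 ltnn addr0.
  rewrite mulr0n subr0 (fC j i) -[X in X - _]mul1r -mulrBl mulrCA mulrC.
  have -> : (if (i < j)%N then f i j else 0) + (if (j < i)%N then f i j else 0) = f i j.
    by case: ltngtP (ij) => [_|_|/val_inj ->]; rewrite ?addr0 ?add0r ?eqxx.
  rewrite /band_ind /band ij /=; case: (boolP (_ && _)) => [_|nb].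
    by rewrite subrr mulr0.
  rewrite subr0 mulr1 mulrC /f ler_wpM2l ?sqr_ge0// ge0_ler_powR ?nnegrE ?mulr_ge0//.
  have [lt|gt|e] := ltngtP i j; last by move: ij; rewrite -val_eqE /= e eqxx.
    rewrite distrC ger0_norm ?subr_ge0 ?ler_nat 1?ltnW// -natrB 1?ltnW// ler_nat.
    by move: nb; rewrite negb_and; lia.
  rewrite ger0_norm ?subr_ge0 ?ler_nat 1?ltnW// -natrB 1?ltnW// ler_nat.
  by move: nb; rewrite negb_and; lia.
have h : \sum_(i < p) \sum_(j < p) (if (i < j)%N then f i j else 0) <= L * p%:R.
  apply: (le_trans _ (le_trans sm _)); last by rewrite mulrC.
  by apply: ler_sum => i _; rewrite -big_mkcond.
rewrite /g; under eq_bigr do rewrite big_split.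
rewrite big_split /= [X in _ + X]exchange_big /=; lra.
Qed.

End band_test.

Lemma first_half_subproof n (k : 'I_(n./2)) : (k < n)%N.
Proof. by have := ltn_ord k; lia. Qed.

Lemma second_half_subproof n (k : 'I_(n./2)) : (n./2 + k < n)%N.
Proof. by have := ltn_ord k; lia. Qed.

(** For odd [n] the last observation lies in neither half. *)
Definition first_half n (k : 'I_(n./2)) : 'I_n := Ordinal (first_half_subproof k).
Definition second_half n (k : 'I_(n./2)) : 'I_n := Ordinal (second_half_subproof k).

(** * Error probabilities of the banded test *)

Section test.
Context (R : realType) (n p T : nat).
Local Notation m := (n./2%:R : R).
Implicit Types S : 'M[R]_p.

Definition pair_prod (b : 'I_p * 'I_p) (x : p.-tuple R) : R :=
  band_ind R T b.1 b.2 * (tnth x b.1 * tnth x b.2).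

Definition band_stat (x : n.-tuple (p.-tuple R)) : R := split_stat (@first_half n) (@second_half n) pair_prod x.

Let first_inj : injective (@first_half n).
Proof. by move=> k l /(congr1 val) /= /val_inj. Qed.

Let second_inj : injective (@second_half n).
Proof. by move=> k l /(congr1 val) /= /addnI /val_inj. Qed.

Let halves (k l : 'I_(n./2)) : first_half k != second_half l.
Proof. by rewrite -val_eqE /=; have := ltn_ord k; lia. Qed.

Section moments.
Context (S : 'M[R]_p).
Hypothesis psdS : psdmx S.
Let mu (b : 'I_p * 'I_p) := band_ind R T b.1 b.2 * S b.1 b.2.
Let c (b b' : 'I_p * 'I_p) := band_cov T S b.1 b.2 b'.1 b'.2.

Let pair_mean b : has_mean (mvnormal S) (pair_prod b) (mu b).
Proof. by apply: has_meanZ; exact: has_mean_mv2. Qed.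

Let pair_cov b b' :
  has_mean (mvnormal S) (fun x => pair_prod b x * pair_prod b' x) (mu b * mu b' + c b b').
Proof.
have := has_meanZ (band_ind R T b.1 b.2 * band_ind R T b'.1 b'.2) (has_mean_mv4 psdS b.1 b.2 b'.1 b'.2).
rewrite (_ : _ * (_ + _ + _) = mu b * mu b' + c b b'); last by rewrite /mu /c /band_cov; ring.
by congr has_mean; apply/funext => x; rewrite /pair_prod mulrACA.
Qed.

Let band_ind_sqr (i j : 'I_p) : band_ind R T i j ^+ 2 = band_ind R T i j.
Proof. by rewrite /band_ind; case: band; rewrite ?expr0n ?expr1n. Qed.

Let sum_mu : \sum_b mu b ^+ 2 = band_sqr T S.
Proof.
rewrite /band_sqr (pair_big xpredT xpredT (fun i j => band_ind R T i j * S i j ^+ 2)) /=.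
by apply: eq_bigr => b _; rewrite /mu exprMn band_ind_sqr.
Qed.

Lemma has_mean_band_stat : has_mean (iid_prob (mvnormal S) n) band_stat (m ^+ 2 * band_sqr T S).
Proof.
by rewrite -sum_mu; apply: has_mean_split_stat.
Qed.

(** Young's inequality 2 m^3 x y <= delta (m^2 x)^2 + delta^-1 m^2 y^2 decouples means from
    covariances in the cross term. The price, [delta] times the squared mean, is made small by the
    later choice of [delta]. *)
Lemma has_mean_band_var : exists v,
  has_mean (iid_prob (mvnormal S) n) (fun x => (band_stat x - m ^+ 2 * band_sqr T S) ^+ 2) v /\
  forall delta : R, 0 < delta ->
    v <= delta * (m ^+ 2 * band_sqr T S) ^+ 2 + (delta^-1 + 1) * (m ^+ 2 * band_cov_sqr T S).
Proof.
have := has_mean_split_var first_inj second_inj halves pair_mean pair_cov.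
rewrite sum_mu => h; eexists; split; first exact: h.
move=> delta d0.
have -> : band_cov_sqr T S = \sum_b \sum_b' c b b' ^+ 2.
  rewrite /band_cov_sqr (pair_big xpredT xpredT (fun i j => \sum_i' \sum_j' band_cov T S i j i' j' ^+ 2)) /=.
  apply: eq_bigr => b _.
  by rewrite (pair_big xpredT xpredT (fun i' j' => band_cov T S b.1 b.2 i' j' ^+ 2)).
have -> : (m ^+ 2 * band_sqr T S) ^+ 2 = \sum_b \sum_b' (m ^+ 2 * (mu b * mu b')) ^+ 2.
  rewrite -sum_mu exprMn [X in X = _](_ : _ = m ^+ 2 ^+ 2 * ((\sum_b mu b ^+ 2) * (\sum_b mu b ^+ 2))); last by rewrite expr2.
  rewrite mulr_suml [LHS]mulr_sumr; apply: eq_bigr => b _.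
  rewrite mulr_sumr [LHS]mulr_sumr; apply: eq_bigr => b' _; ring.
rewrite !mulr_sumr -big_split; apply: ler_sum => b _ /=.
rewrite !mulr_sumr -big_split; apply: ler_sum => b' _ /=.
set x := mu b * mu b'; set y := c b b'.
have e0 : 0 < delta^-1 by rewrite invr_gt0.
have : 0 <= delta^-1 * (delta * (m ^+ 2 * x) - m * y) ^+ 2 by rewrite mulr_ge0 ?sqr_ge0// ltW.
have -> : delta^-1 * (delta * (m ^+ 2 * x) - m * y) ^+ 2 = (delta^-1 * delta) * delta * (m ^+ 2 * x) ^+ 2
  - (delta^-1 * delta) * (2 * m ^+ 3 * (x * y)) + delta^-1 * (m ^+ 2 * y ^+ 2) by ring.
rewrite mulVf ?gt_eqF//; lra.
Qed.

End moments.

Definition band_test (t : R) (x : n.-tuple (p.-tuple R)) : R := (t < band_stat x)%R%:R.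

Lemma band_test_is_test t : is_test (band_test t).
Proof.
split; last by move=> x; rewrite /band_test ler0n lern1 leq_b1.
have ms : measurable_fun setT band_stat.
  exact: has_mean_measurable (has_mean_band_stat (psdmx1 R p)).
have -> : band_test t = \1_(band_stat @^-1` `]t, +oo[) :> (_ -> R).
  apply/funext => x; rewrite indicE /band_test; congr (_%:R); congr nat_of_bool.
  by apply/idP/idP; rewrite inE /= in_itv /= andbT.
apply: measurable_indic; rewrite -[X in measurable X]setTI; apply: ms => //.
Qed.

Lemma band_sqr1 : band_sqr T (1%:M : 'M[R]_p) = 0.
Proof.
rewrite /band_sqr big1// => i _; rewrite big1// => j _; rewrite /band_ind /band mxE.
by case: eqP => _ /=; rewrite ?mul0r// expr0n mulr0.
Qed.

Lemma type1_error_le (t : R) : 0 < t ->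
  expect 1%:M (band_test t) <= 32 * m ^+ 2 * p%:R * T%:R / t ^+ 2.
Proof.
move=> t0; have [v [hv vle]] := has_mean_band_var (psdmx1 R p).
have hD := has_mean_test 1%:M (band_test_is_test t).
rewrite band_sqr1 mulr0 in hv.
have := has_mean_le hD (has_meanZ (t ^+ 2)^-1 hv) => h.
have {}h : expect 1%:M (band_test t) <= (t ^+ 2)^-1 * v.
  apply: h => x; rewrite subr0 /band_test; case: ltP => [lt|_]; last by rewrite mulr_ge0 ?invr_ge0 ?sqr_ge0.
  rewrite ler_pdivlMl ?exprn_gt0// mulr1 ler_sqr ?nnegrE ?ltW//.
  exact: lt_trans lt.
apply: (le_trans h); rewrite mulrC ler_wpM2r ?invr_ge0 ?sqr_ge0//.
(* At the identity the mean is 0, so the term multiplied by [delta] vanishes; [delta = 1] gives the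
   factor 2. *)
have := vle 1 ltr01; rewrite band_sqr1 mulr0 expr0n mulr0 add0r invr1 => /le_trans; apply.
have := @band_cov_sqr_le R p T 1%:M (trmx1 R p); rewrite subrr.
have -> : frob2 (0 : 'M[R]_p) = 0.
  by rewrite /frob2 big1// => i _; rewrite big1// => j _; rewrite mxE expr0n.
rewrite expr0n addr0 => hc.
have {}hc : band_cov_sqr T (1%:M : 'M[R]_p) <= 8 * (2 * p%:R * T%:R).
  by apply: hc => i; rewrite mxE eqxx.
have m2 : 0 <= m ^+ 2 by exact: sqr_ge0.
have := ler_wpM2l m2 hc; lra.
Qed.

(** The threshold is at most half the mean, so acceptance forces a deviation of at least half the
    mean; Chebyshev then gives the factor 4. *)
Lemma type2_error_le S (t delta : R) : psdmx S -> 0 < t -> 0 < delta -> 2 * t <= m ^+ 2 * band_sqr T S ->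
  expect S (fun x => 1 - band_test t x) <=
  4 * (delta + (delta^-1 + 1) * (m ^+ 2 * band_cov_sqr T S / (m ^+ 2 * band_sqr T S) ^+ 2)).
Proof.
move=> psdS t0 d0 tb; have [v [hv vle]] := has_mean_band_var psdS.
have hD := has_mean_test S (is_testC (band_test_is_test t)).
set M := m ^+ 2 * band_sqr T S in tb hv vle *.
have M0 : 0 < M by lra.
have := has_mean_le hD (has_meanZ (4 / M ^+ 2) hv) => h.
have {}h : expect S (fun x => 1 - band_test t x) <= 4 / M ^+ 2 * v.
  apply: h => x; rewrite /band_test; case: ltP => [_|le].
    by rewrite subrr mulr_ge0 ?sqr_ge0// divr_ge0 ?sqr_ge0.
  rewrite subr0 mulrAC ler_pdivlMr ?exprn_gt0// mul1r.
  have -> : 4 * (band_stat x - M) ^+ 2 = (2 * (M - band_stat x)) ^+ 2 by ring.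
  by rewrite ler_sqr ?nnegrE; lra.
apply: (le_trans h).
have := vle delta d0; set C := m ^+ 2 * band_cov_sqr T S => vl.
apply: (@le_trans _ _ (4 / M ^+ 2 * (delta * M ^+ 2 + (delta^-1 + 1) * C))).
  by rewrite ler_wpM2l// divr_ge0// sqr_ge0.
by rewrite le_eqVlt; apply/orP; left; apply/eqP; move: (delta^-1) => e; field; rewrite gt_eqF.
Qed.

(** The bound on [T] keeps the part of |S - I|^2 off the band below p (lambda psi)^2, half of the
    guaranteed total, so the band holds at least half of |S - I|^2. The threshold is half the
    smallest mean this allows, and [xi] is the order of the noise variance relative to the squared
    mean. *)
Lemma band_test_risk (alpha L lambda psi delta t xi : R) : (0 < p)%N -> (1 < n)%N -> (0 < T)%N ->
  0 <= alpha -> 0 < lambda -> 0 < psi -> 0 < delta ->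
  2 * L <= T%:R `^ (2 * alpha) * (lambda * psi) ^+ 2 ->
  t = m ^+ 2 * p%:R * (lambda * psi) ^+ 2 / 2 ->
  xi = T%:R / (m ^+ 2 * p%:R * (lambda * psi) ^+ 4) ->
  risk (band_test t) (alternative alpha L lambda psi) <=
  128 * xi + 4 * (delta + (delta^-1 + 1) * (16 * xi + 32 / m ^+ 2)).
Proof.
move=> p0 n1 T0 al0 la0 psi0 d0 TL tE xiE.
have p0' : 0 < p%:R :> R by rewrite ltr0n.
have m0 : 0 < m by rewrite ltr0n half_gt0.
have T0' : 0 < T%:R :> R by rewrite ltr0n.
set u := (lambda * psi) ^+ 2 in TL tE.
have u0 : 0 < u by rewrite exprn_gt0// mulr_gt0.
have {}xiE : xi = T%:R / (m ^+ 2 * p%:R * u ^+ 2) by rewrite xiE /u -exprM.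
have t0 : 0 < t by rewrite tE !mulr_gt0 ?exprn_gt0 ?invr_gt0.
have m20 : 0 < m ^+ 2 by exact: exprn_gt0.
have xi0 : 0 < xi by rewrite xiE divr_gt0 ?mulr_gt0// exprn_gt0.
have dd : 0 < delta^-1 by rewrite invr_gt0.
rewrite /risk; apply: lerD.
  apply: (le_trans (type1_error_le t0)); rewrite le_eqVlt; apply/orP; left; apply/eqP.
  by rewrite xiE tE; field; rewrite !gt_eqF.
(* Bounding a supremum elementwise needs a nonempty set; for an empty alternative it is 0 by
   convention. *)
have [[S AS]|no] := pselect (exists S, alternative alpha L lambda psi S); last first.
  have -> : alternative alpha L lambda psi = set0 :> set 'M[R]_p.
    by rewrite -subset0 => S AS; apply: no; exists S.
  have b0 : 0 < 16 * xi + 32 / m ^+ 2 by apply: addr_gt0; [exact: mulr_gt0|exact: divr_gt0].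
  have b1 : 0 < delta^-1 + 1 by exact: addr_gt0.
  by rewrite image_set0 sup0 ltW// mulr_gt0// addr_gt0// mulr_gt0.
apply: ge_sup; first by exists (expect S (fun x => 1 - band_test t x)), S.
move=> _ [{AS}S [[FS eS] hpsi] <-].
have [psdS diagS smS] := FS.
have E1 : 2 * p%:R * u <= frob2 (S - 1%:M).
  apply: (le_trans _ (frob2_inv_le psdS la0 eS)).
  move: hpsi; rewrite frobenius_sqr ler_pdivlMl ?mulr_gt0// => hpsi.
  by rewrite /u exprMn mulrCA ler_wpM2l ?sqr_ge0.
have tl := band_sqr_tail T al0 FS p0.
set E := frob2 _ in E1 tl; set N := band_sqr T S in tl.
have Ta : 0 < T%:R `^ (2 * alpha) by rewrite powR_gt0.
have EN : E - N <= p%:R * u.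
  rewrite -(ler_pM2l Ta); apply: (le_trans tl).
  by rewrite (mulrCA _ p%:R) (mulrC (2 * L)) ler_pM2l.
have N1 : p%:R * u <= N by lra.
have N2 : E <= 2 * N by lra.
have N0 : 0 < N by apply: lt_le_trans N1; rewrite mulr_gt0.
have tN : 2 * t <= m ^+ 2 * N.
  by rewrite tE (_ : 2 * _ = m ^+ 2 * (p%:R * u)) ?ler_pM2l//; field.
apply: (le_trans (type2_error_le psdS t0 d0 tN)).
rewrite ler_pM2l// lerD2l ler_pM2l ?addr_gt0//.
have cq := band_cov_sqr_le T psdS.1 diagS; rewrite -/E in cq.
have E0 : 0 <= E by exact: frob2_ge0.
have cq2 : band_cov_sqr T S <= 16 * p%:R * T%:R + 32 * N ^+ 2.
  have : E ^+ 2 <= (2 * N) ^+ 2 by rewrite ler_sqr ?nnegrE//; lra.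
  rewrite exprMn; lra.
have -> : m ^+ 2 * band_cov_sqr T S / (m ^+ 2 * N) ^+ 2 = band_cov_sqr T S / (m ^+ 2 * N ^+ 2).
  by field; rewrite !gt_eqF.
rewrite ler_pdivrMr; last by rewrite mulr_gt0// exprn_gt0.
apply: (le_trans cq2).
have -> : (16 * xi + 32 / m ^+ 2) * (m ^+ 2 * N ^+ 2) = 16 * p%:R * T%:R * (N / (p%:R * u)) ^+ 2 + 32 * N ^+ 2.
  by rewrite xiE; field; rewrite !gt_eqF.
rewrite lerD2r -[leLHS]mulr1 ler_wpM2l ?mulr_ge0//.
have h : 1 <= N / (p%:R * u) by rewrite ler_pdivlMr ?mulr_gt0// mul1r.
exact: exprn_ege1.
Qed.

End test.

(** * Calibration *)

Section scale.
Context (R : realType) (alpha L : R).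
Hypothesis alpha_gt0 : 0 < alpha.
Hypothesis L0 : 0 < L.
Local Notation C := (rate_const alpha L).

Lemma le_powR_inv (r x y : R) : 0 < r -> 0 <= x -> 0 <= y -> x `^ r <= y `^ r -> x <= y.
Proof.
move=> r0 x0 y0; apply: contraTT; rewrite -!ltNge => yx.
by apply: gt0_ltr_powR; rewrite ?nnegrE.
Qed.

Lemma rate_const_gt0 : 0 < C.
Proof. by rewrite /rate_const !mulr_gt0 ?invr_gt0 ?powR_gt0 //; move: alpha_gt0; lra. Qed.

Definition scale (n p : nat) : R :=
  (n%:R * Num.sqrt p%:R * Num.sqrt C) `^ (2 / (4 * alpha + 1)).

Lemma scale_ge0 n p : 0 <= scale n p. Proof. exact: powR_ge0. Qed.

Lemma rateE n p : rate alpha L n p = (scale n p `^ alpha)^-1.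
Proof.
rewrite /rate /scale -powRrM -powRN; congr (_ `^ _).
by field; move: alpha_gt0; lra.
Qed.

Lemma scale_pow n p : scale n p `^ (4 * alpha + 1) = n%:R ^+ 2 * p%:R * C.
Proof.
rewrite /scale -powRrM divfK; last by move: alpha_gt0; lra.
rewrite powR_mulrn ?mulr_ge0 ?sqrtr_ge0//.
by rewrite !exprMn !sqr_sqrtr// ltW// rate_const_gt0.
Qed.

Lemma scale_gt0 n p : (0 < n)%N -> (0 < p)%N -> 0 < scale n p.
Proof.
move=> n0 p0; rewrite /scale powR_gt0// !mulr_gt0 ?ltr0n// sqrtr_gt0 ?ltr0n//.
exact: rate_const_gt0.
Qed.

Lemma rate4 n p : (0 < n)%N -> (0 < p)%N ->
  n%:R ^+ 2 * p%:R * rate alpha L n p ^+ 4 = scale n p / C.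
Proof.
move=> n0 p0; have x0 := scale_gt0 n0 p0; have C0 := rate_const_gt0.
have x4 : (scale n p `^ alpha) ^+ 4 * scale n p = n%:R ^+ 2 * p%:R * C.
  rewrite -scale_pow powRD; last by apply/implyP => _; rewrite gt_eqF.
  by rewrite powRr1 ?ltW// [4 * alpha]mulrC powRrM powR_mulrn ?powR_ge0.
rewrite rateE exprVn; apply: (@mulIf _ C); first by rewrite gt_eqF.
rewrite divfK ?gt_eqF// mulrAC -x4.
have y0 : (scale n p `^ alpha) ^+ 4 != 0 by rewrite gt_eqF// exprn_gt0// powR_gt0.
by rewrite mulrAC divff// mul1r.
Qed.

(** n rate^2 = n / x^(2 alpha). Raised to the power 4 alpha + 1, n <= x^(2 alpha) reads n^(4 alpha +
    1) <= (n^2 p C)^(2 alpha), that is n <= (p C)^(2 alpha). *)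
Lemma n_rate2_le n p : (0 < n)%N -> (0 < p)%N ->
  n%:R / p%:R `^ (2 * alpha) <= C `^ (2 * alpha) -> n%:R * rate alpha L n p ^+ 2 <= 1.
Proof.
move=> n0 p0 h; have x0 := scale_gt0 n0 p0; have C0 := ltW rate_const_gt0.
rewrite rateE; move: (scale n p) (scale_pow n p) x0 => x xE x0.
have xa : 0 < x `^ alpha by exact: powR_gt0.
have n0' : n%:R != 0 :> R by rewrite pnatr_eq0 -lt0n.
have np : 0 < p%:R `^ (2 * alpha) :> R by rewrite powR_gt0 ?ltr0n.
rewrite exprVn ler_pdivrMr ?exprn_gt0// mul1r.
have -> : (x `^ alpha) ^+ 2 = x `^ (2 * alpha).
  by rewrite -powR_mulrn ?(ltW xa)// -powRrM; congr (_ `^ _); ring.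
have k0 : 0 < 4 * alpha + 1 by move: alpha_gt0; lra.
apply: (le_powR_inv k0 (ler0n _ _) (powR_ge0 _ _)).
have n2 : 0 <= n%:R ^+ 2 :> R by exact: sqr_ge0.
have n2p : 0 <= n%:R ^+ 2 * p%:R :> R by exact: mulr_ge0.
rewrite powRAC xE (powRM _ n2p C0) (powRM _ n2 (ler0n _ _)).
have -> : (n%:R ^+ 2) `^ (2 * alpha) = n%:R `^ (4 * alpha) :> R.
  by rewrite -[n%:R ^+ 2]powR_mulrn// -powRrM; congr (_ `^ _); ring.
rewrite powRD; last by rewrite n0' implybT.
rewrite powRr1 ?ler0n// -mulrA ler_wpM2l ?powR_ge0//.
by move: h; rewrite ler_pdivrMr// mulrC.
Qed.

(** Raised to the power 4 alpha + 1 and divided by p, the claim is a bound on n^2 / p^(4 alpha). *)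
Lemma scale_le_p n p : (0 < n)%N -> (0 < p)%N ->
  4 `^ (4 * alpha + 1) * C * (n%:R / p%:R `^ (2 * alpha)) ^+ 2 <= 1 -> 4 * scale n p <= p%:R.
Proof.
move=> n0 p0 h; have x0 := scale_ge0 n p.
move: (scale n p) (scale_pow n p) x0 => x xE x0.
have k0 : 0 < 4 * alpha + 1 by move: alpha_gt0; lra.
have x40 : 0 <= 4 * x by exact: mulr_ge0.
apply: (le_powR_inv k0 x40 (ler0n _ _)).
have pp : 0 < p%:R :> R by rewrite ltr0n.
have np : 0 < p%:R `^ (2 * alpha) :> R by rewrite powR_gt0.
have pE : p%:R `^ (4 * alpha + 1) = (p%:R `^ (2 * alpha)) ^+ 2 * p%:R :> R.
  rewrite powRD; last by rewrite (gt_eqF pp) implybT.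
  rewrite powRr1// -powR_mulrn ?(ltW np)// -powRrM; congr (_ `^ _ * _); ring.
rewrite pE powRM// xE.
move: h; rewrite expr_div_n [_ * (_ / _)]mulrA ler_pdivrMr ?exprn_gt0// mul1r => h.
have -> : 4 `^ (4 * alpha + 1) * (n%:R ^+ 2 * p%:R * C) =
  4 `^ (4 * alpha + 1) * C * n%:R ^+ 2 * p%:R by ring.
by rewrite ler_pM2r.
Qed.

Lemma scale_ge n p A : (0 < p)%N -> 0 <= A -> A `^ (4 * alpha + 1) / C <= n%:R ^+ 2 ->
  A <= scale n p.
Proof.
move=> p0 A0; have C0 := rate_const_gt0.
rewrite ler_pdivrMr// => h.
have k0 : 0 < 4 * alpha + 1 by move: alpha_gt0; lra.
apply: (le_powR_inv k0 A0 (scale_ge0 _ _)).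
rewrite scale_pow; apply: (le_trans h); rewrite ler_pM2r// ler_peMr ?sqr_ge0//.
by rewrite ler1n.
Qed.
End scale.

(** * Bounds on the risk and choice of the parameters *)

Lemma risk_ge0 (R : realType) n p (D : n.-tuple (p.-tuple R) -> R) (A : set 'M[R]_p) :
  is_test D -> 0 <= risk D A.
Proof.
move=> tD; rewrite /risk addr_ge0//; first by have /andP[] := expect_itv 1%:M tD.
have [[S AS]|no] := pselect (A !=set0); last first.
  by rewrite (_ : A = set0) ?image_set0 ?sup0//; apply/eqP; apply: contra_notT no => /set0P.
have b (S' : 'M[R]_p) : 0 <= expect S' (fun x => 1 - D x) <= 1 by exact/expect_itv/is_testC.
have /andP[h _] := b S; apply: (le_trans h).
apply: ub_le_sup; last by exists S.
by exists 1 => _ [S' _ <-]; have /andP[] := b S'.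
Qed.

(** The test that always accepts has risk at most 1. *)
Lemma minimax_risk_le1 (R : realType) n p (A : set 'M[R]_p) : minimax_risk n A <= 1.
Proof.
have t0 : is_test (fun _ : n.-tuple (p.-tuple R) => 0 : R).
  by split => [|x]; [exact: measurable_cst|rewrite lexx ler01].
have E0 S : expect S (fun _ : n.-tuple (p.-tuple R) => 0 : R) = 0.
  by rewrite /expect expectation_cst.
apply: (@le_trans _ _ (risk (fun _ : n.-tuple (p.-tuple R) => 0) A)).
  apply: ge_inf; last by exists (fun=> 0).
  by exists 0 => _ [D tD <-]; exact: risk_ge0.
rewrite /risk E0 add0r.
have [[S AS]|no] := pselect (A !=set0); last first.
  rewrite (_ : A = set0) ?image_set0 ?sup0//; apply/eqP; apply: contra_notT no => /set0P//.
apply: ge_sup; first by exists (expect S (fun _ : n.-tuple _ => 1 - 0)), S.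
move=> _ [S' _ <-].
by have /andP[] := expect_itv S' (is_testC t0).
Qed.

Lemma minimax_risk_ge (R : realType) n p (A : set 'M[R]_p) (r : R) :
  (forall D : n.-tuple (p.-tuple R) -> R, is_test D -> r <= risk D A) -> r <= minimax_risk n A.
Proof.
move=> h; apply: lb_le_inf; last by move=> _ [D tD <-]; exact: h.
exists (risk (fun _ : n.-tuple (p.-tuple R) => 0) A), (fun=> 0) => //.
by split => [|x]; [exact: measurable_cst|rewrite lexx ler01].
Qed.

Lemma le_expR_twice (R : realType) (v : R) : 0 <= v -> v <= 1 / 2 -> expR v - 1 <= 2 * v.
Proof.
move=> v0 v1; have := expR_ge1Dx (- v); rewrite expRN => h.
have e0 := expR_gt0 v; have : (1 - v) * expR v <= 1.
  by rewrite -ler_pdivlMr// div1r.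
by nra.
Qed.

Section block_index.
Context (p B T : nat) (BTp : (2 * T * B <= p)%N).

Lemma block_index_subproof (b : 'I_B) (h : bool) (r : 'I_T) : (2 * T * b + T * h + r < p)%N.
Proof.
have := ltn_ord b; have := ltn_ord r; have : (T * h <= T)%N by case: h; rewrite ?muln1 ?muln0.
nia.
Qed.

Definition block_index b h r := Ordinal (block_index_subproof b h r).

Lemma block_index_inj b h r b' h' r' : block_index b h r = block_index b' h' r' ->
  [/\ b = b', h = h' & r = r'].
Proof.
move=> /(congr1 val) /= E; have rT := ltn_ord r; have rT' := ltn_ord r'.
have bE : b = b' :> nat.
  by case: h h' E => -[] /=; rewrite ?muln1 ?muln0 => E; nia.
have hE : h = h' by move: E; rewrite bE; case: h h' => -[] //=; rewrite ?muln1 ?muln0; nia.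
by split => //; apply: val_inj => //=; move: E; rewrite bE hE; lia.
Qed.

Lemma block_index_dist (R : realDomainType) b h r h' r' :
  `|(block_index b h r)%:R - (block_index b h' r')%:R| <= (2 * T)%:R :> R.
Proof.
have rT := ltn_ord r; have rT' := ltn_ord r'.
have hT : (T * h <= T)%N by case: h; rewrite ?muln1 ?muln0.
have hT' : (T * h' <= T)%N by case: h'; rewrite ?muln1 ?muln0.
rewrite ler_norml lerBlDr -natrD ler_nat lerNl opprB lerBlDr -natrD ler_nat /=.
by apply/andP; split; lia.
Qed.
End block_index.

(** With B = p %/ (2 T) >= 1, p < 2 T (B + 1) <= 4 T B. *)
Lemma leq_block_count (p T : nat) : (0 < T)%N -> (4 * T <= p)%N ->
  (p <= 4 * T * (p %/ (2 * T)))%N.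
Proof.
move=> T0 Tp; have T20 : (0 < 2 * T)%N by rewrite muln_gt0.
have := ltn_ceil p T20; have : (1 <= p %/ (2 * T))%N by rewrite divn_gt0//; lia.
by move: (p %/ (2 * T))%N => B; nia.
Qed.

(** The choice eta = eps in [prior_risk_ge] makes each of the two losses at most eps / 2. *)
Lemma chi2_bound (R : realType) (v eps : R) : 0 < eps -> eps <= 1 ->
  0 <= v -> v <= eps ^+ 2 / 2 -> 1 - eps <= 1 - eps / 2 - (expR v - 1) / (2 * eps).
Proof.
move=> e0 e1 v0 v2; have v1 : v <= 1 / 2 by nra.
have e20 : 0 < 2 * eps by rewrite mulr_gt0.
have : (expR v - 1) / (2 * eps) <= eps / 2.
  rewrite ler_pdivrMr//; apply: (le_trans (le_expR_twice v0 v1)).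
  by move: v2; nra.
lra.
Qed.

(** The conditions on [r], the ratio of the separation to the rate, are left explicit, so that the
    asymptotic statement only has to make [r] small. *)
Lemma lower_bound_at (R : realType) (alpha L lambda eps x C r phi : R) (n p : nat)
    (D : n.-tuple (p.-tuple R) -> R) :
  1 / 2 <= alpha -> 0 < C -> (0 < n)%N -> (0 < p)%N -> 2 <= x -> 4 * x <= p%:R ->
  phi = (x `^ alpha)^-1 -> n%:R ^+ 2 * p%:R * phi ^+ 4 = x / C -> n%:R * phi ^+ 2 <= 1 ->
  0 <= r -> 4 * r <= 1 / 2 -> 4 * r <= 1 - lambda -> 16 * r ^+ 2 <= 1 / 32 ->
  16 * 2 `^ (2 * alpha) * r ^+ 2 <= L -> 0 < eps -> eps <= 1 -> 4096 * r ^+ 4 / C <= eps ^+ 2 / 2 ->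
  is_test D -> 1 - eps <= risk D (alternative alpha L lambda (r * phi)).
Proof.
move=> al C0 n0 p0 x2 xp phiE phi4 nphi r0 r1 r2 r3 r4 e0 e1 r5 tD.
have x0 : 0 < x by lra.
have x1 : 1 <= x by lra.
have a2 : 2^-1 <= alpha by lra.
have al0 : 0 <= alpha by lra.
have a20 : 0 <= 2 * alpha by lra.
have xa0 : 0 < x `^ alpha by exact: powR_gt0.
have phi0 : 0 < phi by rewrite phiE invr_gt0.
pose T := Num.truncn x; pose B := (p %/ (2 * T))%N.
have /andP[Tx xT] : T%:R <= x < T.+1%:R by apply: truncn_itv; exact: ltW.
have T1 : 1 <= T%:R :> R by move: xT; rewrite -natr1; lra.
have T2 : x / 2 <= T%:R by move: xT; rewrite -natr1; lra.
have T0 : 0 < T%:R :> R by lra.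
have T0n : (0 < T)%N by rewrite -(ltr0n R).
have T4p : (4 * T <= p)%N by rewrite -(ler_nat R) natrM; lra.
have BTn : (2 * T * B <= p)%N by rewrite mulnC /B leq_trunc_div.
have pBTn : (p <= 4 * T * B)%N by exact: leq_block_count.
clearbody B T.
(* s^2 T = 16 psi^2, because the separation asks for 4 p psi^2 <= s^2 T^2 B and only p <= 4 T B is
   known. *)
pose psi := r * phi; pose s := 4 * psi / Num.sqrt T%:R.
have sT0 : 0 < Num.sqrt T%:R :> R by rewrite sqrtr_gt0.
have sTT : Num.sqrt T%:R ^+ 2 = T%:R :> R by rewrite sqr_sqrtr ?ltW.
have psi0 : 0 <= psi by rewrite /psi mulr_ge0 ?(ltW phi0).
have s0 : 0 <= s by rewrite /s; apply: divr_ge0; [exact: mulr_ge0|exact: sqrtr_ge0].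
have s2T : s ^+ 2 * T%:R = 16 * psi ^+ 2.
  by rewrite /s expr_div_n sTT divfK ?gt_eqF//; ring.
(* s T = 4 psi sqrt T <= 4 r x^(1/2 - alpha), at most 4 r since x >= 1 and alpha >= 1/2; this makes
   the perturbation small as an operator. *)
have sTr : s * T%:R <= 4 * r.
  have -> : s * T%:R = 4 * psi * Num.sqrt T%:R.
    by rewrite /s -[in X in _ * X = _]sTT; field; rewrite gt_eqF.
  rewrite /psi mulrA -mulrA ler_piMr ?mulr_ge0// phiE mulrC ler_pdivrMr// mul1r.
  rewrite -powR12_sqrt ?(ltW T0)//; apply: (@le_trans _ _ (x `^ 2^-1)).
    by apply: ge0_ler_powR; rewrite ?nnegrE ?invr_ge0 ?(ltW x0).
  by apply: ler_powR.
have npsi : n%:R * psi ^+ 2 <= r ^+ 2.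
  by rewrite /psi exprMn mulrCA ler_piMr ?sqr_ge0.
have nsT : n%:R * s ^+ 2 * T%:R <= 1 / 32 by rewrite -mulrA s2T; lra.
have BT : 2 * T%:R * B%:R <= p%:R :> R by rewrite -!natrM ler_nat.
have pBT : p%:R <= 4 * T%:R * B%:R :> R by rewrite -!natrM ler_nat.
have phi2 : phi ^+ 2 * x `^ (2 * alpha) = 1.
  rewrite [2 * alpha]mulrC powRrM powR_mulrn ?(ltW xa0)// phiE -exprMn mulVf ?gt_eqF//.
  by rewrite expr1n.
have smooth : s ^+ 2 * T%:R * (2 * T)%:R `^ (2 * alpha) <= L.
  rewrite s2T; apply: le_trans r4.
  have h : (2 * T)%:R `^ (2 * alpha) <= 2 `^ (2 * alpha) * x `^ (2 * alpha).
    rewrite natrM powRM ?(ltW T0)// ler_wpM2l ?powR_ge0//.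
    by apply: ge0_ler_powR; rewrite ?nnegrE ?(ltW x0) ?(ltW T0).
  apply: (@le_trans _ _ (16 * psi ^+ 2 * (2 `^ (2 * alpha) * x `^ (2 * alpha)))).
    by rewrite ler_wpM2l// mulr_ge0// sqr_ge0.
  rewrite /psi exprMn le_eqVlt; apply/orP; left; apply/eqP.
  transitivity (16 * 2 `^ (2 * alpha) * r ^+ 2 * (phi ^+ 2 * x `^ (2 * alpha))); first by ring.
  by rewrite phi2 mulr1.
have psiE : 4 * p%:R * psi ^+ 2 <= s ^+ 2 * T%:R ^+ 2 * B%:R.
  have -> : s ^+ 2 * T%:R ^+ 2 * B%:R = 4 * (4 * T%:R * B%:R) * psi ^+ 2.
    by rewrite [T%:R ^+ 2]expr2 mulrA s2T; ring.
  by rewrite ler_wpM2r ?sqr_ge0// ler_wpM2l.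
(* B <= p / (2 T) <= p / x and psi = r phi turn the exponent into 4096 r^4 n^2 p phi^4 / x = 4096
   r^4 / C. *)
have v : 16 * (n%:R * s ^+ 2 * T%:R) ^+ 2 * B%:R <= eps ^+ 2 / 2.
  apply: le_trans r5; rewrite -[n%:R * _ * _]mulrA s2T.
  have Bx : B%:R <= p%:R / x by rewrite ler_pdivlMr//; move: BT T2 (ler0n R B); nra.
  apply: (@le_trans _ _ (16 * (n%:R * (16 * psi ^+ 2)) ^+ 2 * (p%:R / x))).
    by rewrite ler_wpM2l// mulr_ge0// sqr_ge0.
  rewrite /psi le_eqVlt; apply/orP; left; apply/eqP.
  transitivity (4096 * r ^+ 4 * (n%:R ^+ 2 * p%:R * phi ^+ 4) / x).
    by field; rewrite gt_eqF.
  by rewrite phi4; field; rewrite !gt_eqF.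
apply: le_trans (prior_risk_ge (@block_index_inj p B T BTn) n0 p0 s0 al0
  (le_trans sTr r1) (le_trans sTr r2) nsT BT (@block_index_dist p B T BTn R) smooth psiE e0 tD).
have v0 : 0 <= 16 * (n%:R * s ^+ 2 * T%:R) ^+ 2 * B%:R.
  by apply: mulr_ge0 => //; apply: mulr_ge0 => //; exact: sqr_ge0.
exact: chi2_bound.
Qed.

Lemma leq_4half (n : nat) : (1 < n)%N -> (n <= 4 * n./2)%N.
Proof. lia. Qed.

Lemma upper_bound_at (R : realType) (alpha L lambda eps x C r phi delta kappa t : R) (n p T : nat) :
  0 <= alpha -> 0 < lambda -> 0 < C -> (1 < n)%N -> (0 < p)%N -> 1 <= x ->
  phi = (x `^ alpha)^-1 -> n%:R ^+ 2 * p%:R * phi ^+ 4 = x / C -> 0 < r ->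
  T = (Num.truncn x).+1 -> t = n./2%:R ^+ 2 * p%:R * (lambda * (r * phi)) ^+ 2 / 2 ->
  2 * L <= (lambda * r) ^+ 2 -> 0 < eps -> delta = eps / 16 ->
  kappa = eps / 4 / (128 + 68 * (delta^-1 + 1)) ->
  32 * C / (lambda * r) ^+ 4 <= kappa -> 32 / n./2%:R ^+ 2 <= kappa ->
  risk (@band_test R n p T t) (alternative alpha L lambda (r * phi)) <= eps / 2.
Proof.
move=> al la C0 n1 p0 x1 phiE phi4 r0 TE tE r1 e0 dE kE k1 k2.
have x0 : 0 < x by lra.
have xa0 : 0 < x `^ alpha by exact: powR_gt0.
have phi0 : 0 < phi by rewrite phiE invr_gt0.
have /andP[Tx xT] : (Num.truncn x)%:R <= x < (Num.truncn x).+1%:R by apply: truncn_itv; exact: ltW.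
rewrite -TE in xT; have T2 : T%:R <= 2 * x by rewrite TE -natr1; lra.
have T0 : (0 < T)%N by rewrite TE.
have pR : 0 < p%:R :> R by rewrite ltr0n.
have m0 : 0 < n./2%:R :> R by rewrite ltr0n half_gt0.
have m4 : n%:R <= 4 * n./2%:R :> R by rewrite -natrM ler_nat leq_4half.
have phi2 : phi ^+ 2 * x `^ (2 * alpha) = 1.
  rewrite [2 * alpha]mulrC powRrM powR_mulrn ?(ltW xa0)// phiE -exprMn mulVf ?gt_eqF//.
  by rewrite expr1n.
have d0 : 0 < delta by rewrite dE divr_gt0.
have psi0 : 0 < r * phi by exact: mulr_gt0.
(* T > x gives T^(2 alpha) phi^2 >= 1, so the bandwidth condition only involves lambda r. *)
have hL : 2 * L <= T%:R `^ (2 * alpha) * (lambda * (r * phi)) ^+ 2.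
  apply: (le_trans r1).
  have -> : (lambda * (r * phi)) ^+ 2 = (lambda * r) ^+ 2 * phi ^+ 2 by ring.
  rewrite mulrCA ler_peMr ?sqr_ge0// mulrC -[leLHS]phi2 ler_wpM2l ?sqr_ge0//.
  by apply: ge0_ler_powR; rewrite ?nnegrE ?mulr_ge0//; lra.
apply: (le_trans (band_test_risk p0 n1 T0 al la psi0 d0 hL tE erefl)).
set xi := T%:R / _; set m := n./2%:R in m0 m4 k2 xi *.
(* T <= 2 x and n <= 4 m cost a factor 32, and n^2 p phi^4 = x / C. *)
have xik : xi <= kappa.
  apply: le_trans k1.
  have D0 : 0 < m ^+ 2 * p%:R * (lambda * (r * phi)) ^+ 4.
    by rewrite !mulr_gt0 ?exprn_gt0// !mulr_gt0.
  rewrite /xi ler_pdivrMr//.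
  have -> : 32 * C / (lambda * r) ^+ 4 * (m ^+ 2 * p%:R * (lambda * (r * phi)) ^+ 4)
      = 2 * C * ((4 * m) ^+ 2 * (p%:R * phi ^+ 4)) by field; rewrite !gt_eqF.
  apply: (@le_trans _ _ (2 * C * (n%:R ^+ 2 * (p%:R * phi ^+ 4)))).
    by rewrite [n%:R ^+ 2 * _]mulrA phi4 -mulrA (mulrC C) divfK ?gt_eqF.
  rewrite ler_wpM2l ?mulr_ge0 ?(ltW C0)// ler_wpM2r ?mulr_ge0 ?exprn_ge0 ?(ltW phi0)//.
  by rewrite ler_sqr ?nnegrE//; lra.
have K0 : 0 < delta^-1 + 1 by rewrite addr_gt0 ?invr_gt0.
(* As 16 xi + 32 / m^2 <= 17 kappa, the risk is at most kappa (128 + 68 (1 / delta + 1)) + 4 delta;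
   [kappa] and [delta] make each part eps / 4. *)
have kK : kappa * (128 + 68 * (delta^-1 + 1)) = eps / 4.
  by rewrite kE divfK// gt_eqF//; lra.
have : (delta^-1 + 1) * (16 * xi + 32 / m ^+ 2) <= (delta^-1 + 1) * (17 * kappa).
  by rewrite ler_pM2l//; lra.
move: kK xik dE; move: (32 / _) => u; move: (delta^-1 + 1) => K; nra.
Qed.

Lemma eventually_ge (R : realType) (f : nat -> nat) (A : R) :
  f k @[k --> \oo] --> \oo -> \forall k \near \oo, A <= (f k)%:R.
Proof.
move=> /cvgnyPge /(_ (Num.truncn A).+1); apply: filterS => k.
rewrite -(ler_nat R); apply: le_trans.
have [A0|A0] := leP 0 A; last by rewrite ltW// (lt_le_trans A0).
by have /andP[_ /ltW] := truncn_itv A0.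
Qed.

(** The growth of n alone makes the scale large; n = o(p^(2 alpha)) gives the last two conditions,
    segments short compared with p and n rate^2 bounded. *)
Lemma eventually_regime (R : realType) (alpha L A : R) (n p : nat -> nat) :
  0 < alpha -> 0 < L -> 0 <= A ->
  n k @[k --> \oo] --> \oo -> p k @[k --> \oo] --> \oo ->
  (n k)%:R / (p k)%:R `^ (2 * alpha) @[k --> \oo] --> (0 : R) ->
  \forall k \near \oo, [/\ (1 < n k)%N, (0 < p k)%N, A <= scale alpha L (n k) (p k),
    4 * scale alpha L (n k) (p k) <= (p k)%:R & (n k)%:R * rate alpha L (n k) (p k) ^+ 2 <= 1].
Proof.
move=> al0 L0 A0 ny py; set q := (fun k => _ / _) => q0.
have C0 := rate_const_gt0 al0 L0; set C := rate_const alpha L in C0.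
have E1 : 0 < C `^ (2 * alpha) by exact: powR_gt0.
pose K := 4 `^ (4 * alpha + 1) * C.
have K0 : 0 < K by rewrite mulr_gt0// powR_gt0.
have E2 : 0 < (K + 1)^-1 by rewrite invr_gt0; lra.
have [h1 h2] : (\forall k \near \oo, `|q k| <= C `^ (2 * alpha)) /\
    (\forall k \near \oo, `|q k| <= (K + 1)^-1).
  by split; move/cvgr0Pnorm_le : q0; exact.
near=> k.
have n1 : (1 < n k)%N by rewrite -(ler_nat R); near: k; exact: eventually_ge.
have p0 : (0 < p k)%N by rewrite -(ler_nat R); near: k; exact: eventually_ge.
have n0 := ltnW n1.
have nA : A `^ (4 * alpha + 1) / C <= (n k)%:R by near: k; exact: eventually_ge.
have q1 : `|q k| <= C `^ (2 * alpha) by near: k.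
have q2 : `|q k| <= (K + 1)^-1 by near: k.
have qk : 0 <= q k by rewrite /q divr_ge0// powR_ge0.
rewrite ger0_norm// in q1; rewrite ger0_norm// in q2.
split => //.
- apply: scale_ge => //; apply: (le_trans nA).
  by rewrite expr2 ler_peMr// ler1n.
- apply: scale_le_p => //; rewrite -/(q k) -/C -/K.
  (* This yields K q <= 1 and q <= 1 at once, hence K q^2 <= 1. *)
  have h : (K + 1) * q k <= 1 by rewrite -ler_pdivlMl ?mulr1//; lra.
  have : 0 <= K * q k by rewrite mulr_ge0// ltW.
  by move: K0 qk h; clear; move: (q k) => y; nra.
- exact: n_rate2_le.
Unshelve. all: by end_near.
Qed.

Lemma minimax_risk_cvg1 (R : realType) (alpha L lambda : R) (n p : nat -> nat) (psi : nat -> R) :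
  1 / 2 <= alpha -> 0 < L -> lambda < 1 ->
  n k @[k --> \oo] --> \oo -> p k @[k --> \oo] --> \oo ->
  (n k)%:R / (p k)%:R `^ (2 * alpha) @[k --> \oo] --> (0 : R) ->
  (forall k, 0 < psi k) -> psi k / rate alpha L (n k) (p k) @[k --> \oo] --> (0 : R) ->
  minimax_risk (n k) (@alternative R (p k) alpha L lambda (psi k)) @[k --> \oo] --> (1 : R).
Proof.
move=> al L0 la1 ny py q0 psi0 r0; have al0 : 0 < alpha by lra.
have C0 := rate_const_gt0 al0 L0; set C := rate_const alpha L in C0.
apply/cvgrPdist_le => e e0.
(* [chi2_bound] requires eps <= 1. *)
pose eps := Num.min e 1; have eps0 : 0 < eps by rewrite lt_min e0 ltr01.
have eps1 : eps <= 1 by rewrite ge_min lexx orbT.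
have epse : eps <= e by rewrite ge_min lexx.
clearbody eps.
(* Thresholds linear in [r] suffice, because r <= 1 gives r^4 <= r^2 <= r. Here 512 = 16 * 32, and
   128 * 64 = 2 * 4096. *)
have A1 : 0 < 1 / 512 :> R by lra.
have A2 : 0 < (1 - lambda) / 4 by lra.
have h16 : 0 < 16 * 2 `^ (2 * alpha) :> R by rewrite mulr_gt0// powR_gt0.
have A3 : 0 < L / (16 * 2 `^ (2 * alpha)) by exact: divr_gt0.
have A4 : 0 < C * eps ^+ 2 / 128 / 64 by rewrite divr_gt0// divr_gt0// mulr_gt0// exprn_gt0.
move/cvgr0Pnorm_le : r0 => r0.
have B1 := r0 _ A1; have B2 := r0 _ A2; have B3 := r0 _ A3; have B4 := r0 _ A4.
have B5 := eventually_regime al0 L0 (ler0n R 2) ny py q0.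
near=> k.
have [n1 p0 x2 xp nphi] : [/\ (1 < n k)%N, (0 < p k)%N, 2 <= scale alpha L (n k) (p k),
    4 * scale alpha L (n k) (p k) <= (p k)%:R & (n k)%:R * rate alpha L (n k) (p k) ^+ 2 <= 1].
  by near: k.
have n0 := ltnW n1.
have phi0 : 0 < rate alpha L (n k) (p k).
  by rewrite rateE// invr_gt0; apply: powR_gt0; exact: scale_gt0.
pose r := psi k / rate alpha L (n k) (p k).
have rE : psi k = r * rate alpha L (n k) (p k) by rewrite /r divfK ?gt_eqF.
have rk0 : 0 <= r by rewrite divr_ge0// ltW.
have r1 : r <= 1 / 512 by apply: le_trans (ler_norm _) _; rewrite /r; near: k.
have r2 : r <= (1 - lambda) / 4 by apply: le_trans (ler_norm _) _; rewrite /r; near: k.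
have r3 : r <= L / (16 * 2 `^ (2 * alpha)) by apply: le_trans (ler_norm _) _; rewrite /r; near: k.
have r4 : r <= C * eps ^+ 2 / 128 / 64 by apply: le_trans (ler_norm _) _; rewrite /r; near: k.
rewrite ger0_norm ?subr_ge0 ?minimax_risk_le1//.
suff : 1 - eps <= minimax_risk (n k) (@alternative R (p k) alpha L lambda (psi k)).
  by move: epse; lra.
rewrite rE; clearbody r.
apply: minimax_risk_ge => D tD.
have rr : r ^+ 2 <= r by rewrite expr2 ler_piMl//; lra.
have rr4 : r ^+ 4 <= r.
  by apply: le_trans rr; rewrite ler_wiXn2l//; lra.
apply: (@lower_bound_at R alpha L lambda eps (scale alpha L (n k) (p k)) C) => //.
- exact: rateE.
- exact: rate4.
- lra.
- lra.
- lra.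
- rewrite -ler_pdivlMl// mulrC; exact: le_trans r3.
- by rewrite ler_pdivrMr//; lra.
Unshelve. all: by end_near.
Qed.

Lemma band_test_risk_cvg0 (R : realType) (alpha L lambda : R) (n p : nat -> nat) (psi : nat -> R) :
  0 < alpha -> 0 < L -> 0 < lambda ->
  n k @[k --> \oo] --> \oo -> p k @[k --> \oo] --> \oo ->
  (n k)%:R / (p k)%:R `^ (2 * alpha) @[k --> \oo] --> (0 : R) ->
  (forall k, 0 < psi k) -> psi k / rate alpha L (n k) (p k) @[k --> \oo] --> +oo ->
  risk (@band_test R (n k) (p k) (Num.truncn (scale alpha L (n k) (p k))).+1
      ((n k)./2%:R ^+ 2 * (p k)%:R * (lambda * psi k) ^+ 2 / 2))
    (alternative alpha L lambda (psi k)) @[k --> \oo] --> (0 : R).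
Proof.
move=> al0 L0 la0 ny py q0 psi0 /cvgryPge ry.
have C0 := rate_const_gt0 al0 L0; set C := rate_const alpha L in C0.
apply/cvgr0Pnorm_le => e e0.
pose delta := e / 16; pose kappa := e / 4 / (128 + 68 * (delta^-1 + 1)).
have d0 : 0 < delta by rewrite divr_gt0.
have k0 : 0 < kappa.
  rewrite /kappa divr_gt0// ?divr_gt0//; have : 0 < delta^-1 by rewrite invr_gt0.
  by lra.
(* Once lambda r >= 1, its square and fourth power exceed it, so lower bounds linear in lambda r
   suffice. *)
have B1 := ry (lambda^-1); have B2 := ry (2 * L / lambda); have B3 := ry (32 * C / kappa / lambda).
have B4 := eventually_ge (4 * (32 / kappa)) ny.
have B5 := eventually_regime al0 L0 ler01 ny py q0.
near=> k.
have [n1 p0 x1 _ _] : [/\ (1 < n k)%N, (0 < p k)%N, 1 <= scale alpha L (n k) (p k),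
    4 * scale alpha L (n k) (p k) <= (p k)%:R & (n k)%:R * rate alpha L (n k) (p k) ^+ 2 <= 1].
  by near: k.
have n0 := ltnW n1.
have phi0 : 0 < rate alpha L (n k) (p k).
  by rewrite rateE// invr_gt0; apply: powR_gt0; exact: scale_gt0.
pose r := psi k / rate alpha L (n k) (p k).
have rE : psi k = r * rate alpha L (n k) (p k) by rewrite /r divfK ?gt_eqF.
have r0 : 0 < r by rewrite divr_gt0.
have r1 : 1 <= lambda * r by rewrite -ler_pdivrMl// mulr1 /r; near: k.
have r2 : 2 * L <= lambda * r by rewrite (mulrC lambda) -ler_pdivrMr// /r; near: k.
have r3 : 32 * C / kappa <= lambda * r.
  by rewrite (mulrC lambda) -ler_pdivrMr// /r; near: k.
have nk : 4 * (32 / kappa) <= (n k)%:R by near: k.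
rewrite ger0_norm; last exact: risk_ge0 (band_test_is_test _ _ _ _).
suff : risk (@band_test R (n k) (p k) (Num.truncn (scale alpha L (n k) (p k))).+1
      ((n k)./2%:R ^+ 2 * (p k)%:R * (lambda * psi k) ^+ 2 / 2))
    (alternative alpha L lambda (psi k)) <= e / 2 by move: e0; lra.
rewrite {2}rE; clearbody r.
have le2 : lambda * r <= (lambda * r) ^+ 2 by rewrite expr2 ler_peMl//; lra.
have le4 : lambda * r <= (lambda * r) ^+ 4 by apply: (le_trans le2); rewrite ler_weXn2l.
have l4 : 0 < (lambda * r) ^+ 4 by rewrite exprn_gt0// mulr_gt0.
apply: (@upper_bound_at R alpha L lambda e (scale alpha L (n k) (p k)) C r
  (rate alpha L (n k) (p k)) delta kappa) => //.
- exact: ltW.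
- exact: rateE.
- exact: rate4.
- by rewrite rE.
- exact: le_trans le2.
- rewrite ler_pdivrMr// [kappa * _]mulrC -ler_pdivrMr//; exact: le_trans le4.
- have m1 : 1 <= (n k)./2%:R :> R by rewrite ler1n half_gt0.
  have m0 : 0 < (n k)./2%:R :> R by exact: lt_le_trans m1.
  have m4 : (n k)%:R <= 4 * (n k)./2%:R :> R by rewrite -natrM ler_nat leq_4half.
  rewrite ler_pdivrMr ?exprn_gt0// mulrC -ler_pdivrMr//.
  apply: (@le_trans _ _ (n k)./2%:R); first by move: nk m4; lra.
  by rewrite expr2 ler_peMl// ltW.
Unshelve. all: by end_near.
Qed.

Unset Implicit Arguments.
Theorem theorem5 (R : realType) (alpha L lambda : R) (n p : nat -> nat)
    (alpha_gt : 3 / 2 < alpha) (L_gt0 : 0 < L) (lambda_01 : 0 < lambda < 1)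
    (n_infty : n k @[k --> \oo] --> \oo) (p_infty : p k @[k --> \oo] --> \oo)
    (n_small : (n k)%:R / (p k)%:R `^ (2 * alpha) @[k --> \oo] --> (0 : R)) :
  (forall psi : nat -> R, (forall k, 0 < psi k) ->
     psi k / rate alpha L (n k) (p k) @[k --> \oo] --> (0 : R) ->
     minimax_risk (n k) (@alternative R (p k) alpha L lambda (psi k))
       @[k --> \oo] --> (1 : R)) /\
  (forall psi : nat -> R, (forall k, 0 < psi k) ->
     psi k / rate alpha L (n k) (p k) @[k --> \oo] --> +oo ->
     exists D : forall k, (n k).-tuple ((p k).-tuple R) -> R,
       (forall k, is_test (D k)) /\
       risk (D k) (alternative alpha L lambda (psi k)) @[k --> \oo] --> (0 : R)).
Proof.
have al0 : 0 < alpha by move: alpha_gt; lra.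
have al2 : 1 / 2 <= alpha by move: alpha_gt; lra.
have /andP[la0 la1] := lambda_01.
split=> [psi psi0 r0|psi psi0 ry]; first exact: minimax_risk_cvg1.
(* The bandwidth is tied to the rate; only the threshold depends on [psi]. *)
exists (fun k => band_test (Num.truncn (scale alpha L (n k) (p k))).+1
      ((n k)./2%:R ^+ 2 * (p k)%:R * (lambda * psi k) ^+ 2 / 2)).
split=> [k|]; first exact: band_test_is_test.
exact: band_test_risk_cvg0.
Qed.
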